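(* The following decision problem is NP-complete: given a finite set $E$, an explicitly listed family $\mathcal{P} \subseteq 2^E$ with $|P| = 3$ for all $P \in\mathcal{P}$, and marginals $\rho\in[0,1]^E$, decide whether there is a feasible decomposition of $\rho$ for $(E,\mathcal{P},\pi)$ with requirement vector $\pi_P = 1$ for all $P\in\mathcal{P}$.
   Context: A feasible decomposition of $\rho$ for $(E,\mathcal{P},\pi)$ is a vector $x \in \mathbb{R}^{2^E}$ with $x_S \ge 0$ for all $S\subseteq E$, $\sum_S x_S = 1$, $\sum_{S : e \in S} x_S = \rho_e$ for all $e\in E$, and $\sum_{S : S\cap P \ne\emptyset} x_S \ge \pi_P$ for all $P\in\mathcal{P}$. *)

(* Defs.v *)
From HB Require Import structures.
From mathcomp Require Import all_boot all_order all_algebra.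
From mathcomp Require Import reals.

Set Implicit Arguments.
Unset Strict Implicit.
Unset Printing Implicit Defensive.

Import Order.TTheory GRing.Theory Num.Theory.

(* The tape alphabet: [None] is the blank, [Some (inl b)] an input bit and
   [Some (inr a)] an additional work symbol. *)
Definition tape_symbol (A : finType) : finType := option (bool + A)%type.

Inductive direction := MoveLeft | Stay | MoveRight.

Record machine := Machine {
  last_tape : nat;  (* there are last_tape.+1 >= 1 tapes *)
  work_symbol : finType;
  state : finType;
  start : state;
  halting : pred state;
  transition :
    state -> {ffun 'I_last_tape.+1 -> tape_symbol work_symbol} ->
    state * {ffun 'I_last_tape.+1 -> tape_symbol work_symbol * direction}
}.

(* A two-way infinite tape with finitely many visited cells: the cells to the
   left of the head (nearest first), the scanned cell, and the cells to the
   right of the head (nearest first); every cell not listed is blank. *)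
Record tape (A : finType) := Tape {
  left_cells : seq (tape_symbol A);
  scanned : tape_symbol A;
  right_cells : seq (tape_symbol A)
}.

Definition write_move (A : finType) (t : tape A)
    (act : tape_symbol A * direction) : tape A :=
  let: Tape l _ r := t in
  let: (a, d) := act in
  match d with
  | MoveLeft => Tape (behead l) (head None l) (a :: r)
  | Stay => Tape l a r
  | MoveRight => Tape (a :: l) (head None r) (behead r)
  end.

Record configuration (M : machine) := Configuration {
  current : state M;
  tapes : {ffun 'I_(last_tape M).+1 -> tape (work_symbol M)}
}.

Definition step (M : machine) (c : configuration M) : configuration M :=
  if halting (current c) then c else
  let: (q, acts) := transition (current c) [ffun i => scanned (tapes c i)] in
  Configuration q [ffun i => write_move (tapes c i) (acts i)].

Definition input_tape (A : finType) (w : seq bool) : tape A :=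
  let s : seq (tape_symbol A) := [seq Some (inl b) | b <- w] in
  Tape [::] (head None s) (behead s).

(* The input is on tape 0, whose head scans the first bit. *)
Definition initial (M : machine) (w : seq bool) : configuration M :=
  Configuration (start M)
    [ffun i => input_tape (work_symbol M) (if i == ord0 then w else [::])].

Fixpoint leading_bits (A : finType) (s : seq (tape_symbol A)) : seq bool :=
  if s is Some (inl b) :: s' then b :: leading_bits s' else [::].

(* The output is the maximal bit string on tape 0 that starts at the head. *)
Definition output (M : machine) (c : configuration M) : seq bool :=
  let t := tapes c ord0 in leading_bits (scanned t :: right_cells t).

Definition run_result (M : machine) (time : nat) (w v : seq bool) : Prop :=
  let c := iter time (@step M) (initial M w) in
  halting (current c) /\ output c = v.

Definition language := seq bool -> Prop.

Definition polytime_computable (f : seq bool -> seq bool) : Prop :=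
  exists (M : machine) (p : {poly nat}), forall w : seq bool,
    exists2 time : nat, time <= p.[size w]%R & run_result M time w (f w).

Definition in_P (L : language) : Prop :=
  exists2 chi : seq bool -> bool,
    polytime_computable (fun w => [:: chi w]) & forall w, L w <-> chi w.

(* Self-delimiting code of a bit string: each bit is preceded by 1, and the
   end is marked by 0. *)
Definition delimited (w : seq bool) : seq bool :=
  flatten [seq [:: true; b] | b <- w] ++ [:: false].

Definition pair_code (w u : seq bool) : seq bool := delimited w ++ u.

Definition in_NP (L : language) : Prop :=
  exists (V : language) (p : {poly nat}), in_P V /\
    forall w, L w <->
      exists2 u : seq bool, size u <= p.[size w]%R & V (pair_code w u).

Definition polytime_reduces (L1 L2 : language) : Prop :=
  exists2 f : seq bool -> seq bool,
    polytime_computable f & forall w, L1 w <-> L2 (f w).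

Definition NP_complete (L : language) : Prop :=
  in_NP L /\ forall L' : language, in_NP L' -> polytime_reduces L' L.

Local Open Scope ring_scope.

(* Only the values of [pi] on members of [P] matter. *)
Definition feasible_decomposition (R : realType) (E : finType)
    (P : {set {set E}}) (pi : {set E} -> R) (rho : E -> R)
    (x : {set E} -> R) : Prop :=
  [/\ forall S : {set E}, 0 <= x S,
      \sum_(S : {set E}) x S = 1,
      forall e : E, \sum_(S : {set E} | e \in S) x S = rho e
    & forall Q : {set E}, Q \in P ->
        \sum_(S : {set E} | S :&: Q != set0) x S >= pi Q].

(* The ground set is E = {0, ..., ground_size - 1}.  The marginal of [e] is the
   rational number rho_num e / rho_den e, not necessarily in lowest terms. *)
Record instance := Instance {
  ground_size : nat;
  family : seq {set 'I_ground_size};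
  family_uniq : uniq family;
  family_card3 : forall P : {set 'I_ground_size}, P \in family -> #|P| = 3%N;
  rho_num : 'I_ground_size -> nat;
  rho_den : 'I_ground_size -> nat;
  rho_den_gt0 : forall e, (0 < rho_den e)%N;
  rho_le1 : forall e, (rho_num e <= rho_den e)%N
}.

Definition marginal (R : realType) (I : instance) (e : 'I_(ground_size I)) : R :=
  (rho_num e)%:R / (rho_den e)%:R.

Definition has_feasible_decomposition (R : realType) (I : instance) : Prop :=
  exists x : {set 'I_(ground_size I)} -> R,
    feasible_decomposition [set P in family I] (fun=> 1) (@marginal R I) x.

(* Binary expansion, least significant bit first, without leading zeros
   (so 0 is the empty string). *)
Fixpoint bits_of_positive (p : BinNums.positive) : seq bool :=
  match p with
  | BinNums.xH => [:: true]
  | BinNums.xO p' => false :: bits_of_positive p'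
  | BinNums.xI p' => true :: bits_of_positive p'
  end.

Definition binary (n : nat) : seq bool :=
  if bin_of_nat n is BinNums.Npos p then bits_of_positive p else [::].

(* |E| in unary; then, for each element of E, the numerator and the denominator
   of its marginal in binary; then the incidence vectors of the members of the
   family, each preceded by 1, with a final 0. *)
Definition encode (I : instance) : seq bool :=
  rcons (nseq (ground_size I) true) false
  ++ flatten [seq delimited (binary (rho_num e)) ++ delimited (binary (rho_den e))
             | e <- enum 'I_(ground_size I)]
  ++ flatten [seq true :: [seq e \in P | e <- enum 'I_(ground_size I)]
             | P : {set 'I_(ground_size I)} <- family I]
  ++ [:: false].

(* Strings that encode no instance are not in the language. *)
Definition decomposition_problem (R : realType) : language :=
  fun w => exists2 I : instance, w = encode I & has_feasible_decomposition R I.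

(* Main.v *)
(** Membership in NP: in a decomposition of minimal support, the incidence
    vectors of the sets used are affinely independent.  By Cramer's rule its
    coefficients then have the common denominator D |det|, where D is the
    product of the denominators of the marginals and det is the determinant of
    a 0/1 matrix of order at most |E| + 1.  So they have polynomially many
    bits, and a certificate can list sets weighted by powers of two.

    Hardness: each boolean variable x becomes two elements of marginal 1/2
    forming a triple with an element of marginal 0, so that each set used by a
    decomposition picks exactly one of x and its negation.  A clause a \/ b \/ c
    becomes the triples {a, b, y} and {~ y, c, ~ m}, where y is fresh and m is
    common to all clauses.  Some set used by a decomposition contains m, and it
    is a satisfying assignment.  Conversely, a satisfying assignment with m
    true and y = ~ (a \/ b), together with its complement, hits every triple,
    and the average of the two has the required marginals.  The clauses are
    those of the Cook-Levin theorem: the computation of the verifier on a word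
    whose second half is free is forced by implications between at most three
    literals, with cells indexed by their distance to the head.

    Polynomial-time functions are built by closure properties of functions on
    binary trees.  A tree is kept as its prefix code on top of a stack, and
    stack programs are compiled into Turing machines with four tapes. *)

Require Import Defs.
From HB Require Import structures.
From mathcomp Require Import all_boot all_order all_algebra.
From mathcomp Require Import perm boolp reals.
From mathcomp Require Import zify.

Set Implicit Arguments.
Unset Strict Implicit.
Unset Printing Implicit Defensive.

Import Order.TTheory GRing.Theory Num.Theory.

(** * Stack programs and their compilation *)

(** Since the weights sum to 1, requirement 1 says that every set of positive weight hits every
    triple; both halves of the proof rest on this. A satisfying assignment alone does not give
    marginals 1/2, and its complement may violate clauses. Splitting a clause repairs this: the
    complement contains ~ m and so hits {~ y, c, ~ m}, while the choice of y lets the assignment and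
    its complement both hit {a, b, y}. The clauses for a computation derive each step from the
    previous one. Hence every solution makes true whatever happens in the actual run; other
    variables are not forced to be false, and no clause says that a cell holds one symbol only.
    Counting cells from the head dispenses with variables for its position: a rule involves the
    state, the scanned symbols and one more cell. On the side of machines, all iteration goes
    through a fold along a list whose intermediate results stay polynomial. Numbers are coded in
    unary there, so the exponentially large weights of a certificate are handled as lists of
    exponents or as bit strings. *)

Definition store : Type := seq bool * seq bool * seq bool * seq bool.

Definition get (s : store) (r : 'I_4) : seq bool :=
  let: (s0, s1, s2, s3) := s in
  match val r with 0 => s0 | 1 => s1 | 2 => s2 | _ => s3 end.

Definition set_reg (s : store) (r : 'I_4) (v : seq bool) : store :=
  let: (s0, s1, s2, s3) := s in
  match val r with
  | 0 => (v, s1, s2, s3) | 1 => (s0, v, s2, s3)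
  | 2 => (s0, s1, v, s3) | _ => (s0, s1, s2, v)
  end.

Definition R0 : 'I_4 := @Ordinal 4 0 isT.
Definition R1 : 'I_4 := @Ordinal 4 1 isT.
Definition R2 : 'I_4 := @Ordinal 4 2 isT.
Definition R3 : 'I_4 := @Ordinal 4 3 isT.

Lemma get_set (s : store) r v r' :
  get (set_reg s r v) r' = if r' == r then v else get s r'.
Proof.
case: s => [[[s0 s1] s2] s3].
by case: r => [[|[|[|[|]]]] ?] //; case: r' => [[|[|[|[|]]]] ?].
Qed.

Inductive cmd :=
| Push of 'I_4 & bool
| Pop of 'I_4
| Seq of cmd & cmd
| If of 'I_4 & pred (option bool) & cmd & cmd
| Loop of 'I_4 & pred (option bool) & cmd.

Definition peek (s : store) (r : 'I_4) : option bool := ohead (get s r).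

(** Control is the list of commands still to be run. Only finitely many such lists are reachable
    from a given program, so they can serve as states of a machine. *)
Definition stepk (ks : seq cmd * store) : seq cmd * store :=
  let: (k, s) := ks in
  match k with
  | [::] => (k, s)
  | Push r b :: k' => (k', set_reg s r (b :: get s r))
  | Pop r :: k' => (k', set_reg s r (behead (get s r)))
  | Seq c d :: k' => ([:: c, d & k'], s)
  | If r p c d :: k' => ((if p (peek s r) then c else d) :: k', s)
  | Loop r p c :: k' =>
      if p (peek s r) then ([:: c, Loop r p c & k'], s) else (k', s)
  end.

(* All continuations reachable from [c :: k], except [k] itself. *)
Fixpoint conts (c : cmd) (k : seq cmd) : seq (seq cmd) :=
  (c :: k) :: match c with
  | Seq c1 c2 => conts c1 (c2 :: k) ++ conts c2 k
  | If _ _ c1 c2 => conts c1 k ++ conts c2 k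
  | Loop r p c1 => conts c1 (c :: k)
  | _ => [::]
  end.

Lemma conts_head c k : List.In (c :: k) (conts c k).
Proof. by case: c => *; left. Qed.

Lemma conts_step c k k1 s : List.In k1 (conts c k) ->
  List.In (stepk (k1, s)).1 (conts c k) \/ (stepk (k1, s)).1 = k.
Proof.
elim: c k => [r b|r|c IHc d IHd|r p c IHc d IHd|r p c IHc] k.
- by case=> // <-; right.
- by case=> // <-; right.
- case=> [<-|/List.in_app_iff[]].
  + by left; right; apply/List.in_app_iff; left; apply: conts_head.
  + case/IHc=> [H|->]; first by left; right; apply/List.in_app_iff; left.
    by left; right; apply/List.in_app_iff; right; apply: conts_head.
  + case/IHd=> [H|->]; last by right.
    by left; right; apply/List.in_app_iff; right.
- case=> [<-|/List.in_app_iff[]] /=.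
  + left; right; apply/List.in_app_iff.
    by case: ifP => _; [left|right]; apply: conts_head.
  + case/IHc=> [H|->]; last by right.
    by left; right; apply/List.in_app_iff; left.
  + case/IHd=> [H|->]; last by right.
    by left; right; apply/List.in_app_iff; right.
- case=> [<-|] /=.
  + by case: ifP => _; [left; right; apply: conts_head|right].
  + case/IHc=> [H|->]; first by left; right.
    by left; left.
Qed.

(** [cmd] contains predicates and has no decidable equality; the classical one on [seq cmd] turns
    the list of reachable continuations into a finite type. *)
Definition cont_seq (c : cmd) : seq {classic (seq cmd)} := [::] :: conts c [::].

Lemma in_mem_classic (T : Type) (x : T) (l : seq {classic T}) :
  List.In x l -> (x : {classic T}) \in l.
Proof.
elim: l => //= y l IH [->|/IH H]; first by rewrite inE eqxx.
by rewrite inE H orbT.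
Qed.

Lemma mem_in_classic (T : Type) (x : T) (l : seq {classic T}) :
  (x : {classic T}) \in l -> List.In x l.
Proof.
by elim: l => //= y l IH; rewrite inE => /orP[/eqP ->|/IH]; [left|right].
Qed.

Lemma cont_seq_step c (k1 : seq cmd) s : (k1 : {classic _}) \in cont_seq c ->
  ((stepk (k1, s)).1 : {classic _}) \in cont_seq c.
Proof.
move=> Hin; have [<-|H] : [::] = k1 \/ List.In k1 (conts c [::]).
    exact: (mem_in_classic Hin).
  by rewrite inE eqxx.
apply: in_mem_classic; have [H'|->] := conts_step s H; first by right.
by left.
Qed.

Definition cstate (c : cmd) : finType := seq_sub (cont_seq c).

Lemma cstart_subproof c : ([:: c] : {classic _}) \in cont_seq c.
Proof. by apply: in_mem_classic; right; apply: conts_head. Qed.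

Definition cstart (c : cmd) : cstate c := SeqSub (cstart_subproof c).

Definition tsym : finType := tape_symbol void.

Definition sym_bit (a : tsym) : option bool :=
  if a is Some (inl b) then Some b else None.

Definition bit_sym (b : bool) : tsym := Some (inl b).

(* A push first moves the head left (recording the pending write in the
   state), then writes; every other instruction is a single machine step. *)
Definition cmd_state (c : cmd) : finType :=
  (cstate c * option ('I_4 * bool))%type.

Definition cmd_acts (k : seq cmd) (f : {ffun 'I_4 -> tsym}) (i : 'I_4) :
    tsym * direction :=
  match k with
  | Push r b :: _ => (f i, if i == r then MoveLeft else Stay)
  | Pop r :: _ =>
      if (i == r) && (f i != None) then (None, MoveRight) else (f i, Stay)
  | _ => (f i, Stay)
  end.

Definition next_cont (k : seq cmd) (f : {ffun 'I_4 -> tsym}) : seq cmd :=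
  match k with
  | [::] => [::]
  | Push r b :: k' => k'
  | Pop r :: k' => k'
  | Seq c d :: k' => [:: c, d & k']
  | If r p c d :: k' => (if p (sym_bit (f r)) then c else d) :: k'
  | Loop r p c :: k' =>
      if p (sym_bit (f r)) then [:: c, Loop r p c & k'] else k'
  end.

Definition pending (k : seq cmd) : option ('I_4 * bool) :=
  if k is Push r b :: _ then Some (r, b) else None.

(** The default [q.1] of [insubd] is never taken in a simulated run, by [cont_seq_step]. *)
Definition cmd_trans (c : cmd) (q : cmd_state c) (f : {ffun 'I_4 -> tsym}) :
    cmd_state c * {ffun 'I_4 -> tsym * direction} :=
  match q.2 with
  | Some (r, b) =>
      ((q.1, None),
       [ffun i => if i == r then (bit_sym b, Stay) else (f i, Stay)])
  | None =>
      ((insubd q.1 (next_cont (ssval q.1) f : {classic _}),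
        pending (ssval q.1)),
       [ffun i => cmd_acts (ssval q.1) f i])
  end.

Definition cmd_halting (c : cmd) (q : cmd_state c) : bool :=
  nilp (ssval q.1 : seq cmd) && ~~ isSome q.2.

Definition tm (c : cmd) : machine :=
  @Machine 3 void (cmd_state c) (cstart c, None) (@cmd_halting c)
    (@cmd_trans c).

Definition rep (t : tape void) (l : seq bool) : Prop :=
  all (pred1 None) (left_cells t) /\
  exists m, scanned t :: right_cells t = map bit_sym l ++ nseq m None.

Lemma rep_scanned t l : rep t l -> sym_bit (scanned t) = ohead l.
Proof. by case: t l => [lc sc rc] [|b l] [_ [[|m] //= [-> _]]]. Qed.

Lemma rep_none t l : rep t l -> (scanned t == None) = nilp l.
Proof. by case: t l => [lc sc rc] [|b l] [_ [[|m] //= [-> _]]]. Qed.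

Lemma rep_stay t l : rep t l -> rep (write_move t (scanned t, Stay)) l.
Proof. by case: t. Qed.

Lemma rep_push t l b : rep t l ->
  rep (write_move (write_move t (scanned t, MoveLeft)) (bit_sym b, Stay))
    (b :: l).
Proof.
case: t => [lc sc rc] [/= Hl [m Hm]]; split=> /=.
  by case: lc Hl => //= a lc /andP[].
by exists m; rewrite Hm.
Qed.

Lemma rep_pop t l : rep t l ->
  rep (write_move t (if scanned t != None then (None, MoveRight)
                     else (scanned t, Stay))) (behead l).
Proof.
move=> H; rewrite (rep_none H); case: t l H => [lc sc rc] [|b l] //=.
case=> /= Hl [m [_ ->]]; split=> //=.
(* When the last listed cell is popped, the head moves onto a fresh blank and the padding becomes
   1. *)
by case: l => [|b' l]; [case: m => [|m]; [exists 1|exists m.+1]|exists m].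
Qed.

Definition Rep (tp : 'I_4 -> tape void) (s : store) : Prop :=
  forall i, rep (tp i) (get s i).

Section Simulation.

Variable c : cmd.

Definition sim (ks : seq cmd * store) (cf : configuration (tm c)) : Prop :=
  [/\ ssval (current cf).1 = ks.1 :> seq cmd, (current cf).2 = None
    & Rep (tapes cf) ks.2].

Lemma next_contE (k : seq cmd) (tp : 'I_4 -> tape void) s : Rep tp s ->
  next_cont k [ffun i => scanned (tp i)] = (stepk (k, s)).1.
Proof.
move=> H; case: k => [|[r b|r|c1 c2|r p c1 c2|r p c1] k] //=.
  by rewrite ffunE (rep_scanned (H r)).
by rewrite ffunE (rep_scanned (H r)) /peek; case: ifP.
Qed.

Lemma sim_step ks cf : sim ks cf ->
  exists2 n, n <= 2 & sim (stepk ks) (iter n (@step (tm c)) cf).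
Proof.
case: ks => k s; case: cf => [[q o] tp] [/= Hk Ho Hs]; subst o.
have nextE : ssval (insubd q (next_cont (ssval q) [ffun i => scanned (tp i)]
    : {classic _})) = (stepk (k, s)).1 :> seq cmd.
  rewrite -[ssval _]/(val _) val_insubd (next_contE _ Hs) Hk.
  suff -> : ((stepk (k, s)).1 : {classic _}) \in cont_seq c by [].
  by apply: cont_seq_step; rewrite -Hk; apply: (valP q).
case: k Hk nextE => [|k1 k] Hk nextE; first by exists 0.
have nh : cmd_halting (q, None) = false by rewrite /cmd_halting Hk.
have H1 : (forall r b, k1 <> Push r b) ->
    step (Configuration ((q, None) : state (tm c)) tp) =
    Configuration ((insubd q (next_cont (ssval q) [ffun i => scanned (tp i)]
      : {classic _}), None) : state (tm c))
      [ffun i => write_move (tp i)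
        (cmd_acts (k1 :: k) [ffun i => scanned (tp i)] i)].
  move=> np; rewrite /step /= nh /= /cmd_trans /=; congr Configuration.
    by rewrite Hk; case: (k1) np => // r b /(_ r b).
  by apply: eq_ffun => i; rewrite ffunE Hk.
case: k1 Hk nextE H1 => [r b|r|c1 c2|r p c1 c2|r p c1] Hk nextE H1.
- exists 2 => //=; rewrite {2}/step /= nh /cmd_trans /= Hk /=.
  rewrite /step /= /cmd_halting andbF; split=> //=.
    by move: nextE; rewrite Hk.
  move=> i; rewrite !ffunE get_set; case: eqP => [->|_]; last first.
    by rewrite ?ffunE; apply: rep_stay; apply: rep_stay.
  exact: rep_push.
- exists 1 => //; rewrite /= H1 //; split=> //= i.
  rewrite !ffunE get_set; case: eqP => [->|_] /=; first exact: rep_pop.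
  exact: rep_stay.
- by exists 1 => //; rewrite /= H1 //; split=> //= i; rewrite !ffunE; apply: rep_stay.
- by exists 1 => //; rewrite /= H1 //; split=> //= i; rewrite !ffunE; apply: rep_stay.
- exists 1 => //; rewrite /= H1 //; split=> //=.
  by case: ifP => _ i; rewrite !ffunE; apply: rep_stay.
Qed.

Lemma sim_iter n ks cf : sim ks cf ->
  exists2 m, m <= 2 * n & sim (iter n stepk ks) (iter m (@step (tm c)) cf).
Proof.
elim: n => [|n IH] H; first by exists 0.
have [m lem Hm] := IH H; have [m' lem' Hm'] := sim_step Hm.
by exists (m' + m); [lia|rewrite iterD].
Qed.

End Simulation.

Lemma output_rep c (cf : configuration (tm c)) l :
  rep (tapes cf ord0) l -> output cf = l.
Proof.
rewrite /output => -[_ [m ->]].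
by elim: l => [|b l IH] /=; [case: m|rewrite IH].
Qed.

Lemma initial_sim c w : sim ([:: c], (w, [::], [::], [::])) (initial (tm c) w).
Proof.
split=> //= i; rewrite /= ffunE.
have H l : rep (input_tape void l) l.
  by case: l => [|b l]; split=> //=; [exists 1|exists 0; rewrite cats0].
by case: i => [[|[|[|[|]]]] ?].
Qed.

(** Quantified over the continuation, so that runs of the parts compose to a run of the whole. *)
Definition run (c : cmd) (s : store) (n : nat) (s' : store) : Prop :=
  forall k, iter n stepk (c :: k, s) = (k, s').

Lemma run_polytime (c : cmd) (f : seq bool -> seq bool) (p : {poly nat}) :
  (forall w, exists n s1 s2 s3, n <= p.[size w]%R /\
    run c (w, [::], [::], [::]) n (f w, s1, s2, s3)) ->
  polytime_computable f.
Proof.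
move=> H; exists (tm c), (p + p)%R => w.
have [n [s1 [s2 [s3 [len Hr]]]]] := H w.
have [m lem [H1 H2 H3]] := sim_iter n (initial_sim c w).
rewrite Hr in H1 H3; exists m; last first.
  split; last exact: (output_rep (H3 ord0)).
  by move: H1 H2 => /=; rewrite /cmd_halting => -> ->.
by rewrite hornerD; apply: leq_trans lem _; rewrite mul2n -addnn leq_add.
Qed.

(** * Polynomial-time functions on trees *)

Definition runs (c : cmd) (s : store) (B : nat) (s' : store) : Prop :=
  exists2 n, n <= B & run c s n s'.

Lemma runs_push r b s B : 0 < B -> runs (Push r b) s B (set_reg s r (b :: get s r)).
Proof. by exists 1. Qed.

Lemma runs_pop r s B : 0 < B -> runs (Pop r) s B (set_reg s r (behead (get s r))).
Proof. by exists 1. Qed.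

Lemma runs_seq c d s s' s'' B1 B2 B : runs c s B1 s' -> runs d s' B2 s'' ->
  B1 + B2 < B -> runs (Seq c d) s B s''.
Proof.
move=> [n len Hn] [m lem Hm] leB; exists (m + n).+1; first lia.
by move=> k; rewrite iterSr iterD /= Hn Hm.
Qed.

Lemma runs_if r (p : pred (option bool)) c d s s' B1 B :
  runs (if p (peek s r) then c else d) s B1 s' -> B1 < B ->
  runs (If r p c d) s B s'.
Proof.
by move=> [n len Hn] leB; exists n.+1 => [|k]; [lia|rewrite iterSr /= Hn].
Qed.

Lemma runs_loop_stop r (p : pred (option bool)) c s B : ~~ p (peek s r) -> 0 < B ->
  runs (Loop r p c) s B s.
Proof. by move=> /negbTE H ?; exists 1 => // k; rewrite /= H. Qed.

Lemma runs_loop_step r (p : pred (option bool)) c s s' s'' B1 B2 B : p (peek s r) ->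
  runs c s B1 s' -> runs (Loop r p c) s' B2 s'' -> B1 + B2 < B ->
  runs (Loop r p c) s B s''.
Proof.
move=> H [n len Hn] [m lem Hm] leB; exists (m + n).+1; first lia.
by move=> k; rewrite iterSr iterD /= H Hn Hm.
Qed.

Lemma runs_le c s B B' s' : runs c s B s' -> B <= B' -> runs c s B' s'.
Proof. by case=> n ? ? ?; exists n => //; lia. Qed.

Definition store_size (s : store) : nat :=
  let: (s0, s1, s2, s3) := s in size s0 + size s1 + size s2 + size s3.

Lemma stepk_size ks : store_size (stepk ks).2 <= (store_size ks.2).+1.
Proof.
case: ks => [[|[r b|r|c d|r p c d|r p c] k] [[[s0 s1] s2] s3]] //=.
- by case: r => [[|[|[|[|]]]] ?] //=; lia.
- by case: r => [[|[|[|[|]]]] ?] //=; rewrite size_behead; lia.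
- by case: ifP => _ /=.
Qed.

(** A step adds at most one bit to the store, so a time bound is also a bound on the size of the
    result. *)
Lemma runs_size c s B s' : runs c s B s' -> store_size s' <= store_size s + B.
Proof.
case=> n len /(_ [::]) H.
have : store_size (iter n stepk ([:: c], s)).2 <= store_size s + n.
  elim: n {len H} => [|n IH]; first by rewrite addn0.
  by apply: leq_trans (stepk_size _) _; rewrite addnS ltnS.
by rewrite H /=; lia.
Qed.

Definition is_one (o : option bool) : bool := o == Some true.
Definition skip : cmd := Seq (Push R0 true) (Pop R0).

Definition pour (a d : 'I_4) : cmd :=
  Loop a isSome (If a is_one (Seq (Pop a) (Push d true))
                             (Seq (Pop a) (Push d false))).

Lemma store_ext s s' : (forall r, get s r = get s' r) -> s = s'.
Proof.
case: s s' => [[[a0 a1] a2] a3] [[[b0 b1] b2] b3] H.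
by move: (H R0) (H R1) (H R2) (H R3) => /= -> -> -> ->.
Qed.

Lemma runs_pour a d s B : a != d -> 5 * size (get s a) < B ->
  runs (pour a d) s B
    (set_reg (set_reg s a [::]) d (rev (get s a) ++ get s d)).
Proof.
move=> neq; move Ex: (get s a) => x; elim: x s B Ex => [|b x IH] s B Ex leB.
  have -> : set_reg (set_reg s a [::]) d (rev [::] ++ get s d) = s.
    apply: store_ext => r; rewrite !get_set.
    by case: eqP => [->|_] //; case: eqP => [->|_].
  by apply: runs_loop_stop; rewrite // /peek Ex.
pose s' := set_reg (set_reg s a x) d (b :: get s d).
have Ex' : get s' a = x by rewrite !get_set (negbTE neq) eqxx.
have -> : set_reg (set_reg s a [::]) d (rev (b :: x) ++ get s d) =
    set_reg (set_reg s' a [::]) d (rev x ++ get s' d).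
  apply: store_ext => r; rewrite !get_set; case: eqP => // Hr.
    by rewrite eqxx rev_cons cat_rcons.
  by case: eqP.
apply: (@runs_loop_step _ _ _ _ s' _ 4 (B - 5)); first by rewrite /peek Ex.
- apply: (@runs_if _ _ _ _ _ _ 3) => //; rewrite /peek Ex /=.
  have E : s' = set_reg (set_reg s a (behead (get s a))) d
      (b :: get (set_reg s a (behead (get s a))) d).
    by rewrite get_set eq_sym (negbTE neq) Ex.
  by rewrite E; case: (b); apply: (@runs_seq _ _ _ _ _ 1 1) => //;
    [exact: runs_pop|exact: runs_push|exact: runs_pop|exact: runs_push].
- by apply: IH => //; move: leB => /=; lia.
- by move: leB => /=; lia.
Qed.

(** * Moving, copying and exchanging binary trees on a stack *)

Inductive tree := Leaf | Node of tree & tree.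

Fixpoint code (t : tree) : seq bool :=
  if t is Node a b then true :: code a ++ code b else [:: false].

Definition tsize (t : tree) : nat := size (code t).

Lemma tsize_node a b : tsize (Node a b) = (tsize a + tsize b).+1.
Proof. by rewrite /tsize /= size_cat. Qed.

Lemma tsize_gt0 t : 0 < tsize t.
Proof. by case: t. Qed.

(* [R3] counts the trees still to be read. *)
Definition move_loop (d : 'I_4) : cmd :=
  Loop R3 isSome
    (If R0 is_one
      (Seq (Pop R0) (Seq (Push d true) (Push R3 true)))
      (Seq (Pop R0) (Seq (Push d false) (Pop R3)))).

Definition move_tree (d : 'I_4) : cmd := Seq (Push R3 true) (move_loop d).

(** The flag selects [R1] or [R2] as the register that receives the tree, so that one proof serves
    both. *)
Definition put_store (b : bool) (l x y c : seq bool) : store :=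
  if b then (l, x, y, c) else (l, y, x, c).

Definition aux_reg (b : bool) : 'I_4 := if b then R1 else R2.

Lemma runs_eq c s B B' s1 s' : runs c s B s1 -> s1 = s' -> B <= B' ->
  runs c s B' s'.
Proof. by move=> H <-; apply: runs_le. Qed.

Lemma runs_seqE c d s s' s'' B1 B2 : runs c s B1 s' -> runs d s' B2 s'' ->
  runs (Seq c d) s (B1 + B2).+1 s''.
Proof. by move=> H1 H2; apply: runs_seq H1 H2 _. Qed.

Ltac straight_line :=
  first [ eapply runs_seqE; [straight_line | straight_line]
        | exact (runs_push _ _ _ (ltn0Sn 0)) | exact (runs_pop _ _ (ltn0Sn 0)) ].

Ltac run_straight :=
  rewrite /peek /=; eapply runs_eq; [straight_line | reflexivity | by []].

Lemma runs_skip s B : 2 < B -> runs skip s B s.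
Proof.
move=> leB; eapply runs_eq; [straight_line | | exact: leB].
by case: s => [[[? ?] ?] ?].
Qed.

(** Stated backwards, from a run of the remaining loop, so that at a node the two induction
    hypotheses chain. The count in [R3] grows by one at a node, replaced by its two subtrees, and
    drops by one at a leaf. *)
Lemma runs_move_loop b t l x y c s B :
  runs (move_loop (aux_reg b)) (put_store b l (rev (code t) ++ x) y c) B s ->
  runs (move_loop (aux_reg b)) (put_store b (code t ++ l) x y (true :: c))
    (B + 7 * tsize t) s.
Proof.
elim: t l x c B => [|t1 IH1 t2 IH2] l x c B H.
  apply: (@runs_loop_step _ _ _ _ (put_store b l (false :: x) y c) _ 6 B) => //.
  - by clear; case: b.
  - apply: (@runs_if _ _ _ _ _ _ 5) => //.
    by clear; case: b => /=; run_straight.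
  - rewrite /tsize /=; lia.
apply: (@runs_loop_step _ _ _ _
   (put_store b (code t1 ++ code t2 ++ l) (true :: x) y (true :: true :: c)) _ 6
   (B + 7 * tsize t2 + 7 * tsize t1)) => //.
- by clear; case: b.
- apply: (@runs_if _ _ _ _ _ _ 5) => //.
  by clear; case: b; rewrite /= -?catA; run_straight.
- apply: IH1; apply: IH2; move: H => /=.
  by rewrite rev_cons rev_cat -!cats1 -!catA.
- by rewrite tsize_node; lia.
Qed.

Lemma runs_move b t l x y :
  runs (move_tree (aux_reg b)) (put_store b (code t ++ l) x y [::])
    (7 * tsize t + 4) (put_store b l (rev (code t) ++ x) y [::]).
Proof.
apply: (@runs_seq _ _ _ (put_store b (code t ++ l) x y [:: true]) _ 1
  (1 + 7 * tsize t)); last by lia.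
  by case: b; run_straight.
by apply: runs_move_loop; apply: runs_loop_stop; case: b.
Qed.

Definition fork : cmd :=
  Loop R1 isSome (If R1 is_one
    (Seq (Pop R1) (Seq (Push R0 true) (Push R2 true)))
    (Seq (Pop R1) (Seq (Push R0 false) (Push R2 false)))).

Lemma runs_fork l x y B : 7 * size x < B ->
  runs fork (l, x, y, [::]) B (rev x ++ l, [::], rev x ++ y, [::]).
Proof.
elim: x l y B => [|b x IH] l y B /= leB; first exact: runs_loop_stop.
apply: (@runs_loop_step _ _ _ _ (b :: l, x, b :: y, [::]) _ 6 (B - 7)) => //.
- by apply: (@runs_if _ _ _ _ _ _ 5) => //; case: b => /=; run_straight.
- by rewrite rev_cons !cat_rcons; apply: IH; lia.
- by lia.
Qed.

Definition clear (r : 'I_4) : cmd := Loop r isSome (Pop r).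

Lemma runs_clear l x y c B : 2 * size x < B ->
  runs (clear R1) (l, x, y, c) B (l, [::], y, c).
Proof.
elim: x B => [|b x IH] B /= leB; first exact: runs_loop_stop.
apply: (@runs_loop_step _ _ _ _ (l, x, y, c) _ 1 (B - 2)) => //.
- by run_straight.
- by apply: IH; lia.
- by lia.
Qed.

Definition on_top (l : seq bool) : store := (l, [::], [::], [::]).

Definition drop_tree : cmd := Seq (move_tree R1) (clear R1).

Lemma runs_drop_tree t l :
  runs drop_tree (on_top (code t ++ l)) (9 * tsize t + 6) (on_top l).
Proof.
apply: (runs_seq (@runs_move true t l [::] [::])) => /=.
  by apply: runs_clear; rewrite cats0 size_rev; apply: leqnn.
by rewrite /tsize; lia.
Qed.

Definition dup_tree : cmd :=
  Seq (move_tree R1) (Seq fork (Seq (pour R2 R1) (pour R1 R0))).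

Lemma runs_pourE a d s B s' : a != d -> 5 * size (get s a) < B ->
  set_reg (set_reg s a [::]) d (rev (get s a) ++ get s d) = s' ->
  runs (pour a d) s B s'.
Proof. by move=> neq leB <-; apply: runs_pour. Qed.

Lemma runs_dup_tree t l :
  runs dup_tree (on_top (code t ++ l)) (24 * tsize t + 10)
    (on_top (code t ++ code t ++ l)).
Proof.
have sz := size_rev (code t); set c := code t in sz *.
apply: (@runs_seq _ _ _ (l, rev c, [::], [::]) _ _ (17 * tsize t + 5)).
- by rewrite -[rev c]cats0; apply: (@runs_move true t l [::] [::]).
- apply: (@runs_seq _ _ _ (c ++ l, [::], c, [::]) _ (7 * tsize t).+1
    (10 * tsize t + 3)).
  + have H := @runs_fork l (rev c) [::] (7 * tsize t).+1.
    by rewrite revK cats0 sz in H; apply: H; rewrite ltnS.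
  (* The copy in [R2] is in reading order, and two pours put it on [R0] in that same order. *)
  + apply: (@runs_seq _ _ _ (c ++ l, rev c, [::], [::]) _ (5 * tsize t).+1
     (5 * tsize t).+1); last by rewrite /tsize; lia.
    * by apply: runs_pourE; rewrite //= cats0.
    * by apply: runs_pourE; rewrite //= ?sz // revK.
  + by lia.
- by lia.
Qed.

Definition swap_trees : cmd :=
  Seq (move_tree R1) (Seq (move_tree R2) (Seq (pour R1 R0) (pour R2 R0))).

Lemma runs_swap_trees t u l :
  runs swap_trees (on_top (code t ++ code u ++ l))
    (12 * tsize t + 12 * tsize u + 13) (on_top (code u ++ code t ++ l)).
Proof.
have szt := size_rev (code t); have szu := size_rev (code u).
apply: (@runs_seq _ _ _ (code u ++ l, rev (code t), [::], [::]) _ _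
  (5 * tsize t + 12 * tsize u + 8)).
- rewrite -[rev _]cats0; exact: (@runs_move true t _ [::] [::]).
- apply: (@runs_seq _ _ _ (l, rev (code t), rev (code u), [::]) _ _
    (5 * tsize t + 5 * tsize u + 3)).
  + rewrite -[rev (code u)]cats0.
    exact: (@runs_move false u _ [::] (rev (code t))).
  + apply: (@runs_seq _ _ _ (code t ++ l, [::], rev (code u), [::]) _
      (5 * tsize t).+1 (5 * tsize u).+1); last by rewrite /tsize; lia.
    * by apply: runs_pourE; rewrite //= ?szt // revK.
    * by apply: runs_pourE; rewrite //= ?szu // revK.
  + by lia.
- by lia.
Qed.

(* [p.[n]] elaborates to several convertible but distinct terms, which [lia]
   would not identify. *)
Definition peval (p : {poly nat}) (n : nat) : nat := p.[n]%R.

Lemma pevalD p q n : peval (p + q)%R n = peval p n + peval q n.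
Proof. exact: hornerD. Qed.

Lemma pevalM p q n : peval (p * q)%R n = peval p n * peval q n.
Proof. exact: hornerM. Qed.

Lemma pevalC c n : peval (c%:P)%R n = c.
Proof. exact: hornerC. Qed.

Lemma pevalX n : peval 'X%R n = n.
Proof. exact: hornerX. Qed.

Lemma peval_comp p q n : peval (p \Po q)%R n = peval p (peval q n).
Proof. exact: horner_comp. Qed.

Definition pevalE := (pevalD, pevalM, pevalC, pevalX, peval_comp).

Lemma peval_MXaddC p c n : peval (p * 'X + c%:P)%R n = peval p n * n + c.
Proof. by rewrite !pevalE. Qed.

Lemma peval_le (p : {poly nat}) m n : m <= n -> peval p m <= peval p n.
Proof.
move=> le_mn; elim/poly_ind: p => [|p c IH]; first by rewrite /peval !horner0.
rewrite !peval_MXaddC leq_add2r; exact: leq_mul.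
Qed.

(** * Codes of data types and closure properties of polynomial-time functions *)

Class codable (T : Type) := enc : T -> tree.

Definition esize {T} `{codable T} (x : T) : nat := tsize (enc x).

#[global] Instance codable_tree : codable tree := id.
#[global] Instance codable_bool : codable bool :=
  fun b => if b then Node Leaf Leaf else Leaf.
#[global] Instance codable_prod A B `{codable A} `{codable B} :
  codable (A * B) := fun p => Node (enc p.1) (enc p.2).
#[global] Instance codable_seq A `{codable A} : codable (seq A) :=
  foldr (fun a t => Node (enc a) t) Leaf.
(** Unary, since times, positions and exponents are small; a number then has the same code as a list
    of that many units. *)
#[global] Instance codable_nat : codable nat := fun n => iter n (Node Leaf) Leaf.

(* Polynomial-time computability, with the argument and the value on top of an
   otherwise arbitrary stack. *)
Definition pt {A B} `{codable A} `{codable B} (f : A -> B) : Prop :=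
  exists (c : cmd) (p : {poly nat}), forall a l,
    runs c (on_top (code (enc a) ++ l)) (peval p (esize a))
      (on_top (code (enc (f a)) ++ l)).

Section Closure.

Context {A B C D : Type}.
Context `{codable A} `{codable B} `{codable C} `{codable D}.

Lemma pt_size (f : A -> B) : pt f ->
  exists p : {poly nat}, forall a, esize (f a) <= peval p (esize a).
Proof.
case=> c [p Hc]; exists ('X + p)%R => a; rewrite !pevalE.
by have := runs_size (Hc a [::]); rewrite /= !addn0 !cats0.
Qed.

(** Only codes matter: constructors and projections of a data type can be computed as operations on
    trees or pairs with the same codes. *)
Lemma pt_code (f : A -> B) (F : C -> D) (u : A -> C) :
  pt F -> (forall a, enc (u a) = enc a) ->
  (forall a, enc (F (u a)) = enc (f a)) -> pt f.
Proof.
move=> [c [p Hc]] E1 E2; exists c, p => a l.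
by rewrite /esize -E1 -E2; apply: Hc.
Qed.

Lemma pt_id : pt (fun a : A => a).
Proof. by exists skip, (3%N%:P)%R => t l; rewrite pevalE; apply: runs_skip. Qed.

Lemma pt_comp (g : B -> C) (f : A -> B) : pt g -> pt f -> pt (fun a => g (f a)).
Proof.
move=> [c [p Hc]] Hf; have [r Hr] := pt_size Hf.
case: Hf => d [q Hd].
exists (Seq d c), (q + (p \Po r) + 1%N%:P)%R => t l.
apply: runs_seq (Hd t l) (Hc (f t) l) _.
by rewrite !pevalE addn1 ltnS leq_add2l peval_le.
Qed.

Definition push_all (w : seq bool) : cmd :=
  foldr (fun b c => Seq c (Push R0 b)) skip w.

Lemma runs_push_all w l :
  runs (push_all w) (on_top l) (2 * size w + 3) (on_top (w ++ l)).
Proof.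
elim: w => [|b w IH] /=; first by apply: runs_skip.
apply: runs_seq IH _ _; first by apply: (@runs_push R0 b (on_top _) 1).
lia.
Qed.

Lemma pt_const (b : B) : pt (fun _ : A => b).
Proof.
exists (Seq drop_tree (push_all (code (enc b)))).
exists (9%N%:P * 'X + (2 * esize b + 10)%N%:P)%R => a l.
apply: runs_seq (runs_drop_tree _ l) (runs_push_all _ l) _.
rewrite !pevalE /esize /tsize; lia.
Qed.

End Closure.

Section Branching.

Context {A B C : Type} `{codable A} `{codable B} `{codable C}.

Lemma pt_pair (f : A -> B) (g : A -> C) : pt f -> pt g ->
  pt (fun a => (f a, g a)).
Proof.
move=> Hf Hg; have [rG sG] := pt_size Hg.
case: Hf Hg => [c [p Hc]] [d [q Hd]].
exists (Seq dup_tree (Seq d (Seq swap_trees (Seq c (Push R0 true))))).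
exists (24%N%:P * 'X + q + (12%N%:P * 'X + 12%N%:P * rG) + p + 30%N%:P)%R.
move=> a l.
apply: (runs_seq (runs_dup_tree (enc a) l)).
  apply: (runs_seq (Hd _ _)); last exact: ltnSn.
  apply: (runs_seq (runs_swap_trees _ _ _)); last exact: ltnSn.
  apply: (runs_seq (Hc _ _)); last exact: ltnSn.
  by rewrite /on_top /= -catA; apply: (@runs_push R0 true (on_top _) 1).
by rewrite !pevalE; have := sG a; rewrite /esize; lia.
Qed.

Lemma pt_if (b : A -> bool) (f g : A -> B) : pt b -> pt f -> pt g ->
  pt (fun a => if b a then f a else g a).
Proof.
move=> Hb [c [p Hc]] [d [q Hd]]; have [r sB] := pt_size Hb.
case: Hb => e [pb Hb].
exists (Seq dup_tree (Seq e (If R0 is_one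
  (Seq drop_tree c) (Seq (Pop R0) d)))).
exists (24%N%:P * 'X + pb + 9%N%:P * r + p + q + 60%N%:P)%R => t l.
apply: (runs_seq (runs_dup_tree (enc t) l)).
  apply: (runs_seq (Hb _ _)); last exact: ltnSn.
  apply: (@runs_if _ _ _ _ _ _ (peval p (esize t) + peval q (esize t) + 40));
    last exact: ltnSn.
  case: (b t) => /=.
    apply: (@runs_seq _ _ _ (on_top (code (enc t) ++ l)) _ 33
      (peval p (esize t))); last by lia.
    - exact: (runs_drop_tree (enc true)).
    - exact: Hc.
  apply: (@runs_seq _ _ _ (on_top (code (enc t) ++ l)) _ 1
    (peval q (esize t))); last by lia.
  - by run_straight.
  - exact: Hd.
rewrite !pevalE /esize; lia.
Qed.

End Branching.

Definition hd (t : tree) := if t is Node a _ then a else Leaf.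
Definition tl (t : tree) := if t is Node _ b then b else Leaf.

Lemma pt_tl : pt tl.
Proof.
exists (If R0 is_one (Seq (Pop R0) drop_tree) skip),
  (9%N%:P * 'X + 9%N%:P)%R.
move=> t l; rewrite !pevalE /esize /enc /codable_tree.
case: t => [|a b]; first by apply: runs_if; [exact: runs_skip|].
apply: (@runs_if _ _ _ _ _ _ (9 * tsize a + 8)) => /=; last first.
  rewrite tsize_node; lia.
apply: (@runs_seq _ _ _ (on_top (code a ++ code b ++ l)) _ 1
  (9 * tsize a + 6)); last by lia.
  by rewrite -?catA; run_straight.
exact: runs_drop_tree.
Qed.

Lemma pt_hd : pt hd.
Proof.
exists (If R0 is_one (Seq (Pop R0) (Seq swap_trees drop_tree)) skip).
exists (30%N%:P * 'X + 30%N%:P)%R.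
move=> t l; rewrite !pevalE /esize /enc /codable_tree.
case: t => [|a b]; first by apply: runs_if; [exact: runs_skip|].
apply: (@runs_if _ _ _ _ _ _ (12 * tsize a + 21 * tsize b + 22)) => /=;
  last by rewrite tsize_node; lia.
apply: (@runs_seq _ _ _ (on_top (code a ++ code b ++ l)) _ 1
  (12 * tsize a + 21 * tsize b + 20)); last by lia.
  by rewrite -?catA; run_straight.
apply: (runs_seq (runs_swap_trees _ _ _)); first exact: runs_drop_tree.
by lia.
Qed.

Definition is_leaf (t : tree) := if t is Leaf then true else false.

Lemma pt_is_leaf : pt is_leaf.
Proof.
exists (If R0 is_one (Seq drop_tree (push_all (code (enc false))))
   (Seq drop_tree (push_all (code (enc true))))).
exists (9%N%:P * 'X + 30%N%:P)%R => a l.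
apply: (@runs_if _ _ _ _ _ _ (9 * esize a + 20)); last by rewrite !pevalE; lia.
have drop_bit (b : bool) : runs (Seq drop_tree (push_all (code (enc b))))
    (on_top (code a ++ l)) (9 * esize a + 20) (on_top (code (enc b) ++ l)).
  apply: (@runs_seq _ _ _ (on_top l) _ (9 * esize a + 6) 9); last by lia.
    exact: runs_drop_tree.
  by apply: (runs_le (runs_push_all (code (enc b)) l)); case: b.
by case: a drop_bit => [|t u]; apply.
Qed.

Section Projections.

Context {X A B : Type} `{codable X} `{codable A} `{codable B}.

Lemma pt_fst (f : X -> A * B) : pt f -> pt (fun x => (f x).1).
Proof. by apply: (pt_comp (g := fst)); apply: (pt_code (u := enc)) pt_hd _ _. Qed.

Lemma pt_snd (f : X -> A * B) : pt f -> pt (fun x => (f x).2).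
Proof. by apply: (pt_comp (g := snd)); apply: (pt_code (u := enc)) pt_tl _ _. Qed.

Lemma pt_behead (f : X -> seq A) : pt f -> pt (fun x => behead (f x)).
Proof.
by apply: (pt_comp (g := behead)); apply: (pt_code (u := enc)) pt_tl _ _; case.
Qed.

Lemma pt_nilp (f : X -> seq A) : pt f -> pt (fun x => nilp (f x)).
Proof.
apply: (pt_comp (g := fun l : seq A => nilp l)).
by apply: (pt_code (u := enc)) pt_is_leaf _ _; case.
Qed.

Lemma pt_head (a0 : A) (f : X -> seq A) : pt f -> pt (fun x => head a0 (f x)).
Proof.
apply: (pt_comp (g := head a0)).
apply: (pt_code (u := enc) (pt_if pt_is_leaf (pt_const (enc a0)) pt_hd)) _ _ => //.
by case.
Qed.

Lemma pt_cons (f : X -> A) (g : X -> seq A) : pt f -> pt g ->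
  pt (fun x => f x :: g x).
Proof.
by move=> Hf Hg; apply: (pt_code (u := id)) (pt_pair Hf Hg) _ _.
Qed.

Lemma pt_succ (f : X -> nat) : pt f -> pt (fun x => (f x).+1).
Proof.
by move=> Hf; apply: (pt_code (u := id)) (pt_pair (pt_const Leaf) Hf) _ _.
Qed.

Lemma pt_pred (f : X -> nat) : pt f -> pt (fun x => (f x).-1).
Proof.
by apply: (pt_comp (g := predn)); apply: (pt_code (u := enc)) pt_tl _ _; case.
Qed.

Lemma pt_eq0 (f : X -> nat) : pt f -> pt (fun x => f x == 0).
Proof.
apply: (pt_comp (g := fun n => n == 0)).
by apply: (pt_code (u := enc)) pt_is_leaf _ _; case.
Qed.

End Projections.

Section CodeSizes.

Context {A B : Type} `{codable A} `{codable B}.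

Lemma esize_cons (a : A) l : esize (a :: l) = (esize a + esize l).+1.
Proof. exact: tsize_node. Qed.

Lemma esize_pair (a : A) (b : B) : esize (a, b) = (esize a + esize b).+1.
Proof. exact: tsize_node. Qed.

Lemma size_esize (l : seq A) : size l < esize l.
Proof. by elim: l => //= a l IH; rewrite esize_cons; lia. Qed.

End CodeSizes.

Section Folds.

Context {X A B : Type} `{codable X} `{codable A} `{codable B}.

(** Iterating a polynomial-time function can blow up exponentially, hence the bound on all partial
    results in terms of the initial data. [D] restricts it to the initial data that occur: in
    [pt_foldl_orbit] a parameter determines both the list and the start value. *)
Lemma runs_foldl (D : seq A -> B -> Prop) (f : B -> A -> B) :
  pt (fun p : A * B => f p.2 p.1) ->
  (exists q : {poly nat}, forall l z i, D l z ->
    esize (foldl f z (take i l)) <= peval q (esize l + esize z)) ->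
  exists c (p : {poly nat}), forall l z k, D l z ->
    runs c (on_top (code (enc (l, z)) ++ k)) (peval p (esize (l, z)))
      (on_top (code (enc (foldl f z l)) ++ k)).
Proof.
move=> Hf [q Hq].
pose G (p : seq A * B) := if p.1 is a :: l then (l, f p.2 a) else p.
have [g [pg Hg]] : exists g (pg : {poly nat}), forall a l z k,
   runs g (on_top (code (enc (a :: l, z)) ++ k))
     (peval pg (esize (a :: l, z))) (on_top (code (enc (l, f z a)) ++ k)).
  have : pt (fun p : (A * seq A) * B => (p.1.2, f p.2 p.1.1)).
    apply: pt_pair; first exact: pt_snd (pt_fst pt_id).
    apply: (pt_comp Hf (f := fun p => (p.1.1, p.2))).
    by apply: pt_pair; [exact: pt_fst (pt_fst pt_id)|exact: pt_snd pt_id].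
  by move=> [g [pg Hg]]; exists g, pg => a l z k; apply: (Hg (a, l, z)).
(* Without its leading [true], the code of a pair is the code of the list followed by that of the
   accumulator, so the top bit tells whether the list is exhausted. The tag is put back before each
   call of [g] and removed after it. *)
exists (Seq (Pop R0) (Seq (Loop R0 is_one
  (Seq (Push R0 true) (Seq g (Pop R0)))) (Pop R0))).
pose Bd : {poly nat} := ((pg \Po ('X + q + 1%N%:P)) + 5%N%:P)%R.
exists ('X * (Bd \Po 'X) + 10%N%:P)%R => l0 z0 k Dlz.
have loop l1 l : l0 = l1 ++ l -> let z := foldl f z0 l1 in
  runs (Loop R0 is_one (Seq (Push R0 true) (Seq g (Pop R0))))
    (on_top (code (enc l) ++ code (enc z) ++ k))
    (size l * (peval Bd (esize l0 + esize z0)) + 1)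
    (on_top (code Leaf ++ code (enc (foldl f z l)) ++ k)).
  elim: l l1 => [|a l IH] l1 El /=; first exact: runs_loop_stop.
  have := IH (rcons l1 a); rewrite cat_rcons -El foldl_rcons /= => /(_ erefl).
  move=> IHm; apply: (runs_loop_step _ _ IHm); first by [].
  - apply: (@runs_seq _ _ _ (on_top (code (enc (a :: l, foldl f z0 l1)) ++ k))
      _ 1).
    + by rewrite /= -!catA; run_straight.
    + apply: (runs_seq (Hg _ _ _ _)).
      * by rewrite /= -catA; apply: (@runs_pop R0 (on_top (true :: _)) 1).
      * exact: ltnSn.
    + exact: ltnSn.
  - rewrite mulSn; have : peval pg (esize (a :: l, foldl f z0 l1)) + 5
        <= peval Bd (esize l0 + esize z0); last by lia.
    rewrite !pevalE leq_add2r peval_le // esize_pair.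
    have := Hq l0 z0 (size l1) Dlz; rewrite {1}El take_size_cat //.
    have : esize (a :: l) <= esize l0; last by lia.
    rewrite El; elim: (l1) => //= b l2 IH2.
    by apply: leq_trans IH2 _; rewrite esize_cons; lia.
rewrite !pevalE.
apply: (@runs_seq _ _ _ (on_top (code (enc l0) ++ code (enc z0) ++ k)) _ 1
  (size l0 * peval Bd (esize l0 + esize z0) + 4)).
- by rewrite /= -catA; run_straight.
- apply: (runs_seq (loop [::] l0 erefl)).
    by apply: (@runs_pop R0 (on_top (false :: _)) 1).
  by lia.
- have : size l0 * peval Bd (esize l0 + esize z0) <=
    esize (l0, z0) * peval Bd (esize (l0, z0)).
    apply: leq_mul; first by apply: leq_trans (ltnW (size_esize l0)) _; rewrite esize_pair; lia.
    by apply: peval_le; rewrite esize_pair; lia.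
  by rewrite [in X in _ <= X]/Bd !pevalE; move: (size l0 * _) (esize _ * _) => u v; lia.
Qed.

End Folds.

#[global] Instance codable_unit : codable unit := fun _ => Leaf.

Lemma esize_gt0 A `{codable A} (a : A) : 0 < esize a.
Proof. exact: tsize_gt0. Qed.

Lemma esize_bool (b : bool) : esize b <= 3.
Proof. by case: b. Qed.

Lemma esize_nat (n : nat) : esize n = 2 * n + 1.
Proof.
elim: n => // n IH; have -> : esize n.+1 = (1 + esize n).+1 by exact: tsize_node.
lia.
Qed.

Lemma esize_cat A `{codable A} (l1 l2 : seq A) :
  esize (l1 ++ l2) + 1 = esize l1 + esize l2.
Proof. by elim: l1 => [|a l1 IH]; [rewrite addnC|rewrite /= !esize_cons; lia]. Qed.

Lemma esize_rev A `{codable A} (l : seq A) : esize (rev l) = esize l.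
Proof.
elim: l => // a l IH; apply: (@addIn 1); rewrite rev_cons -cats1.
rewrite esize_cat IH !esize_cons.
have -> : @esize (seq A) _ [::] = 1 by []; lia.
Qed.

Section Folds.

Context {X A B : Type} `{codable X} `{codable A} `{codable B}.

Lemma pt_foldl_orbit (f : X -> B -> A -> B) (l : X -> seq A) (z : X -> B) :
  pt (fun p : X * A * B => f p.1.1 p.2 p.1.2) ->
  (exists q : {poly nat}, forall x i,
    esize (foldl (f x) (z x) (take i (l x))) <= peval q (esize x)) ->
  pt l -> pt z -> pt (fun x => foldl (f x) (z x) (l x)).
Proof.
move=> Hf [q Hq] Hl Hz.
(* The parameter travels with the accumulator, as a fold on the stack sees nothing else. *)
pose g (s : X * B) a := (s.1, f s.1 s.2 a).
have gE x b k : foldl g (x, b) k = (x, foldl (f x) b k).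
  by elim: k b => //= a k IH b; rewrite IH.
have Hg : pt (fun p : A * (X * B) => g p.2 p.1).
  apply: pt_pair; first exact: pt_fst (pt_snd pt_id).
  apply: (pt_comp Hf (f := fun p : A * (X * B) => ((p.2.1, p.1), p.2.2))).
  apply: pt_pair; last exact: pt_snd (pt_snd pt_id).
  by apply: pt_pair; [exact: pt_fst (pt_snd pt_id)|exact: pt_fst pt_id].
have [|c [p Hc]] := runs_foldl (D := fun k s => k = l s.1 /\ s.2 = z s.1) Hg.
  exists ('X + q + 1%N%:P)%R => k [x b] i /= [-> ->].
  rewrite gE esize_pair !pevalE addn1 ltnS.
  have leX : esize x <= esize (l x) + esize (x, z x) by rewrite esize_pair; lia.
  by apply: leq_add => //; apply: leq_trans (Hq x i) (peval_le _ leX).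
have Hx : pt (fun x => (l x, (x, z x))).
  by apply: pt_pair => //; apply: pt_pair => //; apply: pt_id.
apply: (pt_comp (g := snd) (f := fun x => (x, foldl (f x) (z x) (l x)))).
  exact: (pt_snd pt_id).
have [r Hr] := pt_size Hx; case: Hx => d [pd Hd].
exists (Seq d c), (pd + (p \Po r) + 1%N%:P)%R => x k.
apply: (runs_seq (Hd x k)).
  by rewrite -gE; apply: (Hc (l x) (x, z x)).
by rewrite !pevalE addn1 ltnS leq_add2l peval_le.
Qed.

(** If a step enlarges the accumulator by an amount that depends only on the parameter and the item,
    the sizes grow additively and stay polynomial. *)
Lemma pt_foldl (f : X -> B -> A -> B) (l : X -> seq A) (z : X -> B) :
  pt (fun p : X * A * B => f p.1.1 p.2 p.1.2) ->
  (exists q : {poly nat}, forall x b a,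
    esize (f x b a) <= esize b + peval q (esize x + esize a)) ->
  pt l -> pt z -> pt (fun x => foldl (f x) (z x) (l x)).
Proof.
move=> Hf [q Hq] Hl Hz; apply: pt_foldl_orbit => //.
have [rl Hrl] := pt_size Hl; have [rz Hrz] := pt_size Hz.
exists (rz + rl * (q \Po ('X + rl)))%R => x i; rewrite !pevalE.
have key k b : esize (foldl (f x) b k) <=
    esize b + esize k * peval q (esize x + esize k).
  elim: k b => [|a k IH] b; first by rewrite /=; lia.
  apply: leq_trans (IH _) _; rewrite esize_cons.
  have le1 : peval q (esize x + esize k) <=
    peval q (esize x + (esize a + esize k).+1) by apply: peval_le; lia.
  have le2 : peval q (esize x + esize a) <=
    peval q (esize x + (esize a + esize k).+1) by apply: peval_le; lia.
  have := Hq x b a; move: le1 le2.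
  move: (peval q _) (peval q _) (peval q _) => u v w; nia.
apply: leq_trans (key _ _) _; apply: leq_add => //.
have le1 : esize (take i (l x)) <= peval rl (esize x).
  apply: leq_trans (Hrl x); rewrite -{2}(cat_take_drop i (l x)).
  have E : esize (take i (l x) ++ drop i (l x)) + 1 =
    esize (take i (l x)) + esize (drop i (l x)) by exact: esize_cat.
  have gt0 : 0 < esize (drop i (l x)) by exact: esize_gt0.
  by lia.
by apply: leq_mul => //; apply: peval_le; rewrite leq_add2l.
Qed.

End Folds.

Section Booleans.

Context {X : Type} `{codable X}.

Lemma pt_neg (f : X -> bool) : pt f -> pt (fun x => ~~ f x).
Proof. by move=> Hf; apply: (pt_if Hf); apply: pt_const. Qed.

Lemma pt_and (f g : X -> bool) : pt f -> pt g -> pt (fun x => f x && g x).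
Proof. by move=> Hf Hg; apply: (pt_if Hf Hg); apply: pt_const. Qed.

Lemma pt_or (f g : X -> bool) : pt f -> pt g -> pt (fun x => f x || g x).
Proof. by move=> Hf Hg; apply: (pt_if Hf (pt_const true) Hg). Qed.

Lemma pt_xor (f g : X -> bool) : pt f -> pt g -> pt (fun x => f x (+) g x).
Proof.
move=> Hf Hg; have -> : (fun x => f x (+) g x) =
   (fun x => if f x then ~~ g x else g x) by apply/funext => x; case: (f x).
exact: pt_if Hf (pt_neg Hg) Hg.
Qed.

Lemma pt_eqb (f g : X -> bool) : pt f -> pt g -> pt (fun x => f x == g x).
Proof.
move=> Hf Hg; have -> : (fun x => f x == g x) = (fun x => ~~ (f x (+) g x)).
  by apply/funext => x; case: (f x) (g x) => [] [].
exact: pt_neg (pt_xor Hf Hg).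
Qed.

End Booleans.

Ltac pt_growth c :=
  exists c => ? ? ?; rewrite ?pevalE ?esize_cons ?esize_pair ?esize_nat; try lia.

Section Concatenation.

Context {X A : Type} `{cX : codable X} `{cA : codable A}.

Lemma pt_catrev (f g : X -> seq A) : pt f -> pt g ->
  pt (fun x => catrev (f x) (g x)).
Proof.
move=> Hf Hg; have -> : (fun x => catrev (f x) (g x)) =
    (fun x => foldl (fun l a => a :: l) (g x) (f x)).
  by apply/funext => x; elim: (f x) (g x) => //= a l IH m.
apply: (pt_foldl (f := fun _ l a => a :: l)) => //.
  exact: pt_cons (pt_snd (pt_fst pt_id)) (pt_snd pt_id).
by pt_growth ('X + 1%N%:P : {poly nat})%R.
Qed.

Lemma pt_rev (f : X -> seq A) : pt f -> pt (fun x => rev (f x)).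
Proof. by move=> Hf; apply: (pt_catrev Hf (pt_const [::])). Qed.

Lemma pt_cat (f g : X -> seq A) : pt f -> pt g -> pt (fun x => f x ++ g x).
Proof.
move=> Hf Hg; have -> : (fun x => f x ++ g x) =
    (fun x => catrev (rev (f x)) (g x)).
  by apply/funext => x; rewrite catrevE revK.
exact: pt_catrev (pt_rev Hf) Hg.
Qed.

End Concatenation.

Section Lists.

Context {X A B : Type} `{cX : codable X} `{cA : codable A} `{cB : codable B}.

Lemma pt_map (f : X -> A -> B) (l : X -> seq A) :
  pt (fun p : X * A => f p.1 p.2) -> pt l -> pt (fun x => map (f x) (l x)).
Proof.
move=> Hf Hl; have -> : (fun x => map (f x) (l x)) =
    (fun x => rev (foldl (fun m a => f x a :: m) [::] (l x))).
  apply/funext => x; rewrite -[LHS]cat0s -[X in X ++ _]/(rev [::]).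
  elim: (l x) [::] => [|a s IH] m /=; first by rewrite cats0.
  by rewrite -IH rev_cons cat_rcons.
apply: pt_rev; apply: (pt_foldl (f := fun x m a => f x a :: m)) => //.
- apply: pt_cons (pt_snd pt_id).
  apply: (pt_comp Hf (f := fun p => (p.1.1, p.1.2))).
  exact: pt_pair (pt_fst (pt_fst pt_id)) (pt_snd (pt_fst pt_id)).
- have [q Hq] := pt_size Hf; exists ((q \Po ('X + 1%N%:P)) + 1%N%:P)%R.
  move=> x m a; rewrite esize_cons !pevalE.
  have := Hq (x, a); rewrite esize_pair /=; rewrite -[(_ + _).+1]addn1; lia.
- exact: pt_const.
Qed.

Lemma pt_filter (P : X -> A -> bool) (l : X -> seq A) :
  pt (fun p : X * A => P p.1 p.2) -> pt l -> pt (fun x => filter (P x) (l x)).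
Proof.
move=> HP Hl; have -> : (fun x => filter (P x) (l x)) =
    (fun x => rev (foldl (fun m a => if P x a then a :: m else m) [::] (l x))).
  apply/funext => x; rewrite -[LHS]cat0s -[X in X ++ _]/(rev [::]).
  elim: (l x) [::] => [|a s IH] m /=; first by rewrite cats0.
  by rewrite -IH; case: ifP => // _; rewrite rev_cons cat_rcons.
apply: pt_rev.
apply: (pt_foldl (f := fun x m a => if P x a then a :: m else m)) => //.
- apply: pt_if; last exact: pt_snd pt_id.
    apply: (pt_comp HP (f := fun p => (p.1.1, p.1.2))).
    exact: pt_pair (pt_fst (pt_fst pt_id)) (pt_snd (pt_fst pt_id)).
  exact: pt_cons (pt_snd (pt_fst pt_id)) (pt_snd pt_id).
- exists ('X + 1%N%:P)%R => x m a; case: ifP => _; rewrite ?esize_cons !pevalE; lia.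
- exact: pt_const.
Qed.

Lemma pt_has (P : X -> A -> bool) (l : X -> seq A) :
  pt (fun p : X * A => P p.1 p.2) -> pt l -> pt (fun x => has (P x) (l x)).
Proof.
move=> HP Hl; have -> : (fun x => has (P x) (l x)) =
    (fun x => ~~ nilp (filter (P x) (l x))).
  by apply/funext => x; rewrite /nilp size_filter -lt0n has_count.
exact: pt_neg (pt_nilp (pt_filter HP Hl)).
Qed.

Lemma pt_all (P : X -> A -> bool) (l : X -> seq A) :
  pt (fun p : X * A => P p.1 p.2) -> pt l -> pt (fun x => all (P x) (l x)).
Proof.
move=> HP Hl; have -> : (fun x => all (P x) (l x)) =
    (fun x => ~~ has (fun a => ~~ P x a) (l x)).
  by apply/funext => x; rewrite -all_predC; apply: eq_all => a /=; rewrite negbK.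
by apply: pt_neg; apply: (pt_has (P := fun x a => ~~ P x a)) => //; apply: pt_neg.
Qed.

Lemma pt_size_seq (f : X -> seq A) : pt f -> pt (fun x => size (f x)).
Proof.
move=> Hf; have -> : (fun x => size (f x)) =
    (fun x => foldl (fun n _ => n.+1) 0 (f x)).
  apply/funext => x; rewrite -[LHS]addn0.
  by elim: (f x) 0 => //= a l IH n; rewrite -IH addSnnS.
apply: (pt_foldl (f := fun _ n _ => n.+1)) => //.
- exact: pt_succ (pt_snd pt_id).
- by pt_growth (2%N%:P : {poly nat})%R.
- exact: pt_const.
Qed.

Lemma pt_flatten (f : X -> seq (seq A)) : pt f -> pt (fun x => flatten (f x)).
Proof.
move=> Hf; have -> : (fun x => flatten (f x)) =
    (fun x => foldl (fun m l => l ++ m) [::] (rev (f x))).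
  by apply/funext => x; rewrite foldl_rev.
apply: (pt_foldl (f := fun _ m l => l ++ m)).
- exact: pt_cat (pt_snd (pt_fst pt_id)) (pt_snd pt_id).
- exists 'X%R => x m l; have E : esize (l ++ m) + 1 = esize l + esize m
    by exact: esize_cat.
  by rewrite pevalE; lia.
- exact: pt_rev.
- exact: pt_const.
Qed.

Lemma pt_iter (f : X -> A -> A) (n : X -> nat) (z : X -> A) :
  pt (fun p : X * A => f p.1 p.2) ->
  (exists q : {poly nat}, forall x a,
    esize (f x a) <= esize a + peval q (esize x)) ->
  pt n -> pt z -> pt (fun x => iter (n x) (f x) (z x)).
Proof.
move=> Hf [q Hq] Hn Hz; have -> : (fun x => iter (n x) (f x) (z x)) =
    (fun x => foldl (fun a (_ : unit) => f x a) (z x) (nseq (n x) tt)).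
  apply/funext => x; elim: (n x) (z x) => //= k IH b.
  by rewrite -IH -iterSr.
apply: (pt_foldl (f := fun x a _ => f x a)) => //.
- apply: (pt_comp Hf (f := fun p => (p.1.1, p.2))).
  exact: pt_pair (pt_fst (pt_fst pt_id)) (pt_snd pt_id).
- exists q => x b u; apply: leq_trans (Hq x b) _; rewrite leq_add2l.
  by apply: peval_le; lia.
(* The conversion is free: a number and the list of that many units have equal codes. *)
- apply: (pt_comp (g := fun n => nseq n tt)) => //.
  apply: (pt_code (u := id) pt_id) => // k.
  by elim: k => //= k; rewrite /enc /= => <-.
Qed.

End Lists.

Lemma pt_add {X} `{codable X} (f g : X -> nat) : pt f -> pt g -> pt (fun x => f x + g x).
Proof.
move=> Hf Hg; have -> : (fun x => f x + g x) = (fun x => iter (f x) S (g x)).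
  by apply/funext => x; elim: (f x) => //= n <-.
apply: (pt_iter (f := fun _ => S)) => //; first exact: pt_succ (pt_snd pt_id).
by exists (2%N%:P)%R => x n; rewrite !esize_nat pevalE; lia.
Qed.

Lemma pt_mul {X} `{codable X} (f g : X -> nat) : pt f -> pt g -> pt (fun x => f x * g x).
Proof.
move=> Hf Hg; have -> : (fun x => f x * g x) =
    (fun x => iter (f x) (addn (g x)) 0).
  by apply/funext => x; elim: (f x) => //= n <-; rewrite mulSn.
apply: (pt_iter (f := fun x => addn (g x))) => //.
- exact: pt_add (pt_comp Hg (pt_fst pt_id)) (pt_snd pt_id).
- have [q Hq] := pt_size Hg; exists q => x n.
  by have := Hq x; rewrite !esize_nat; lia.
- exact: pt_const.
Qed.

Lemma pt_sub {X} `{codable X} (f g : X -> nat) : pt f -> pt g -> pt (fun x => f x - g x).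
Proof.
move=> Hf Hg; have -> : (fun x => f x - g x) =
    (fun x => iter (g x) predn (f x)).
  by apply/funext => x; rewrite iter_predn.
apply: (pt_iter (f := fun _ => predn)) => //.
  exact: pt_pred (pt_snd pt_id).
by exists (0%N%:P)%R => x n; rewrite !esize_nat pevalE; lia.
Qed.

Lemma pt_leq {X} `{codable X} (f g : X -> nat) : pt f -> pt g -> pt (fun x => f x <= g x).
Proof. by move=> Hf Hg; apply: pt_eq0; apply: pt_sub. Qed.

Lemma pt_eqn {X} `{codable X} (f g : X -> nat) : pt f -> pt g -> pt (fun x => f x == g x).
Proof.
move=> Hf Hg; have -> : (fun x => f x == g x) =
   (fun x => (f x <= g x) && (g x <= f x)).
  by apply/funext => x; rewrite eqn_leq.
exact: pt_and (pt_leq Hf Hg) (pt_leq Hg Hf).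
Qed.

Lemma pt_half_odd {X} `{codable X} (f : X -> nat) : pt f -> pt (fun x => ((f x)./2, odd (f x))).
Proof.
move=> Hf; pose step (s : nat * bool) := (if s.2 then s.1.+1 else s.1, ~~ s.2).
have -> : (fun x => ((f x)./2, odd (f x))) =
    (fun x => iter (f x) step (0, false)).
  apply/funext => x; elim: (f x) => //= n <-; rewrite /step /= uphalf_half.
  by case: odd.
apply: (pt_iter (f := fun _ => step)) => //.
- apply: pt_pair; last exact: pt_neg (pt_snd (pt_snd pt_id)).
  apply: pt_if; first exact: pt_snd (pt_snd pt_id).
    exact: pt_succ (pt_fst (pt_snd pt_id)).
  exact: pt_fst (pt_snd pt_id).
- exists (5%N%:P)%R => x [n b]; rewrite !esize_pair /= !esize_nat pevalE.
  by have := esize_bool (~~ b); case: b => /=; rewrite ?esize_nat; lia.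
- exact: pt_const.
Qed.

(** The item pushed grows with the accumulator, so the growth condition of [pt_foldl] does not
    apply; the partial results are initial ranges and are bounded directly. *)
Lemma pt_iota {X} `{codable X} (f g : X -> nat) : pt f -> pt g -> pt (fun x => iota (f x) (g x)).
Proof.
move=> Hf Hg.
pose step m (l : seq nat) (_ : unit) := (m + size l) :: l.
have stepE m n : foldl (step m) [::] (nseq n tt) = rev (iota m n).
  elim: n => // n IH; rewrite -addn1 nseqD foldl_cat IH iotaD rev_cat.
  by rewrite /= /step size_rev size_iota.
have -> : (fun x => iota (f x) (g x)) =
    (fun x => rev (foldl (step (f x)) [::] (nseq (g x) tt))).
  by apply/funext => x; rewrite stepE revK.
apply: pt_rev; apply: (pt_foldl_orbit (f := fun x => step (f x))).
- apply: pt_cons; last exact: pt_snd pt_id.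
  apply: pt_add; last exact: pt_size_seq (pt_snd pt_id).
  exact: pt_comp Hf (pt_fst (pt_fst pt_id)).
- have [p Hp] := pt_size Hf; have [q Hq] := pt_size Hg.
  exists (q * (2%N%:P * p + 2%N%:P * q + 2%N%:P) + 1%N%:P)%R => x i.
  have -> : take i (nseq (g x) tt) = nseq (minn i (g x)) tt.
    by elim: i (g x) => [|i IH] [|n] //=; rewrite minnSS /= IH.
  rewrite stepE esize_rev.
  have size_le m n : esize (iota m n) <= n * (2 * m + 2 * n + 2) + 1.
    elim: n m => // n IH m; rewrite /= esize_cons esize_nat.
    by have := IH m.+1; nia.
  apply: leq_trans (size_le _ _) _; rewrite !pevalE.
  have := Hp x; have := Hq x; rewrite !esize_nat.
  by have := geq_minr i (g x); nia.
- apply: (pt_comp (g := fun n => nseq n tt)) => //.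
  apply: (pt_code (u := id) pt_id) => // k.
  by elim: k => //= k; rewrite /enc /= => <-.
- exact: pt_const.
Qed.

Lemma pt_poly {X} `{codable X} (p : {poly nat}) (f : X -> nat) : pt f ->
  pt (fun x => peval p (f x)).
Proof.
move=> Hf; elim/poly_ind: p => [|p c IH].
  have -> : (fun x => peval 0%R (f x)) = (fun=> 0); last exact: pt_const.
  by apply/funext => x; rewrite /peval horner0.
have -> : (fun x => peval (p * 'X + c%:P)%R (f x)) =
    (fun x => peval p (f x) * f x + c).
  by apply/funext => x; rewrite !pevalE.
exact: pt_add (pt_mul IH Hf) (pt_const c).
Qed.

Section Access.

Context {X A : Type} `{cX : codable X} `{cA : codable A}.

Lemma esize_behead (l : seq A) : esize (behead l) <= esize l.
Proof. by case: l => // a l; rewrite esize_cons /=; lia. Qed.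

Lemma pt_drop (n : X -> nat) (l : X -> seq A) : pt n -> pt l ->
  pt (fun x => drop (n x) (l x)).
Proof.
move=> Hn Hl; have -> : (fun x => drop (n x) (l x)) =
    (fun x => iter (n x) behead (l x)).
  apply/funext => x; elim: (n x) (l x) => [|k IH] s; first exact: drop0.
  by rewrite iterSr -IH; case: s.
apply: (pt_iter (f := fun _ => behead)) => //.
  exact: pt_behead (pt_snd pt_id).
by exists 0%R => x k; apply: leq_trans (esize_behead k) _; apply: leq_addr.
Qed.

Lemma pt_nth (a0 : A) (l : X -> seq A) (n : X -> nat) : pt l -> pt n ->
  pt (fun x => nth a0 (l x) (n x)).
Proof.
move=> Hl Hn; have -> : (fun x => nth a0 (l x) (n x)) =
    (fun x => head a0 (drop (n x) (l x))).
  by apply/funext => x; rewrite -nth0 nth_drop addn0.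
exact: pt_head (pt_drop Hn Hl).
Qed.

End Access.

Lemma pt_eqseq {X} {A : eqType} `{cX : codable X} `{cA : codable A} (a0 : A)
    (f g : X -> seq A) :
  pt (fun p : A * A => p.1 == p.2) -> pt f -> pt g -> pt (fun x => f x == g x).
Proof.
move=> HA Hf Hg.
have -> : (fun x => f x == g x) = (fun x => (size (f x) == size (g x)) &&
    all (fun i => nth a0 (f x) i == nth a0 (g x) i) (iota 0 (size (f x)))).
  apply/funext => x; apply/eqP/andP => [->|[/eqP E /allP H]].
    by split=> //; apply/allP.
  apply: (@eq_from_nth _ a0) => // i lti; apply/eqP/H.
  by rewrite mem_iota.
apply: pt_and; first exact: pt_eqn (pt_size_seq Hf) (pt_size_seq Hg).
apply: (pt_all (P := fun x i => nth a0 (f x) i == nth a0 (g x) i)).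
  apply: (pt_comp HA (f := fun p => (nth a0 (f p.1) p.2, nth a0 (g p.1) p.2))).
  by apply: pt_pair; apply: pt_nth (pt_snd pt_id); apply: pt_comp (pt_fst pt_id).
exact: pt_iota (pt_const 0) (pt_size_seq Hf).
Qed.

(** * From functions on trees to functions on bit strings *)

Definition encode_bits : cmd :=
  Loop R1 isSome (If R1 is_one
    (Seq (Pop R1) (Seq (Push R0 false) (Seq (Push R0 false)
      (Seq (Push R0 true) (Push R0 true)))))
    (Seq (Pop R1) (Seq (Push R0 false) (Push R0 true)))).

(** In the code of a list, an item [true] contributes [1100] and an item [false] contributes [10].
    One round of the loop takes at most 11 steps. *)
Lemma runs_encode_bits (w v : seq bool) B : 11 * size w < B ->
  runs encode_bits (code (enc v), w, [::], [::]) B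
    (on_top (code (enc (catrev w v)))).
Proof.
elim: w v B => [|b w IH] v B /= leB; first exact: runs_loop_stop.
apply: (@runs_loop_step _ _ _ _ (code (enc (b :: v)), w, [::], [::]) _ 10
  (B - 11)) => //.
- by apply: (@runs_if _ _ _ _ _ _ 9) => //; case: b => /=; run_straight.
- by apply: IH; lia.
- by lia.
Qed.

Definition decode_bits : cmd :=
  Loop R0 is_one (Seq (Pop R0) (If R0 is_one
    (Seq (Pop R0) (Seq (Pop R0) (Seq (Pop R0) (Push R1 true))))
    (Seq (Pop R0) (Push R1 false)))).

Lemma runs_decode_bits (w v : seq bool) B : 11 * size w < B ->
  runs decode_bits (code (enc w), v, [::], [::]) B
    ([:: false], catrev w v, [::], [::]).
Proof.
elim: w v B => [|b w IH] v B /= leB; first exact: runs_loop_stop.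
apply: (@runs_loop_step _ _ _ _ (code (enc w), b :: v, [::], [::]) _ 10
  (B - 11)) => //.
- apply: (@runs_seq _ _ _ (code (enc b) ++ code (enc w), v, [::], [::]) _ 1 8).
  + by run_straight.
  + by apply: (@runs_if _ _ _ _ _ _ 7) => //; case: b => /=; run_straight.
  + by [].
- by apply: IH; lia.
- by lia.
Qed.

Lemma esize_bits (w : seq bool) : esize w <= 4 * size w + 1.
Proof.
elim: w => // b w IH; rewrite esize_cons /=.
by have := esize_bool b; lia.
Qed.

(** A list is built from its end, so the input is reversed before being encoded, and the output
    after being decoded. The factor 16 is 5 + 11, the cost per bit of a pour and of a recoding. *)
Theorem pt_polytime (f : seq bool -> seq bool) : pt f -> polytime_computable f.
Proof.
move=> Hf; have [r Hr] := pt_size Hf; case: Hf => c [p Hc].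
pose e : {poly nat} := (4%N%:P * 'X + 1%N%:P)%R.
apply: (@run_polytime (Seq (pour R0 R1) (Seq (Push R0 false) (Seq encode_bits
  (Seq c (Seq decode_bits (Seq (Pop R0) (pour R1 R0))))))) _
  (16%N%:P * 'X + (p \Po e) + 16%N%:P * (r \Po e) + 30%N%:P)%R) => w.
have lep : peval p (esize w) <= peval (p \Po e) (size w).
  by rewrite peval_comp; apply: peval_le; rewrite !pevalE esize_bits.
have ler : size (f w) <= peval (r \Po e) (size w).
  apply: leq_trans (ltnW (size_esize (f w))) _; apply: leq_trans (Hr w) _.
  by rewrite peval_comp; apply: peval_le; rewrite !pevalE esize_bits.
have [n len Hn] : runs (Seq (pour R0 R1) (Seq (Push R0 false) (Seq encode_bits
  (Seq c (Seq decode_bits (Seq (Pop R0) (pour R1 R0)))))))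
  (w, [::], [::], [::]) (peval (16%N%:P * 'X + (p \Po e) + 16%N%:P * (r \Po e) +
    30%N%:P)%R (size w)) (f w, [::], [::], [::]); last first.
  by exists n, [::], [::], [::].
apply: (@runs_seq _ _ _ ([::], rev w, [::], [::]) _ (5 * size w).+1).
- by apply: runs_pourE; rewrite //= cats0.
- apply: (@runs_seq _ _ _ ([:: false], rev w, [::], [::]) _ 1).
  + by run_straight.
  + apply: (@runs_seq _ _ _ (on_top (code (enc w))) _ (11 * size w).+1).
    * rewrite -[in enc w](revK w).
      by apply: (@runs_encode_bits (rev w) [::]); rewrite size_rev.
    * apply: (@runs_seq _ _ _ (on_top (code (enc (f w)))) _ (peval p (esize w))).
      - by have := Hc w [::]; rewrite !cats0.
      - apply: (@runs_seq _ _ _ ([:: false], rev (f w), [::], [::]) _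
          (11 * size (f w)).+1); first exact: runs_decode_bits.
        + apply: (@runs_seq _ _ _ ([::], rev (f w), [::], [::]) _ 1
           (5 * size (f w)).+1).
          * by run_straight.
          * by apply: runs_pourE; rewrite //= ?size_rev // revK cats0.
          * exact: ltnSn.
        + exact: ltnSn.
      - exact: ltnSn.
    * exact: ltnSn.
  + exact: ltnSn.
- by rewrite !pevalD !pevalM !pevalC pevalX; lia.
Qed.

Corollary pt_in_P (chi : seq bool -> bool) : pt chi -> in_P (fun w => chi w).
Proof.
move=> Hchi; exists chi => //; apply: pt_polytime.
exact: pt_cons Hchi (pt_const [::]).
Qed.

(** * Membership in NP *)

Lemma pt_apply {X A B C} `{codable X} `{codable A} `{codable B} `{codable C}
    (h : A -> B -> C) (f : X -> A) (g : X -> B) :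
  pt (fun p : A * B => h p.1 p.2) -> pt f -> pt g -> pt (fun x => h (f x) (g x)).
Proof. by move=> Hh Hf Hg; apply: (pt_comp Hh (pt_pair Hf Hg)). Qed.

Ltac pt_basic :=
  lazymatch goal with
  | |- @pt _ _ _ _ (fun x => x) => exact: pt_id
  | |- @pt _ _ _ _ (fun _ => ?c) => exact: pt_const
  | |- @pt _ _ _ _ fst => exact: (pt_fst pt_id)
  | |- @pt _ _ _ _ snd => exact: (pt_snd pt_id)
  | |- @pt _ _ _ _ (fun x => fst (@?f x)) => apply: (pt_fst (f := f))
  | |- @pt _ _ _ _ (fun x => snd (@?f x)) => apply: (pt_snd (f := f))
  | |- @pt _ _ _ _ (fun x => (@?f x, @?g x)) => apply: (pt_pair (f := f) (g := g))
  | |- @pt _ _ _ _ (fun x => (@?f x) :: (@?g x)) =>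
      apply: (pt_cons (f := f) (g := g))
  | |- @pt _ _ _ _ (fun x => S (@?f x)) => apply: (pt_succ (f := f))
  | |- @pt _ _ _ _ (fun x => addn (@?f x) (@?g x)) =>
      apply: (pt_add (f := f) (g := g))
  | |- @pt _ _ _ _ (fun x => muln (@?f x) (@?g x)) =>
      apply: (pt_mul (f := f) (g := g))
  | |- @pt _ _ _ _ (fun x => subn (@?f x) (@?g x)) =>
      apply: (pt_sub (f := f) (g := g))
  | |- @pt _ _ _ _ (fun x => leq (@?f x) (@?g x)) =>
      apply: (pt_leq (f := f) (g := g))
  | |- @pt _ _ _ _ (fun x => negb (@?f x)) => apply: (pt_neg (f := f))
  | |- @pt _ _ _ _ (fun x => andb (@?f x) (@?g x)) =>
      apply: (pt_and (f := f) (g := g))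
  | |- @pt _ _ _ _ (fun x => orb (@?f x) (@?g x)) =>
      apply: (pt_or (f := f) (g := g))
  | |- @pt _ _ _ _ (fun x => eq_op (@?f x) (@?g x)) =>
      first [apply: (pt_eqn (f := f) (g := g)) | apply: (pt_eqb (f := f) (g := g))]
  | |- @pt _ _ _ _ (fun x => nilp (@?f x)) => apply: (pt_nilp (f := f))
  | |- @pt _ _ _ _ (fun x => cat (@?f x) (@?g x)) =>
      apply: (pt_cat (f := f) (g := g))
  | |- @pt _ _ _ _ (fun x => rev (@?f x)) => apply: (pt_rev (f := f))
  | |- @pt _ _ _ _ (fun x => flatten (@?f x)) => apply: (pt_flatten (f := f))
  | |- @pt _ _ _ _ (fun x => size (@?f x)) => apply: (pt_size_seq (f := f))
  | |- @pt _ _ _ _ (fun x => nth ?a (@?f x) (@?g x)) =>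
      apply: (pt_nth a (l := f) (n := g))
  | |- @pt _ _ _ _ (fun x => drop (@?f x) (@?g x)) =>
      apply: (pt_drop (n := f) (l := g))
  | |- @pt _ _ _ _ (fun x => iota (@?f x) (@?g x)) =>
      apply: (pt_iota (f := f) (g := g))
  | |- @pt _ _ _ _ (fun x => head ?a (@?f x)) => apply: (pt_head a (f := f))
  | |- @pt _ _ _ _ (fun x => behead (@?f x)) => apply: (pt_behead (f := f))
  | |- @pt _ _ _ _ (fun x => map (@?f x) (@?l x)) =>
      apply: (pt_map (f := f) (l := l))
  | |- @pt _ _ _ _ (fun x => filter (@?P x) (@?l x)) =>
      apply: (pt_filter (P := P) (l := l))
  | |- @pt _ _ _ _ (fun x => has (@?P x) (@?l x)) =>
      apply: (pt_has (P := P) (l := l))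
  | |- @pt _ _ _ _ (fun x => all (@?P x) (@?l x)) =>
      apply: (pt_all (P := P) (l := l))
  | H : @pt _ _ _ _ ?f |- @pt _ _ _ _ ?f => exact: H
  | H : @pt _ _ _ _ ?g |- @pt _ _ _ _ (fun x => ?g (@?f x)) =>
      apply: (pt_comp (g := g) (f := f) H)
  end.

Ltac pt_solve := repeat (pt_basic; cbv beta).

(** The encoding of instances on raw data, without the proofs inside [instance], so that the
    verifier and the reduction can both compute it. *)
Definition encode_data (n : nat) (rho : seq (seq bool * seq bool))
    (rows : seq (seq bool)) : seq bool :=
  rcons (nseq n true) false
  ++ flatten [seq delimited p.1 ++ delimited p.2 | p <- rho]
  ++ flatten [seq true :: r | r <- rows] ++ [:: false].

Definition set_row n (P : {set 'I_n}) : seq bool :=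
  [seq e \in P | e <- enum 'I_n].

Definition row_set n (r : seq bool) : {set 'I_n} :=
  [set i : 'I_n | nth false r i].

Lemma size_set_row n (P : {set 'I_n}) : size (set_row P) = n.
Proof. by rewrite size_map size_enum_ord. Qed.

Lemma nth_set_row n (P : {set 'I_n}) (i : 'I_n) :
  nth false (set_row P) i = (i \in P).
Proof. by rewrite (nth_map i) ?size_enum_ord // nth_ord_enum. Qed.

Lemma set_rowK n : cancel (@set_row n) (@row_set n).
Proof. by move=> P; apply/setP => i; rewrite inE nth_set_row. Qed.

Lemma row_setK n r : size r = n -> set_row (row_set n r) = r.
Proof.
move=> sz; apply: (@eq_from_nth _ false); rewrite size_set_row // => i lti.
by rewrite (nth_set_row _ (Ordinal lti)) inE.
Qed.

Lemma encodeE (I : instance) : encode I = encode_data (ground_size I)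
  [seq (binary (rho_num e), binary (rho_den e)) | e <- enum 'I_(ground_size I)]
  [seq set_row P | P <- Defs.family I].
Proof. by rewrite /encode /encode_data -!map_comp. Qed.

Lemma pt_delimited {X} `{codable X} (f : X -> seq bool) : pt f -> pt (fun x => delimited (f x)).
Proof. by move=> Hf; rewrite /delimited; pt_solve. Qed.

Lemma pt_nseq {X} `{codable X} {A} `{codable A} (a : A) (f : X -> nat) : pt f ->
  pt (fun x => nseq (f x) a).
Proof.
move=> Hf; have -> : (fun x => nseq (f x) a) =
    (fun x => [seq a | _ <- iota 0 (f x)]).
  apply/funext => x; elim: (f x) 0 => //= n IH m.
  by rewrite -IH.
by pt_solve.
Qed.

Lemma pt_encode_data {X} `{codable X} (n : X -> nat) (rho : X -> seq (seq bool * seq bool))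
    (rows : X -> seq (seq bool)) :
  pt n -> pt rho -> pt rows -> pt (fun x => encode_data (n x) (rho x) (rows x)).
Proof.
move=> Hn Hrho Hrows; rewrite /encode_data.
apply: pt_cat.
  have -> : (fun x => rcons (nseq (n x) true) false) =
    (fun x => nseq (n x) true ++ [:: false]).
    by apply/funext => x; rewrite cats1.
  by apply: pt_cat; [apply: pt_nseq|apply: pt_const].
apply: pt_cat; last by pt_solve.
apply: pt_flatten; apply: pt_map => //.
by apply: pt_cat; apply: pt_delimited; pt_solve.
Qed.

(* A natural number is represented by a list of exponents, as a sum of powers
   of two: addition is concatenation and multiplication is the list of all
   pairwise sums. *)
Definition exp_value (l : seq nat) : nat := \sum_(k <- l) 2 ^ k.

Definition exponents (b : seq bool) : seq nat :=
  [seq i <- iota 0 (size b) | nth false b i].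

Definition sum_pairs (l1 l2 : seq nat) : seq nat :=
  flatten [seq [seq i + j | j <- l2] | i <- l1].

Lemma exp_value_sum_pairs l1 l2 : exp_value (sum_pairs l1 l2) = exp_value l1 * exp_value l2.
Proof.
rewrite /exp_value /sum_pairs; elim: l1 => [|i l1 IH] /=; first by rewrite !big_nil.
rewrite big_cat /= IH big_cons mulnDl big_map; congr (_ + _).
by rewrite big_distrr /=; apply: eq_bigr => j _; rewrite expnD.
Qed.

(** Column addition in base two: the parity of this number is the bit of the sum at level [k], and
    its half is the carry into the next level. *)
Definition carry (l : seq nat) (c k : nat) : nat := c + count_mem k l.

Definition compare_step (l1 l2 : seq nat) (s : nat * nat * bool) (k : nat) :=
  (((carry l1 s.1.1 k)./2, (carry l2 s.1.2 k)./2),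
   s.2 && (odd (carry l1 s.1.1 k) == odd (carry l2 s.1.2 k))).

(** The sum of the exponents, an upper bound for each of them, written with operations already known
    to be polynomial. *)
Definition levels (l : seq nat) : nat := size (flatten [seq iota 0 k | k <- l]).

Definition same_value (l1 l2 : seq nat) : bool :=
  let s := foldl (compare_step l1 l2) ((0, 0), true)
    (iota 0 (levels l1 + levels l2).+1) in
  s.2 && (s.1.1 == s.1.2).

Definition tail_value (l : seq nat) (m : nat) : nat :=
  \sum_(k <- l | m <= k) 2 ^ (k - m).

Lemma tail_valueS l m : tail_value l m = count_mem m l + (tail_value l m.+1).*2.
Proof.
rewrite /tail_value; elim: l => [|k l IH]; first by rewrite !big_nil.
rewrite !big_cons /= IH; move: (\sum_(_ <- _ | _) _) (count_mem m l) => u v.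
case: (ltngtP m k) => [lt_mk|gt_mk|->].
- rewrite (_ : k - m = (k - m.+1).+1) ?expnS; last by lia.
  by move: (2 ^ _) => y; lia.
- by [].
- by rewrite subnn expn0; lia.
Qed.

Lemma levelsE l : levels l = sumn l.
Proof.
rewrite /levels size_flatten /shape -map_comp; congr sumn.
by rewrite -[RHS]map_id; apply: eq_map => k /=; rewrite size_iota.
Qed.

Lemma tail_value0 l m : sumn l < m -> tail_value l m = 0.
Proof.
rewrite /tail_value; elim: l => [|k l IH] /= lt; first by rewrite big_nil.
by rewrite big_cons IH; [case: leqP => //|]; lia.
Qed.

(** At level [m] it remains to compare the numbers [c + tail_value l m]. Equality forces equal
    parities, and the halves are the numbers to be compared at the next level. Past all exponents
    the tails vanish and only the carries are left. *)
Lemma same_valueE l1 l2 : same_value l1 l2 = (exp_value l1 == exp_value l2).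
Proof.
pose res (s : nat * nat * bool) := s.2 && (s.1.1 == s.1.2).
have key j m c1 c2 b : sumn l1 < m + j -> sumn l2 < m + j ->
    res (foldl (compare_step l1 l2) ((c1, c2), b) (iota m j)) =
    b && (c1 + tail_value l1 m == c2 + tail_value l2 m).
  elim: j m c1 c2 b => [|j IH] m c1 c2 b lt1 lt2.
    by rewrite /res /= !tail_value0 ?addn0 //; lia.
  rewrite /= IH; try lia; rewrite /carry -andbA; congr (_ && _).
  rewrite !(tail_valueS _ m) !addnA.
  move: (c1 + _) (c2 + _) (tail_value _ _) (tail_value _ _) => x y u v.
  apply/andP/eqP => [[/eqP e1 /eqP e2]|e].
    by rewrite -(odd_double_half x) -(odd_double_half y) e1; lia.
  by split; apply/eqP; lia.
rewrite /same_value -/(res _) key ?levelsE; try lia; rewrite !add0n.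
congr (_ == _); rewrite /tail_value /exp_value;
  by apply: eq_big => // k _; rewrite subn0.
Qed.

Lemma pt_same_value {X} `{codable X} (f g : X -> seq nat) : pt f -> pt g ->
  pt (fun x => same_value (f x) (g x)).
Proof.
apply: (pt_apply (h := same_value)); rewrite /same_value.
have carryE (l : seq nat) c k : carry l c k = c + size [seq i <- l | i == k].
  by rewrite size_filter.
have Hl (h : seq nat * seq nat -> seq nat) : pt h -> pt (fun p => levels (h p)).
  by move=> Hh; rewrite /levels; pt_solve.
have Hs : pt (fun p : seq nat * seq nat => foldl (compare_step p.1 p.2)
   ((0, 0), true) (iota 0 (levels p.1 + levels p.2).+1)); last by pt_solve.
apply: (pt_foldl (f := fun p => compare_step p.1 p.2)).
- rewrite /compare_step.
  have Hc (h : (seq nat * seq nat) * nat * (nat * nat * bool) -> seq nat)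
     (c : (seq nat * seq nat) * nat * (nat * nat * bool) -> nat) :
    pt h -> pt c -> pt (fun p => ((carry (h p) (c p) p.1.2)./2,
       odd (carry (h p) (c p) p.1.2))).
    move=> Hh Hc; apply: (pt_half_odd (f := fun p => carry (h p) (c p) p.1.2)).
    rewrite (_ : (fun p => carry _ _ _) = (fun p => c p +
      size [seq i <- h p | i == p.1.2])); last by apply/funext => p.
    by apply: pt_add => //; apply: pt_size_seq; apply: pt_filter => //; pt_solve.
  have H1 := Hc (fun p => p.1.1.1) (fun p => p.2.1.1).
  have H2 := Hc (fun p => p.1.1.2) (fun p => p.2.1.2).
  have {}H1 := H1 (pt_fst (pt_fst (pt_fst pt_id))) (pt_fst (pt_fst (pt_snd pt_id))).
  have {}H2 := H2 (pt_snd (pt_fst (pt_fst pt_id))) (pt_snd (pt_fst (pt_snd pt_id))).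
  apply: pt_pair.
    by apply: pt_pair; [apply: (pt_fst H1)|apply: (pt_fst H2)].
  apply: pt_and; first by pt_solve.
  by apply: pt_eqb; [apply: (pt_snd H1)|apply: (pt_snd H2)].
(* Unary carries are affordable: a level increases a carry by at most the length of the list. *)
- exists (2%N%:P * 'X + 10%N%:P)%R => -[l1 l2] [[c1 c2] b] k.
  rewrite /compare_step !esize_pair /= !esize_nat !pevalE.
  have b1 (b' : bool) : esize b' <= 3 by exact: esize_bool.
  have cl (l : seq nat) c : (carry l c k)./2 <= c + esize l.
    have : count_mem k l <= size l by exact: count_size.
    have : size l < esize l by exact: size_esize.
    by rewrite /carry; lia.
  by have := b1 (b && (odd (carry l1 c1 k) == odd (carry l2 c2 k)));
    have := cl l1 c1; have := cl l2 c2; lia.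
- have H1 := Hl _ (pt_fst pt_id); have H2 := Hl _ (pt_snd pt_id).
  exact: pt_iota (pt_const 0) (pt_succ (pt_add H1 H2)).
- exact: pt_const.
Qed.

(* Marginals, incidence vectors of the family, and the decomposition: a pair
   [(S, k)] stands for the set [S] with weight [2 ^ k], before normalization. *)
Definition certificate : Type :=
  seq (seq bool * seq bool) * seq (seq bool) * seq (seq bool * nat).

Definition weights (c : seq (seq bool * nat)) : seq nat := [seq p.2 | p <- c].

Definition weights_at (c : seq (seq bool * nat)) (e : nat) : seq nat :=
  weights [seq p <- c | nth false p.1 e].

Definition meets (n : nat) (s r : seq bool) : bool :=
  has (fun i => nth false s i && nth false r i) (iota 0 n).

Definition valid_row (n : nat) (rows : seq (seq bool)) (r : seq bool) : bool :=
  [&& size r == n, size [seq b <- r | b] == 3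
    & size [seq r' <- rows | r' == r] == 1].

(** [head true (rev _)] is the most significant bit, with default [true] for the empty string, so it
    excludes leading zeros. A canonical nonempty denominator is positive. *)
Definition valid_marginal (p : seq bool * seq bool) : bool :=
  [&& head true (rev p.1), head true (rev p.2) & ~~ nilp p.2].

(** The marginal equation at [e], cross-multiplied to avoid division and normalization. *)
Definition valid_at (nums : seq (seq bool * seq bool))
    (c : seq (seq bool * nat)) (e : nat) : bool :=
  same_value
    (sum_pairs (weights_at c e) (exponents (nth ([::], [::]) nums e).2))
    (sum_pairs (exponents (nth ([::], [::]) nums e).1) (weights c)).

(** The certificate carries the instance in decoded form, and [w] is compared with its encoding;
    this replaces parsing [w]. *)
Definition check (w : seq bool) (d : certificate) : bool :=
  [&& w == encode_data (size d.1.1) d.1.1 d.1.2,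
      all (valid_row (size d.1.1) d.1.2) d.1.2,
      all valid_marginal d.1.1,
      ~~ nilp d.2,
      all (fun p => all (meets (size d.1.1) p.1) d.1.2) d.2
    & all (valid_at d.1.1 d.2) (iota 0 (size d.1.1))].

Lemma pt_check {X} `{codable X} (f : X -> seq bool) (g : X -> certificate) :
  pt f -> pt g -> pt (fun x => check (f x) (g x)).
Proof.
have eqbits Y (cY : codable Y) (u v : Y -> seq bool) : pt u -> pt v ->
    pt (fun y => u y == v y).
  by move=> Hu Hv; apply: (pt_eqseq true) => //; pt_solve.
have Hpairs Y (cY : codable Y) (u v : Y -> seq nat) : pt u -> pt v ->
    pt (fun y => sum_pairs (u y) (v y)).
  apply: (pt_apply (h := sum_pairs)).
  by rewrite /sum_pairs; pt_solve.
have Hexp Y (cY : codable Y) (u : Y -> seq bool) : pt u ->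
    pt (fun y => exponents (u y)).
  apply: (pt_comp (g := exponents)).
  by rewrite /exponents; pt_solve.
apply: (pt_apply (h := check)).
rewrite /check /valid_row /valid_marginal /valid_at /meets /weights_at /weights.
by repeat (first [pt_basic | apply: pt_same_value | apply: pt_encode_data
  | apply: (@Hpairs) | apply: (@Hexp)
  | apply: (@eqbits)]; cbv beta).
Qed.

(** * Decoding of certificates and of pairs *)

Definition spine : tree -> seq tree :=
  fix spine t := if t is Node a u then a :: spine u else [::].

Definition tree_bits (t : tree) : seq bool := [seq ~~ is_leaf u | u <- spine t].

(** A left inverse of [enc] that is total on trees. Malformed trees are read as some certificate,
    which is harmless because [check_sound] covers all of them. *)
Definition tree_certificate (t : tree) : certificate :=
  (([seq (tree_bits (hd u), tree_bits (tl u)) | u <- spine (hd (hd t))],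
    [seq tree_bits u | u <- spine (tl (hd t))]),
   [seq (tree_bits (hd u), size (spine (tl u))) | u <- spine (tl t)]).

Lemma spine_enc A `{codable A} (l : seq A) : spine (enc l) = [seq enc a | a <- l].
Proof. by elim: l => //= a l ->. Qed.

Lemma tree_bits_enc (b : seq bool) : tree_bits (enc b) = b.
Proof.
rewrite /tree_bits spine_enc -map_comp -[RHS]map_id.
by apply: eq_map => -[].
Qed.

Lemma tree_certificate_enc (d : certificate) : tree_certificate (enc d) = d.
Proof.
case: d => [[nums rows] c]; rewrite /tree_certificate /= !spine_enc -!map_comp.
congr (_, _, _); rewrite -[RHS]map_id; apply: eq_map.
- by move=> [u v] /=; rewrite !tree_bits_enc.
- by move=> u /=; rewrite tree_bits_enc.
- move=> [u k] /=; rewrite tree_bits_enc; congr (_, _).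
  by elim: k => //= k ->.
Qed.

(** A prefix code is evaluated from the right: when a [true] is met, its two subtrees lie on top of
    the stack. *)
Definition parse_step (s : seq tree) (b : bool) : seq tree :=
  if b then Node (head Leaf s) (head Leaf (behead s)) :: behead (behead s)
  else Leaf :: s.

Definition parse (u : seq bool) : tree :=
  head Leaf (foldl parse_step [::] (rev u)).

Lemma parse_code t : parse (code t) = t.
Proof.
rewrite /parse; suff -> s : foldl parse_step s (rev (code t)) = t :: s by [].
elim: t s => //= a IHa b IHb s.
by rewrite rev_cons rev_cat foldl_rcons foldl_cat IHb IHa.
Qed.

(* In [delimited w ++ u], the first [false] at an even position [i + i] ends
   the code of [w], so that [i = size w]. *)
Definition delimited_size (s : seq bool) : nat :=
  head 0 [seq i <- iota 0 (size s) | ~~ nth false s (i + i)].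

Definition pair_fst (s : seq bool) : seq bool :=
  [seq nth false s (i + i).+1 | i <- iota 0 (delimited_size s)].

Definition pair_snd (s : seq bool) : seq bool :=
  drop (delimited_size s + delimited_size s).+1 s.

Lemma delimited_cons b w : delimited (b :: w) = [:: true, b & delimited w].
Proof. by []. Qed.

Lemma size_delimited w : size (delimited w) = (size w + size w).+1.
Proof. by elim: w => // b w IH; rewrite delimited_cons /= IH; lia. Qed.

Lemma delimited_sizeE w u : delimited_size (pair_code w u) = size w.
Proof.
have E0 : nth false (pair_code w u) (size w + size w) = false.
  rewrite /pair_code; elim: w => // b w IH.
  by rewrite delimited_cons /= addnS /= IH.
have E1 i : i < size w -> nth false (pair_code w u) (i + i) = true.
  rewrite /pair_code; elim: w i {E0} => // b w IH [|i] lti //.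
  by rewrite delimited_cons addnS /= IH.
rewrite /delimited_size.
have -> : size (pair_code w u) = size w + (size w + size u).+1.
  by rewrite size_cat size_delimited; lia.
rewrite iotaD filter_cat (@eq_in_filter _ _ pred0) ?filter_pred0 /=.
  by rewrite add0n E0.
by move=> i; rewrite mem_iota add0n /= => lti; rewrite E1.
Qed.

Lemma pair_fstK w u : pair_fst (pair_code w u) = w.
Proof.
apply: (@eq_from_nth _ false); rewrite /pair_fst size_map size_iota
  delimited_sizeE // => i lti.
rewrite (nth_map 0) ?size_iota // nth_iota // add0n /pair_code.
elim: w i lti => // b w IH [|i] lti //.
by rewrite delimited_cons addnS /= IH.
Qed.

Lemma pair_sndK w u : pair_snd (pair_code w u) = u.
Proof.
by rewrite /pair_snd delimited_sizeE drop_cat size_delimited ltnn subnn drop0.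
Qed.

Definition verifier (s : seq bool) : bool :=
  check (pair_fst s) (tree_certificate (parse (pair_snd s))).

Lemma pt_verifier : pt verifier.
Proof.
have Hs X (cX : codable X) (f : X -> tree) : pt f -> pt (fun x => spine (f x)).
  apply: (pt_comp (g := spine)); apply: (pt_code (u := id) pt_id) => // t.
  by elim: t => // a _ b IH; apply: (congr1 (Node a) IH).
have Hhd X (cX : codable X) (f : X -> tree) : pt f -> pt (fun x => hd (f x)).
  exact: (pt_comp pt_hd).
have Htl X (cX : codable X) (f : X -> tree) : pt f -> pt (fun x => tl (f x)).
  exact: (pt_comp pt_tl).
have Hil X (cX : codable X) (f : X -> tree) : pt f -> pt (fun x => is_leaf (f x)).
  exact: (pt_comp pt_is_leaf).
have Hn X (cX : codable X) (f g : X -> tree) : pt f -> pt g ->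
    pt (fun x => Node (f x) (g x)).
  by move=> Hf Hg; apply: (pt_code (u := id)) (pt_pair Hf Hg) _ _.
have Hp X (cX : codable X) (f : X -> seq bool) : pt f ->
    pt (fun x => parse (f x)).
  apply: (pt_comp (g := parse)); rewrite /parse; apply: pt_head.
  apply: (pt_foldl (f := fun _ => parse_step)).
  - rewrite /parse_step; apply: pt_if; first by pt_solve.
      by apply: pt_cons; [apply: Hn|]; pt_solve.
    by pt_solve.
  - exists (10%N%:P)%R => x s b; rewrite pevalC /parse_step.
    have E0 : esize (Leaf :: s) = (1 + esize s).+1 by exact: esize_cons.
    case: b; last by lia.
    have Ec (t : tree) l : esize (t :: l) = (esize t + esize l).+1
      by exact: esize_cons.
    have En t t' : esize (Node t t') = (esize t + esize t').+1
      by exact: tsize_node.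
    have El : esize Leaf = 1 by [].
    by clear E0; case: s => [|t [|t' s]]; rewrite /= ?Ec En ?Ec ?El; lia.
  - exact: pt_rev pt_id.
  - exact: pt_const.
have Hd X (cX : codable X) (f : X -> seq bool) : pt f ->
    pt (fun x => delimited_size (f x)).
  apply: (pt_comp (g := delimited_size)); rewrite /delimited_size.
  by pt_solve.
have H1 : pt pair_fst by rewrite /pair_fst; repeat (first [pt_basic | apply: Hd]).
have H2 : pt pair_snd by rewrite /pair_snd; repeat (first [pt_basic | apply: Hd]).
apply: pt_check => //; rewrite /tree_certificate /tree_bits.
by repeat (first [pt_basic | apply: (@Hs) | apply: (@Hhd) | apply: (@Htl)
  | apply: (@Hil) | apply: (@Hp)]; cbv beta).
Qed.

(** * Binary expansions and their values *)

Definition bits_value (b : seq bool) : nat :=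
  foldr (fun (x : bool) v => x + v.*2) 0 b.

Lemma exp_value_exponents b : exp_value (exponents b) = bits_value b.
Proof.
rewrite /exp_value /exponents; elim: b => [|x b IH]; first by rewrite big_nil.
rewrite -[bits_value _]/(x + (bits_value b).*2) -IH !big_filter.
rewrite -[iota 0 _]/(0 :: iota 1 (size b)) big_cons (iotaDl 1 0) big_map /=.
have -> : \sum_(i <- iota 0 (size b) | nth false b i) 2 ^ (1 + i) =
    (\sum_(i <- iota 0 (size b) | nth false b i) 2 ^ i).*2.
  rewrite -mul2n big_distrr /=.
  by apply: eq_bigr => i _; rewrite add1n expnS.
by case: x.
Qed.

Lemma bits_value_positive p : bits_value (bits_of_positive p) = nat_of_pos p.
Proof. by elim: p => //= p ->; rewrite ?NatTrec.doubleE. Qed.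

Lemma bits_value_binary n : bits_value (binary n) = n.
Proof.
rewrite /binary -[RHS]bin_of_natK; case: (bin_of_nat n) => //= p.
exact: bits_value_positive.
Qed.

Lemma head_rev (x : bool) b : head x (rev b) = last x b.
Proof. by case/lastP: b => // b y; rewrite rev_rcons last_rcons. Qed.

Lemma canonical_positive b : b != [::] -> last true b ->
  exists p, b = bits_of_positive p.
Proof.
elim: b => // x [|y b] IH _ H; first by exists BinNums.xH; case: x H.
have [//|//|p ->] := IH; case: x {H}; first by exists (BinNums.xI p).
by exists (BinNums.xO p).
Qed.

Lemma binary_bits_value b : head true (rev b) -> binary (bits_value b) = b.
Proof.
rewrite head_rev; have [->|nz] := eqVneq b [::]; first by [].
case/(canonical_positive nz)=> p ->; rewrite bits_value_positive /binary.
by rewrite -[nat_of_pos p]/(nat_of_bin (BinNums.Npos p)) nat_of_binK.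
Qed.

Lemma last_bits_of_positive x p : last x (bits_of_positive p).
Proof. by elim: p x => //=. Qed.

Lemma last_binary n : last true (binary n).
Proof.
by rewrite /binary; case: bin_of_nat => //= p; apply: last_bits_of_positive.
Qed.

Lemma card_row_set n r : size r = n -> #|row_set n r| = size [seq b <- r | b].
Proof.
move=> sz; rewrite -[in RHS](row_setK sz) /set_row filter_map size_map.
by rewrite size_filter -sum1_count big_enum_cond -sum1_card; apply: eq_bigl.
Qed.

Local Open Scope ring_scope.

(** * Soundness of certificates *)

Section Soundness.

Variables (R : realType) (nums : seq (seq bool * seq bool)).
Variables (rows : seq (seq bool)) (c : seq (seq bool * nat)).

Let n := size nums.
Let num_at (e : 'I_n) := nth ([::], [::]) nums e.

Hypothesis rowsP : all (valid_row n rows) rows.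
Hypothesis numsP : all valid_marginal nums.
Hypothesis c_neq0 : ~~ nilp c.
Hypothesis cP : all (fun p => all (meets n p.1) rows) c.
Hypothesis atP : all (valid_at nums c) (iota 0 n).

Let family_of := [seq row_set n r | r <- rows].

Let size_row r : r \in rows -> size r = n.
Proof. by move/(allP rowsP) => /and3P[/eqP]. Qed.

Let family_of_uniq : uniq family_of.
Proof.
rewrite map_inj_in_uniq; last first.
  move=> r1 r2 r1P r2P /(congr1 (@set_row n)).
  by rewrite !row_setK ?size_row.
apply: count_mem_uniq => r; case: (boolP (r \in rows)) => [rP|/count_memPn //].
by have /and3P[_ _ /eqP] := allP rowsP r rP; rewrite size_filter.
Qed.

Let family_of_card3 P : P \in family_of -> #|P| = 3%N.
Proof.
case/mapP=> r rP ->; rewrite card_row_set; last exact: size_row.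
by have /and3P[_ /eqP -> _] := allP rowsP r rP.
Qed.

Let total : nat := (\sum_(p <- c) 2 ^ p.2)%N.

Let total_gt0 : (0 < total)%N.
Proof.
rewrite /total; case: c c_neq0 => // p c' _.
by rewrite big_cons addn_gt0 expn_gt0.
Qed.

Let valid_e (e : 'I_n) : valid_marginal (num_at e).
Proof. by apply: (allP numsP); apply: mem_nth. Qed.

Let den_gt0 (e : 'I_n) : (0 < bits_value (num_at e).2)%N.
Proof.
have /and3P[_ H nz] := valid_e e.
rewrite lt0n; apply: contra nz => /eqP E.
by move: (binary_bits_value H); rewrite E => <-.
Qed.

Let at_total (e : 'I_n) :
  ((\sum_(p <- c | nth false p.1 e) 2 ^ p.2) * bits_value (num_at e).2 =
   bits_value (num_at e).1 * total)%N.
Proof.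
have := allP atP e; rewrite mem_iota add0n ltn_ord => /(_ isT).
rewrite /valid_at same_valueE !exp_value_sum_pairs !exp_value_exponents => /eqP.
by rewrite /exp_value /weights_at /weights !big_map big_filter.
Qed.

(** The sets containing [e] weigh at most [total], so the marginal equation implies this bound and
    [check] does not have to test it. *)
Let num_le (e : 'I_n) :
  (bits_value (num_at e).1 <= bits_value (num_at e).2)%N.
Proof.
rewrite -(leq_pmul2r total_gt0) -at_total mulnC leq_mul2l /total.
by rewrite big_mkcond leq_sum ?orbT // => p _; case: ifP.
Qed.

Let certified_instance : instance :=
  @Instance n family_of family_of_uniq family_of_card3
    (fun e => bits_value (num_at e).1) (fun e => bits_value (num_at e).2)
    den_gt0 num_le.

Let encode_certified : encode certified_instance = encode_data n nums rows.
Proof.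
rewrite encodeE /=; congr encode_data.
  apply: (@eq_from_nth _ ([::], [::])); rewrite size_map size_enum_ord // => i lti.
  rewrite (nth_map (Ordinal lti)) ?size_enum_ord //.
  rewrite (_ : nth _ _ _ = Ordinal lti); last exact: (nth_ord_enum _ (Ordinal lti)).
  have /and3P[H1 H2 _] := valid_e (Ordinal lti).
  by rewrite !binary_bits_value //= /num_at /=; case: (nth _ _ _).
rewrite /family_of -map_comp -[RHS]map_id; apply/eq_in_map => r rP /=.
by rewrite row_setK ?size_row.
Qed.

(** Several pairs of the certificate may denote the same set; their weights add up. *)
Let x (S : {set 'I_n}) : R :=
  (\sum_(p <- c | row_set n p.1 == S) 2 ^ p.2)%N%:R / total%:R.

Let sum_x (A : pred {set 'I_n}) : \sum_(S | A S) x S =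
  (\sum_(p <- c | A (row_set n p.1)) 2 ^ p.2)%N%:R / total%:R.
Proof.
rewrite -big_distrl -natr_sum /=; congr (_%:R / _).
rewrite [RHS](partition_big (fun p => row_set n p.1) A) //=.
apply: eq_bigr => S AS; apply: eq_bigl => p.
by case: eqP => [->|_]; rewrite ?AS ?andbF.
Qed.

Let total_neq0 : total%:R != 0 :> R.
Proof. by rewrite pnatr_eq0 -lt0n. Qed.

Lemma certificate_sound : decomposition_problem R (encode_data n nums rows).
Proof.
exists certified_instance; first by rewrite encode_certified.
exists x; split=> /=.
- by move=> S; rewrite mulr_ge0 ?invr_ge0.
- by rewrite (sum_x predT) divff.
- move=> e; rewrite (sum_x (fun S => e \in S)) /marginal /=.
  apply/eqP; rewrite eqr_div ?pnatr_eq0 -?lt0n // -!natrM eqr_nat.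
  by rewrite -at_total; apply/eqP; congr (_ * _)%N; apply: eq_bigl => p;
    rewrite inE.
- move=> Q; rewrite inE => /mapP[r rP ->].
  rewrite (sum_x (fun S => S :&: row_set n r != set0)).
  rewrite (_ : (\sum_(p <- c | _) _)%N = total) ?divff //.
  rewrite /total big_seq_cond [RHS]big_seq; apply: eq_bigl => p.
  case: (boolP (p \in c)) => //= pP.
  have /hasP[i] := allP (allP cP p pP) r rP.
  rewrite mem_iota add0n => /= lti /andP[H1 H2].
  by apply/set0Pn; exists (Ordinal lti); rewrite !inE H1.
Qed.

End Soundness.

Lemma check_sound (R : realType) w d : check w d -> decomposition_problem R w.
Proof.
case/and5P=> /eqP-> H1 H2 H3 /andP[H4 H5].
exact: (certificate_sound R H1 H2 H3 H4 H5).
Qed.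

Local Open Scope ring_scope.

(** * Solutions of minimal support *)

Section BasicSolution.

Variables (F : realFieldType) (T : finType) (m : nat) (A : T -> 'I_m -> F).

Definition supp (x : T -> F) : {set T} := [set S | x S != 0].

(** Equivalently, the rows [A S] with [S] in the support of [x] are linearly independent. *)
Definition basic (x : T -> F) : Prop :=
  forall z : T -> F, supp z \subset supp x ->
    (forall c, \sum_S z S * A S c = 0) -> forall S, z S = 0.

(** The ratio test of the simplex method: one moves along the opposite of [z] until the first
    coordinate vanishes. The minimality of the ratio at [S0] keeps the others nonnegative, and [S0]
    leaves the support. *)
Lemma shrink_support (x z : T -> F) : (forall S, 0 <= x S) ->
  supp z \subset supp x -> (forall c, \sum_S z S * A S c = 0) ->
  (exists S, 0 < z S) ->
  exists y, [/\ forall S, 0 <= y S,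
    forall c, \sum_S y S * A S c = \sum_S x S * A S c & supp y \proper supp x].
Proof.
move=> x_ge0 szx z0 [S1 zS1].
case: (@Order.TotalTheory.arg_minP _ _ _ S1 (fun S => 0 < z S)
  (fun S => x S / z S) zS1) => S0 zS0 minS0.
pose t := x S0 / z S0; have t_ge0 : 0 <= t by rewrite divr_ge0 // ltW.
exists (fun S => x S - t * z S); split.
- move=> S; rewrite subr_ge0; have [zS|zS] := ltP 0 (z S).
    by rewrite -ler_pdivlMr //; apply: minS0.
  by apply: le_trans (x_ge0 S); rewrite mulr_ge0_le0.
- move=> c; under eq_bigr do rewrite mulrBl -mulrA.
  by rewrite sumrB -big_distrr /= z0 mulr0 subr0.
- apply/properP; split.
    apply/subsetP => S; rewrite !inE; apply: contraNneq => xS.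
    have := subsetP szx S; rewrite !inE xS eqxx; have [->|_ /(_ isT)//] := eqVneq.
    by rewrite mulr0 subr0.
  exists S0; last by rewrite inE negbK /t divfK ?subrr // gt_eqF.
  by apply: (subsetP szx); rewrite inE gt_eqF.
Qed.

Lemma basic_solution (x : T -> F) : (forall S, 0 <= x S) ->
  exists y, [/\ forall S, 0 <= y S,
    forall c, \sum_S y S * A S c = \sum_S x S * A S c,
    supp y \subset supp x & basic y].
Proof.
have [n] := ubnP #|supp x|; elim: n x => // n IH x; rewrite ltnS => le_n x_ge0.
have [[z [szx z0 [S zS]]]|nz] := pselect (exists z, [/\ supp z \subset supp x,
    forall c, \sum_S z S * A S c = 0 & exists S, z S != 0]); last first.
  exists x; split=> // z szx z0 S; apply/eqP/negPn/negP => zS.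
  by apply: nz; exists z; split=> //; exists S.
(* A kernel vector may be replaced by its opposite, which has the same support. *)
wlog zS_gt0 : z szx z0 zS / 0 < z S.
  move=> Hw; have [|zS_le0] := ltP 0 (z S); first exact: (Hw z).
  apply: (Hw (fun S => - z S)); rewrite ?oppr_eq0 ?oppr_gt0 //.
  - by rewrite (_ : supp _ = supp z) //; apply/setP => U; rewrite !inE oppr_eq0.
  - move=> c; under eq_bigr do rewrite mulNr.
    by rewrite sumrN z0 oppr0.
  - by rewrite lt_neqAle zS.
have [y [y_ge0 yA yx]] := shrink_support x_ge0 szx z0 (ex_intro _ S zS_gt0).
have [y' [y'_ge0 y'A y'y By']] := IH y (leq_trans (proper_card yx) le_n) y_ge0.
exists y'; split=> //; first by move=> c; rewrite y'A yA.
exact: subset_trans y'y (proper_sub yx).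
Qed.

End BasicSolution.

(** * Integer weights from Cramer's rule *)

Section Cramer.

Variables (R : realType) (T : finType) (m : nat) (a : T -> 'I_m -> bool).
Variables (D : nat) (b : 'I_m -> nat) (y : T -> R).

Let A S c : R := (a S c)%:R.

Hypothesis y_basic : basic A y.
Hypothesis yA : forall c, D%:R * (\sum_S y S * A S c) = (b c)%:R.

Let k := #|supp y|.
Let N : 'M[R]_(k, m) := \matrix_(i, c) A (enum_val i) c.

(** A linear relation among the rows of [N] extends by zero to a kernel vector on [T], which
    vanishes because [y] is basic. *)
Let N_free : row_free N.
Proof.
rewrite -kermx_eq0; apply/rowV0P => u /sub_kermxP uN.
pose z (S : T) := \sum_(i < k | enum_val i == S) u 0 i.
have zi i : z (enum_val i) = u 0 i.
  by rewrite /z (eq_bigl (pred1 i)) ?big_pred1_eq // => j; rewrite (inj_eq enum_val_inj).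
have z0 := y_basic (z := z).
apply/rowP => i; rewrite mxE -zi; apply: z0 => [|c].
  apply/subsetP => S; rewrite inE => zS.
  have [j /eqP <-|none] := pickP (fun j : 'I_k => enum_val j == S).
    exact: enum_valP.
  by rewrite /z big_pred0 ?eqxx in zS.
transitivity ((u *m N) 0 c); last by rewrite uN mxE.
rewrite mxE; under eq_bigr do rewrite /z big_distrl /=.
rewrite (exchange_big_dep predT) //=; apply: eq_bigr => j _.
by rewrite (big_pred1 (enum_val j)) ?mxE // => S; rewrite eq_sym.
Qed.

Lemma supp_card : (k <= m)%N.
Proof. by rewrite -(eqP N_free) rank_leq_col. Qed.

Let NT_full : row_full N^T.
Proof. by rewrite /row_full mxrank_tr. Qed.

Let f := fullrankfun NT_full.

(** An invertible square minor, taken over the integers so that its adjugate and its determinant are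
    integral. *)
Let M0 : 'M[int]_k := \matrix_(i, j) (a (enum_val i) (f j))%:R.

Let M : 'M[R]_k := map_mx intr M0.

Let M_unit : M \in unitmx.
Proof.
suff -> : M = (rowsub f N^T)^T by rewrite unitmx_tr fullrowsub_unit.
by apply/matrixP => i j; rewrite !mxE /A; case: (a _ _).
Qed.

Let yM i : D%:R * y (enum_val i) =
  ((\sum_j (b (f j))%:Z * \adj M0 j i)%:~R) / (\det M0)%:~R.
Proof.
pose v : 'rV[R]_k := \row_j (D%:R * y (enum_val j)).
have vM : v *m M = \row_j (b (f j))%:R.
  apply/rowP => j; rewrite !mxE -yA big_distrr /=.
  rewrite (bigID (mem (supp y))) /= [X in _ + X]big1 ?addr0.
    rewrite (big_enum_val (fun S => D%:R * (y S * A S (f j)))) /=.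
    by apply: eq_bigr => i' _; rewrite !mxE /A mulrA; case: (a _ _).
  by move=> S; rewrite inE negbK => /eqP->; rewrite mul0r mulr0.
have -> : D%:R * y (enum_val i) = v 0 i by rewrite mxE.
rewrite -[v](mulmxK M_unit) vM /invmx M_unit -scalemxAr mxE mulrC.
rewrite -map_mx_adj det_map_mx; congr (_ / _).
by rewrite mxE rmorph_sum; apply: eq_bigr => j _; rewrite !mxE rmorphM.
Qed.

(** In the Leibniz expansion every permutation contributes at most 1 in absolute value. *)
Let det_le : (`|\det M0| <= k`!)%N.
Proof.
rewrite -lez_nat abszE /determinant; apply: le_trans (ler_norm_sum _ _ _) _.
rewrite -(natz k`!) -card_Sn -[X in _ <= X]sumr_const; apply: ler_sum => s _.
rewrite normrM normrX normrN1 expr1n mul1r normr_prod; apply: prodr_ile1 => j _.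
by rewrite !mxE; case: (a _ _).
Qed.

Hypothesis D_gt0 : (0 < D)%N.
Hypothesis y_ge0 : forall S, 0 <= y S.

Lemma rational_weights : exists (wt : T -> nat) (Q : nat),
  [/\ (0 < Q)%N, (Q <= D * m`!)%N & forall S, (wt S)%:R = Q%:R * y S].
Proof.
have det_neq0 : \det M0 != 0.
  by move: M_unit; rewrite unitmxE det_map_mx unitfE intr_eq0.
pose Q := (D * `|\det M0|)%N.
have [S|wt wtP] := choice (P := fun S w => w%:R = Q%:R * y S).
  have [SP|] := boolP (S \in supp y); last first.
    by rewrite inE negbK => /eqP ->; exists 0%N; rewrite mulr0.
  rewrite -(enum_rankK_in SP SP); set i := enum_rank_in _ _.
  (* As [y] is nonnegative, absolute values can be taken in the numerator and in the determinant of
     Cramer's rule without changing the quotient. *)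
  exists (absz (\sum_j (b (f j))%:Z * \adj M0 j i)).
  have yi : D%:R * y (enum_val i) = `|D%:R * y (enum_val i)|.
    by rewrite ger0_norm // mulr_ge0 ?ler0n.
  rewrite /Q natrM mulrAC yi yM normf_div -!intr_norm !natr_absz divfK //.
  by rewrite intr_eq0 normr_eq0.
exists wt, Q; split=> //; first by rewrite muln_gt0 D_gt0 absz_gt0.
rewrite leq_mul2l (leq_trans det_le) ?orbT //.
by apply: leq_fact; apply: supp_card.
Qed.

End Cramer.

(** * Length estimates for binary expansions and codes *)

Local Open Scope nat_scope.

Lemma bits_value_lt b : bits_value b < 2 ^ size b.
Proof. by elim: b => // x b IH; rewrite /= expnS; case: x; lia. Qed.

Lemma size_bits_of_positive p : 2 ^ size (bits_of_positive p) <= (nat_of_pos p).*2.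
Proof.
by elim: p => //= p IH; rewrite expnS ?NatTrec.doubleE;
  move: (2 ^ _) IH => v; lia.
Qed.

Lemma size_binary n K : n < 2 ^ K -> size (binary n) <= K.
Proof.
rewrite -[in n < _](bin_of_natK n) /binary; case: (bin_of_nat n) => // p lt_pK.
rewrite -ltnS -(@ltn_exp2l 2) // expnS mul2n.
by apply: leq_ltn_trans (size_bits_of_positive p) _; rewrite ltn_double.
Qed.

Lemma binary_lt n : n < 2 ^ size (binary n).
Proof. by have := bits_value_lt (binary n); rewrite bits_value_binary. Qed.

Lemma fact_le_exp m : m`! <= 2 ^ (m * m).
Proof.
rewrite expnM; apply: (@leq_trans (m ^ m)); last first.
  by case: m => // m; rewrite leq_exp2r // ltnW // ltn_expl.
elim: m => // m IH; rewrite factS expnS leq_mul //.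
by apply: leq_trans IH _; case: m => // m; rewrite leq_exp2r.
Qed.

Lemma mem_list (T : eqType) (x : T) (l : seq T) : List.In x l -> x \in l.
Proof.
by elim: l => //= y l IH [->|/IH]; rewrite inE ?eqxx // => ->; rewrite orbT.
Qed.

Lemma esize_seq_le A `{codable A} (l : seq A) B :
  (forall a, List.In a l -> esize a <= B) -> esize l <= size l * B.+1 + 1.
Proof.
elim: l => // a l IH HB; rewrite esize_cons /=.
have := IH (fun a al => HB a (or_intror al)); have := HB a (or_introl erefl).
by lia.
Qed.

Local Open Scope ring_scope.

(** * Completeness: feasible instances have short certificates *)

Section Completeness.

Variables (R : realType) (I : instance).

Let n := ground_size I.

Hypothesis feasible : has_feasible_decomposition R I.

Definition hits_all (S : {set 'I_n}) : Prop :=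
  forall P, P \in Defs.family I -> S :&: P != set0.

(** The sets that hit [P] already have weight at least 1, which is the total; so the nonnegative
    weights of all other sets sum to 0. *)
Lemma support_hits (x : {set 'I_n} -> R) :
  feasible_decomposition [set P in Defs.family I] (fun=> 1) (@marginal R I) x ->
  forall S, x S != 0 -> hits_all S.
Proof.
case=> x_ge0 x1 _ xP S xS P PI; apply: contraNneq xS => SP.
have := xP P; rewrite inE PI => /(_ isT); rewrite -x1.
rewrite [X in X <= _](bigID (fun S => S :&: P != set0)) /= gerDl => le0.
have /psumr_eq0P : \sum_(S | ~~ (S :&: P != set0)) x S = 0.
  by apply/eqP; rewrite eq_le le0 sumr_ge0.
by move=> H; rewrite H // SP negbK.
Qed.

(** The additional coordinate [ord0] is constantly 1: normalization becomes one more linear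
    equation, and affine independence becomes linear independence. *)
Definition incidence (S : {set 'I_n}) (c : 'I_n.+1) : bool :=
  if unlift ord0 c is Some e then e \in S else true.

Definition den_product : nat := (\prod_(e < n) rho_den e)%N.

(** The right-hand sides of the linear system, multiplied by a common denominator to make them
    integral. *)
Definition scaled_rhs (c : 'I_n.+1) : nat :=
  if unlift ord0 c is Some e then (den_product %/ rho_den e * rho_num e)%N
  else den_product.

Lemma den_product_gt0 : (0 < den_product)%N.
Proof. by rewrite prodn_gt0 // => e; apply: rho_den_gt0. Qed.

Lemma dvd_den_product (e : 'I_n) : (rho_den e %| den_product)%N.
Proof. by rewrite /den_product (bigD1 e) //= dvdn_mulr. Qed.

(** A denominator is less than 2 to the power of its length, and the factorial of [n.+1] is at most
    2 to the power [n.+1 * n.+1]. The last 1 makes [weight_bound] strict. *)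
Definition weight_bits : nat :=
  (\sum_(e < n) size (binary (rho_den e)) + n.+1 * n.+1 + 1)%N.

Lemma weight_bound : (den_product * n.+1`! < 2 ^ weight_bits)%N.
Proof.
rewrite /weight_bits addn1 expnS; apply: (@leq_ltn_trans (2 ^
  (\sum_(e < n) size (binary (rho_den e)) + n.+1 * n.+1))%N); last first.
  by rewrite -[X in (X < _)%N]mul1n ltn_pmul2r ?expn_gt0.
rewrite expnD leq_mul ?fact_le_exp // expn_sum.
by apply: leq_prod => e _; apply/ltnW/binary_lt.
Qed.

Lemma incidence_sum (x : {set 'I_n} -> R) c :
  \sum_S x S * (incidence S c)%:R = \sum_(S | incidence S c) x S.
Proof.
rewrite [RHS]big_mkcond; apply: eq_bigr => S _.
by case: (incidence S c); rewrite ?mulr1 ?mulr0.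
Qed.

Lemma integer_weights : exists (wt : {set 'I_n} -> nat),
  [/\ (0 < \sum_S wt S)%N, forall S, (wt S < 2 ^ weight_bits)%N,
    forall S, wt S != 0%N -> hits_all S,
    (#|[set S | wt S != 0%N]| <= n.+1)%N
  & forall e : 'I_n, ((\sum_(S : {set 'I_n} | e \in S) wt S) * rho_den e =
      rho_num e * \sum_S wt S)%N].
Proof.
case: feasible => x xF; have xH := support_hits xF.
case: xF => x_ge0 x1 xe _.
have [y [y_ge0 yA yx y_basic]] :=
  basic_solution (fun S c => (incidence S c)%:R) x_ge0.
have y1 : \sum_S y S = 1.
  have E S : incidence S ord0 = true by rewrite /incidence unlift_none.
  by have := yA ord0; rewrite !incidence_sum !(eq_bigl _ _ E) x1.
have ye (e : 'I_n) : \sum_(S : {set 'I_n} | e \in S) y S = (rho_num e)%:R / (rho_den e)%:R.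
  have E S : incidence S (lift ord0 e) = (e \in S) by rewrite /incidence liftK.
  by have := yA (lift ord0 e); rewrite !incidence_sum !(eq_bigl _ _ E) xe.
have den_neq0 (e : 'I_n) : (rho_den e)%:R != 0 :> R.
  by rewrite pnatr_eq0 -lt0n rho_den_gt0.
have yb c : den_product%:R * (\sum_S y S * (incidence S c)%:R) =
    (scaled_rhs c)%:R.
  rewrite incidence_sum /scaled_rhs /incidence; case: unlift => [e|].
    rewrite ye mulrA; apply: (mulIf (den_neq0 e)).
    by rewrite mulfVK // -!natrM mulnAC divnK // dvd_den_product.
  by rewrite y1 mulr1.
have [wt [Q [Q_gt0 Q_le wtE]]] :=
  rational_weights y_basic yb den_product_gt0 y_ge0.
have sumE (A : pred {set 'I_n}) :
    (\sum_(S | A S) wt S)%:R = Q%:R * \sum_(S | A S) y S :> R.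
  by rewrite natr_sum big_distrr /=; apply: eq_bigr => S _; apply: wtE.
have wt0 S : (wt S != 0%N) = (y S != 0).
  by rewrite -(pnatr_eq0 R) wtE mulf_eq0 pnatr_eq0 (gtn_eqF Q_gt0).
have totE : (\sum_S wt S)%N = Q.
  by apply/eqP; rewrite -(eqr_nat R) (sumE predT) y1 mulr1.
exists wt; rewrite totE; split=> //.
- move=> S; apply: leq_ltn_trans (leq_trans _ Q_le) weight_bound.
  by rewrite -totE (bigD1 S) //= leq_addr.
- move=> S; rewrite wt0 => yS; apply: xH.
  by have := subsetP yx S; rewrite !inE; apply.
- by have := supp_card y_basic; congr (_ <= _)%N; apply: eq_card => S;
    rewrite !inE wt0.
- move=> e; apply/eqP; rewrite -(eqr_nat R) !natrM.
  by rewrite (sumE (fun S => e \in S)) ye -mulrA divfK // mulrC.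
Qed.

Definition nums_of : seq (seq bool * seq bool) :=
  [seq (binary (rho_num e), binary (rho_den e)) | e <- enum 'I_n].

Definition rows_of : seq (seq bool) := [seq set_row P | P <- Defs.family I].

Definition cert_of (wt : {set 'I_n} -> nat) : seq (seq bool * nat) :=
  flatten [seq [seq (set_row U, k) | k <- exponents (binary (wt U))]
          | U <- enum [set U : {set 'I_n} | wt U != 0%N]].

Lemma sum_pow2_cond (A : bool) (l : seq nat) :
  (\sum_(k <- l | A) 2 ^ k = if A then exp_value l else 0)%N.
Proof. by case: A => //; rewrite big_pred0. Qed.

Lemma sum_cert_of wt (A : pred (seq bool)) :
  (\sum_(p <- cert_of wt | A p.1) 2 ^ p.2 = \sum_(S : {set 'I_n} | A (set_row S)) wt S)%N.
Proof.
rewrite /cert_of big_flatten big_map big_enum /= big_mkcond [RHS]big_mkcond.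
apply: eq_bigr => S _; rewrite inE big_map /= sum_pow2_cond exp_value_exponents.
rewrite bits_value_binary; case: (A _); last by case: ifP.
by case: eqVneq => [->|].
Qed.

Lemma mem_cert_of wt p : p \in cert_of wt ->
  exists2 S, wt S != 0%N & p.1 = set_row S /\ (p.2 < size (binary (wt S)))%N.
Proof.
case/flatten_mapP=> S; rewrite mem_enum inE => wtS /mapP[k kP ->].
exists S => //=; split=> //; move: kP.
by rewrite mem_filter mem_iota add0n => /and3P[].
Qed.

Lemma complete_check wt :
  (0 < \sum_S wt S)%N -> (forall S, wt S != 0%N -> hits_all S) ->
  (forall e : 'I_n, ((\sum_(S : {set 'I_n} | e \in S) wt S) * rho_den e =
      rho_num e * \sum_S wt S)%N) ->
  check (encode I) (nums_of, rows_of, cert_of wt).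
Proof.
move=> wt_gt0 wtH wtE; have sz : size nums_of = n by rewrite size_map size_enum_ord.
rewrite /check /= sz; apply/and5P; split.
- by rewrite encodeE.
- apply/allP => _ /mapP[P PI ->]; rewrite /valid_row size_set_row eqxx /=.
  rewrite -(@card_row_set n) ?size_set_row // set_rowK family_card3 //=.
  rewrite size_filter count_uniq_mem ?map_f //.
  by rewrite map_inj_uniq ?family_uniq //; apply: can_inj (@set_rowK n).
- apply/allP => _ /mapP[e _ ->]; rewrite /valid_marginal /= !head_rev !last_binary.
  have := bits_value_binary (rho_den e); case: (binary _) => //= E.
  by have := rho_den_gt0 e; rewrite -E.
- apply: contraL wt_gt0 => /nilP cE; rewrite -leqNgt leqn0.
  by rewrite -(sum_cert_of wt predT) cE big_nil.
- apply/andP; split.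
    apply/allP => p /mem_cert_of[S wtS [-> _]]; apply/allP => _ /mapP[P PI ->].
    have /set0Pn[i] := wtH S wtS P PI; rewrite inE => /andP[iS iP].
    apply/hasP; exists (val i); first by rewrite mem_iota /=.
    by rewrite !nth_set_row iS iP.
  apply/allP => e; rewrite mem_iota add0n => /= lte.
  rewrite /valid_at same_valueE !exp_value_sum_pairs !exp_value_exponents.
  rewrite (nth_map (Ordinal lte)) ?size_enum_ord //=.
  rewrite (_ : nth _ _ _ = Ordinal lte); last exact: (nth_ord_enum _ (Ordinal lte)).
  rewrite !bits_value_binary /weights_at /weights /exp_value !big_map big_filter.
  rewrite (sum_cert_of wt (fun r => nth false r e)) (sum_cert_of wt predT).
  rewrite -wtE; apply/eqP; congr (_ * _)%N; apply: eq_bigl => S.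
  by rewrite (nth_set_row S (Ordinal lte)).
Qed.

(** The indeterminate stands for the length of the encoded instance, and [k] bounds [weight_bits].
    The three main summands bound the codes of the marginals, of the family and of the
    decomposition, the last having at most [n.+1] sets with [k] exponents each; the final 2 counts
    the two pairings. *)
Definition certificate_poly : {poly nat} :=
  let k := ('X + 'X * 'X + 1%N%:P)%R in
  ('X * (8%N%:P * 'X + 4%N%:P) + 1%N%:P
   + ('X * (4%N%:P * 'X + 2%N%:P) + 1%N%:P)
   + ('X * k * (4%N%:P * 'X + 2%N%:P * k + 4%N%:P) + 1%N%:P) + 2%N%:P)%R.

Lemma certificate_size wt : (forall S, wt S < 2 ^ weight_bits)%N ->
  (#|[set S | wt S != 0%N]| <= n.+1)%N ->
  (esize (nums_of, rows_of, cert_of wt) <=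
    peval certificate_poly (size (encode I)))%N.
Proof.
move=> wt_lt card_le; set W := size (encode I).
pose len (e : 'I_n) := ((size (binary (rho_num e))).*2.+1 +
  (size (binary (rho_den e))).*2.+1)%N.
(* The bounds on the sizes of the single components are read off this exact formula for the
   length. *)
have WE : (n.+1 + \sum_e len e + size (Defs.family I) * n.+1 + 1 = W)%N.
  rewrite /W encodeE /encode_data !size_cat size_rcons size_nseq !size_flatten.
  rewrite !sumnE /shape !big_map -enumT big_enum /=.
  under [in RHS]eq_bigr => e _ do rewrite size_cat !size_delimited !addnn.
  rewrite (eq_bigr (fun=> n.+1) (r := Defs.family I)).
    rewrite big_const_seq iter_addn_0 count_predT [in RHS]mulnC.
    by move: (size _ * _)%N => v; rewrite -!addnA.
  by move=> P _; rewrite /= size_set_row.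
have num_le e : (len e <= W)%N.
  by rewrite -WE (bigD1 e) //=; lia.
have den_le : (\sum_(e < n) size (binary (rho_den e)) <= W)%N.
  apply: (@leq_trans (\sum_e len e)%N); last by rewrite -WE; lia.
  by apply: leq_sum => e _; rewrite /len; lia.
have n_le : (n.+1 <= W)%N by rewrite -WE; lia.
have fam_le : (size (Defs.family I) <= W)%N by rewrite -WE mulnS; lia.
have bits_le (r : seq bool) : (size r <= W -> esize r <= 4 * W + 1)%N.
  by move=> le_r; apply: leq_trans (esize_bits r) _; lia.
have k_le : (weight_bits <= W + W * W + 1)%N.
  by rewrite /weight_bits leq_add2r leq_add // leq_mul.
have size_nums : (esize nums_of <= W * (8 * W + 4) + 1)%N.
  apply: leq_trans (esize_seq_le (B := 8 * W + 3) _) _.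
    move=> _ /List.in_map_iff[e [<- _]]; rewrite esize_pair.
    have := num_le e; rewrite /len => le_e.
    have : (esize (binary (rho_num e)) <= 4 * W + 1)%N by apply: bits_le; lia.
    have : (esize (binary (rho_den e)) <= 4 * W + 1)%N by apply: bits_le; lia.
    lia.
  rewrite size_map size_enum_ord leq_add2r leq_mul //; first exact: ltnW.
  lia.
have row_le (S : {set 'I_n}) : (esize (set_row S) <= 4 * W + 1)%N.
  by apply: bits_le; rewrite size_set_row; apply: ltnW.
have size_rows : (esize rows_of <= W * (4 * W + 2) + 1)%N.
  apply: leq_trans (esize_seq_le (B := 4 * W + 1) _) _.
    by move=> _ /List.in_map_iff[P [<- _]]; apply: row_le.
  by rewrite size_map leq_add2r leq_mul //; lia.
have size_cert : (esize (cert_of wt) <= W * (W + W * W + 1) *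
    (4 * W + 2 * (W + W * W + 1) + 4) + 1)%N.
  apply: leq_trans (esize_seq_le
    (B := 4 * W + 2 * (W + W * W + 1) + 3) _) _.
    move=> [r k] /mem_list/mem_cert_of /= [S wtS [-> lt_k]].
    rewrite esize_pair esize_nat.
    have : (size (binary (wt S)) <= weight_bits)%N by apply: size_binary.
    have := row_le S; lia.
  rewrite leq_add2r; apply: leq_mul; last by lia.
  rewrite /cert_of size_flatten sumnE /shape !big_map big_enum /=.
  apply: (@leq_trans (\sum_(S in [set U : {set 'I_n} | wt U != 0]) weight_bits)%N).
    apply: leq_sum => S _; rewrite size_map /exponents size_filter.
    apply: leq_trans (count_size _ _) _; rewrite size_iota.
    exact: size_binary.
  rewrite sum_nat_const; apply: leq_mul => //.
  exact: leq_trans card_le n_le.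
rewrite !esize_pair /certificate_poly !pevalE.
move: size_nums size_rows size_cert.
move: (esize nums_of) (esize rows_of) (esize (cert_of wt)) => u v t.
move: (W * _)%N (W * _)%N (_ * _)%N => *; lia.
Qed.

End Completeness.

Theorem decomposition_in_NP (R : realType) : in_NP (decomposition_problem R).
Proof.
exists (fun s => verifier s), certificate_poly; split.
  exact: pt_in_P pt_verifier.
move=> w; split=> [[I -> F]|[u _]].
  have [wt [wt_gt0 wt_lt wtH card_le wtE]] := integer_weights F.
  exists (code (enc (nums_of I, rows_of I, cert_of wt))).
    exact: (certificate_size wt_lt card_le).
  by rewrite /verifier pair_fstK pair_sndK parse_code tree_certificate_enc
    complete_check.
by rewrite /verifier pair_fstK pair_sndK => /(check_sound R).
Qed.

(** * Hardness *)

Local Open Scope nat_scope.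

Lemma delimited_pairs_inj (l l' : seq (seq bool * seq bool)) s s' :
  size l = size l' ->
  flatten [seq delimited p.1 ++ delimited p.2 | p <- l] ++ s =
  flatten [seq delimited p.1 ++ delimited p.2 | p <- l'] ++ s' ->
  l = l' /\ s = s'.
Proof.
elim: l l' => [|[u v] l IH] [|[u' v'] l'] //= [sz].
set X := flatten _ in IH *; set X' := flatten _ => E.
have {}E : pair_code u (pair_code v (X ++ s)) =
    pair_code u' (pair_code v' (X' ++ s')).
  by rewrite /pair_code !catA -!catA; move: E; rewrite -!catA.
have Eu := congr1 pair_fst E; rewrite !pair_fstK in Eu.
have {}E := congr1 pair_snd E; rewrite !pair_sndK in E.
have Ev := congr1 pair_fst E; rewrite !pair_fstK in Ev.
have {}E := congr1 pair_snd E; rewrite !pair_sndK in E.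
by have [-> ->] := IH _ sz E; rewrite Eu Ev.
Qed.

(** The language speaks of any instance with the given code; injectivity recovers its ground set,
    marginals and family when the code comes from the reduction. *)
Lemma encode_data_inj n n' rho rho' rows rows' :
  size rho = n -> size rho' = n' ->
  all (fun r => size r == n) rows -> all (fun r => size r == n') rows' ->
  encode_data n rho rows = encode_data n' rho' rows' ->
  [/\ n = n', rho = rho' & rows = rows'].
Proof.
move=> sz sz' szr szr'; rewrite /encode_data -!cats1 -!catA /= => E.
have [En {}E] : n = n' /\
    flatten [seq delimited p.1 ++ delimited p.2 | p <- rho] ++
      flatten [seq true :: r | r <- rows] ++ [:: false] =
    flatten [seq delimited p.1 ++ delimited p.2 | p <- rho'] ++
      flatten [seq true :: r | r <- rows'] ++ [:: false].
  move: E {sz sz' szr szr'}; elim: n n' => [|n IH] [|n'] //= []; first by [].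
  by move/IH => [-> ->].
move: sz' szr'; rewrite -En => sz' {En n'} szr'.
have [Er {}E] : rho = rho' /\ flatten [seq true :: r | r <- rows] ++ [:: false] =
    flatten [seq true :: r | r <- rows'] ++ [:: false].
  by apply: delimited_pairs_inj E; rewrite sz sz'.
split=> //; elim: rows rows' szr szr' E => [|r l IH] [|r' l'] //=.
move=> /andP[/eqP sr sl] /andP[/eqP sr' sl'] [] /eqP; rewrite -!catA.
rewrite eqseq_cat ?sr ?sr' // => /andP[/eqP-> /eqP E].
by rewrite (IH _ sl sl' E).
Qed.

(* Variable [x] has the positive literal [2 x + 1] and the negative literal
   [2 x + 2]; element [0] is never chosen. *)
Definition pos (x : nat) : nat := (x + x).+1.
Definition neg (x : nat) : nat := (x + x).+2.

Definition ev (tau : nat -> bool) (e : nat) : bool :=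
  if e is e'.+1 then if odd e' then ~~ tau e'./2 else tau e'./2 else false.

Lemma ev_pos tau x : ev tau (pos x) = tau x.
Proof. by rewrite /= addnn odd_double doubleK. Qed.

Lemma ev_neg tau x : ev tau (neg x) = ~~ tau x.
Proof. by rewrite /= addnn odd_double /= uphalf_double. Qed.

Arguments ev : simpl never.
Arguments pos : simpl never.
Arguments neg : simpl never.

(** * Clauses and the triples built from them *)

Definition triple : Type := nat * nat * nat.

Definition in_triple (t : triple) (e : nat) : bool :=
  [|| e == t.1.1, e == t.1.2 | e == t.2].

(** These conditions make the elements of each triple distinct. A missing literal is the element
    [0]; since the first two literals differ, one of them is present. The third is placed next to
    [2], the negation of variable [0]. *)
Definition wf_clause (nv : nat) (t : triple) : bool :=
  [&& t.1.1 != t.1.2, t.1.1 <= nv + nv, t.1.2 <= nv + nv, t.2 <= nv + nv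
    & t.2 != 2].

Definition sat (tau : nat -> bool) (t : triple) : bool :=
  [|| ev tau t.1.1, ev tau t.1.2 | ev tau t.2].

Definition var_count (nv : nat) (cs : seq triple) : nat := nv + size cs.

Definition elt_count (nv : nat) (cs : seq triple) : nat :=
  (var_count nv cs + var_count nv cs).+1.

Definition clause (cs : seq triple) (i : nat) : triple := nth (0, 0, 0) cs i.

(* The clause [a \/ b \/ c] is split by a fresh variable [y] into [a \/ b \/ y]
   and [~ y \/ c], the latter being required only when variable [0] holds.
   Thus a solution and its complement both hit all triples. *)
Definition triples (nv : nat) (cs : seq triple) : seq triple :=
  [seq (0, pos x, neg x) | x <- iota 0 (var_count nv cs)] ++
  [seq ((clause cs i).1, pos (nv + i)) | i <- iota 0 (size cs)] ++
  [seq (neg (nv + i), (clause cs i).2, 2) | i <- iota 0 (size cs)].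

Definition triple_row (n : nat) (t : triple) : seq bool :=
  [seq in_triple t e | e <- iota 0 n].

Definition instance_rows (nv : nat) (cs : seq triple) : seq (seq bool) :=
  [seq triple_row (elt_count nv cs) t | t <- triples nv cs].

(** The fractions are [0 / 1] and [1 / 2], least significant bit first. *)
Definition instance_marginals (nv : nat) (cs : seq triple) :
    seq (seq bool * seq bool) :=
  [seq (if e == 0 then ([::], [:: true]) else ([:: true], [:: false; true]))
  | e <- iota 0 (elt_count nv cs)].

Definition instance_code (nv : nat) (cs : seq triple) : seq bool :=
  encode_data (elt_count nv cs) (instance_marginals nv cs) (instance_rows nv cs).

Lemma nth_triple_row n t e : e < n -> nth false (triple_row n t) e = in_triple t e.
Proof. by move=> lte; rewrite (nth_map 0) ?size_iota // nth_iota. Qed.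

Section Reduction.

Variables (nv : nat) (cs : seq triple).
Hypotheses (nv_gt0 : 0 < nv) (cs_wf : all (wf_clause nv) cs).

Let n := elt_count nv cs.

Lemma clauseP i : i < size cs ->
  let t := clause cs i in
  [/\ t.1.1 <> t.1.2, t.1.1 <= nv + nv, t.1.2 <= nv + nv, t.2 <= nv + nv
    & t.2 <> 2].
Proof.
move=> lti; have /and5P[/eqP H1 H2 H3 H4 /eqP H5] :=
  allP cs_wf _ (mem_nth (0, 0, 0) lti).
by split.
Qed.

Lemma triplesP t : t \in triples nv cs ->
  [/\ uniq [:: t.1.1; t.1.2; t.2] & all (fun e => e < n) [:: t.1.1; t.1.2; t.2]].
Proof.
rewrite /n /elt_count /triples /var_count !mem_cat => /or3P[] /mapP[i];
  rewrite mem_iota add0n => /= lti -> /=; rewrite ?inE /pos /neg.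
- by split; lia.
- by have [H1 H2 H3 H4 H5] := clauseP lti; split; lia.
- by have [H1 H2 H3 H4 H5] := clauseP lti; split; lia.
Qed.

(** Variables and clauses are identified by their own literals in the rows. Kinds are separated by
    the fresh variable of a clause: a triple of the first kind contains both of its literals or
    neither, the second kind only a positive one, the third only a negative one. *)
Lemma triples_uniq : uniq (instance_rows nv cs).
Proof.
have rowE t t' : triple_row n t = triple_row n t' ->
    forall e, e < n -> in_triple t e = in_triple t' e.
  by move=> E e lte; rewrite -!(nth_triple_row _ lte) E.
rewrite /instance_rows /triples -/n !map_cat -!map_comp !cat_uniq.
rewrite /n /elt_count /var_count in rowE *.
apply/and5P; split=> //.
- rewrite map_inj_in_uniq ?iota_uniq // => x x'; rewrite !mem_iota /= => ltx ltx'.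
  by move/rowE => /(_ (pos x)); rewrite /in_triple /= /pos /neg; lia.
- rewrite -all_predC; apply/allP => r; rewrite mem_cat => /orP[] /mapP[i].
    rewrite mem_iota /= => lti ->; apply/negP => /mapP[x]; rewrite mem_iota /=.
    move=> ltx /rowE H; have [H1 H2 H3 H4 H5] := clauseP lti.
    have := H (pos (nv + i)); have := H (neg (nv + i)).
    by rewrite /in_triple /= /pos /neg; lia.
  rewrite mem_iota /= => lti ->; apply/negP => /mapP[x]; rewrite mem_iota /=.
  move=> ltx /rowE H; have [H1 H2 H3 H4 H5] := clauseP lti.
  have := H (pos (nv + i)); have := H (neg (nv + i)).
  by rewrite /in_triple /= /pos /neg; lia.
- rewrite map_inj_in_uniq ?iota_uniq // => i i'; rewrite !mem_iota /= => lti lti'.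
  have [H1 H2 H3 H4 H5] := clauseP lti'.
  by move/rowE => /(_ (pos (nv + i))); rewrite /in_triple /= /pos; lia.
- rewrite -all_predC; apply/allP => r /mapP[i].
  rewrite mem_iota /= => lti ->; apply/negP => /mapP[x]; rewrite mem_iota /=.
  move=> ltx /rowE H; have [H1 H2 H3 H4 H5] := clauseP lti.
  have := H (pos (nv + x)).
  by rewrite /in_triple /= /pos /neg; lia.
- rewrite map_inj_in_uniq ?iota_uniq // => i i'; rewrite !mem_iota /= => lti lti'.
  have [H1 H2 H3 H4 H5] := clauseP lti'.
  by move/rowE => /(_ (neg (nv + i))); rewrite /in_triple /= /neg; lia.
Qed.

Lemma size_triple_row t : t \in triples nv cs ->
  size [seq b <- triple_row n t | b] = 3.
Proof.
move=> /triplesP[t_uniq t_lt]; rewrite /triple_row filter_map size_map.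
apply: (perm_size (s2 := [:: t.1.1; t.1.2; t.2])).
apply: uniq_perm => //; first by rewrite filter_uniq ?iota_uniq.
move=> e; rewrite mem_filter mem_iota add0n /= !inE.
apply/andP/idP => [[]//|te]; split=> //.
by apply: (allP t_lt); rewrite !inE.
Qed.

Definition extend (tau : nat -> bool) (x : nat) : bool :=
  if x < nv then tau x
  else ~~ (ev tau (clause cs (x - nv)).1.1 || ev tau (clause cs (x - nv)).1.2).

Lemma ev_extend tau e : e <= nv + nv -> ev (extend tau) e = ev tau e.
Proof.
case: e => // e lt_e; have lt_half : e./2 < nv by lia.
by rewrite /ev /extend lt_half.
Qed.

Lemma extend_fresh tau i : extend tau (nv + i) =
  ~~ (ev tau (clause cs i).1.1 || ev tau (clause cs i).1.2).
Proof. by rewrite /extend ltnNge leq_addr /= addKn. Qed.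

Lemma triple_hit (sel : nat -> bool) t : t \in triples nv cs ->
  [|| sel t.1.1, sel t.1.2 | sel t.2] ->
  meets n [seq sel e | e <- iota 0 n] (triple_row n t).
Proof.
move=> /triplesP[_ t_lt] t_sel.
have [e et sel_e] : exists2 e, e \in [:: t.1.1; t.1.2; t.2] & sel e.
  by case/or3P: t_sel => ?; [exists t.1.1|exists t.1.2|exists t.2];
    rewrite // !inE eqxx ?orbT.
have lte := allP t_lt e et; apply/hasP; exists e; first by rewrite mem_iota.
by rewrite (nth_map 0) ?size_iota // nth_iota // add0n sel_e nth_triple_row //
  -[in_triple _ _]/(_ || _); move: et; rewrite !inE.
Qed.

Lemma size_instance_marginals : size (instance_marginals nv cs) = n.
Proof. by rewrite size_map size_iota. Qed.

(** The assignment and its complement, each with weight [2 ^ 0], form a certificate, so soundness of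
    certificates yields the decomposition. *)
Lemma sat_decomposition (R : realType) (tau : nat -> bool) :
  tau 0 -> all (sat tau) cs -> decomposition_problem R (instance_code nv cs).
Proof.
move=> tau0 tauP; pose tau' := extend tau.
pose sel1 e := ev tau' e; pose sel2 e := (e != 0) && ~~ ev tau' e.
have tau'0 : tau' 0 by rewrite /tau' /extend nv_gt0.
have sel1P t : t \in triples nv cs -> [|| sel1 t.1.1, sel1 t.1.2 | sel1 t.2].
  rewrite !mem_cat => /or3P[] /mapP[i]; rewrite mem_iota add0n => /= lti -> /=.
  - by rewrite /sel1 ev_pos ev_neg; case: (tau' i).
  - have [_ H1 H2 _ _] := clauseP lti.
    rewrite /sel1 ev_pos /tau' extend_fresh !ev_extend //.
    by case: (ev _ _) (ev _ _) => [] [].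
  - have [_ H1 H2 H3 _] := clauseP lti.
    rewrite /sel1 ev_neg /tau' extend_fresh negbK ev_extend //.
    have /or3P := allP tauP _ (mem_nth (0, 0, 0) lti).
    by rewrite -/(clause cs i) => -[] ->; rewrite ?orbT.
have sel2P t : t \in triples nv cs -> [|| sel2 t.1.1, sel2 t.1.2 | sel2 t.2].
  rewrite !mem_cat => /or3P[] /mapP[i]; rewrite mem_iota add0n => /= lti -> /=.
  - by rewrite /sel2 ev_pos ev_neg; case: (tau' i).
  - have [neq H1 H2 _ _] := clauseP lti.
    rewrite /sel2 ev_pos /tau' extend_fresh !ev_extend //=.
    (* If one of the two literals holds, the fresh variable is false and its positive literal lies
       in [sel2]. If both fail, at least one of them is not the element [0] and lies in [sel2]. *)
    case: (ev tau (clause cs i).1.1) (ev tau (clause cs i).1.2) => [] [];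
      rewrite ?orbT //= !andbT orbF; lia.
  - by rewrite /sel2 -[2]/(neg 0) !ev_neg tau'0 !orbT.
have sz := size_instance_marginals.
rewrite /instance_code -/n -sz.
apply: (@certificate_sound R _ _
  [:: ([seq sel1 e | e <- iota 0 n], 0); ([seq sel2 e | e <- iota 0 n], 0)]);
  rewrite ?sz //.
- apply/allP => r rP.
  have E1 : size [seq r' <- instance_rows nv cs | r' == r] = 1.
    by rewrite size_filter -[count _ _]/(count_mem r _) count_uniq_mem
      ?triples_uniq // rP.
  rewrite /valid_row E1 eqxx andbT; case/mapP: rP => t tP ->.
  by rewrite size_map size_iota eqxx size_triple_row.
- by apply/allP => p /mapP[e _ ->]; case: eqP.
- by rewrite /= andbT; apply/andP; split; apply/allP => _ /mapP[t tP ->];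
    apply: triple_hit => //; [apply: sel1P|apply: sel2P].
- apply/allP => e; rewrite mem_iota add0n => /= lte.
  rewrite /valid_at same_valueE !exp_value_sum_pairs !exp_value_exponents.
  rewrite (nth_map 0) ?size_iota // nth_iota // add0n /weights_at.
  have selE (sel : nat -> bool) : nth false [seq sel i | i <- iota 0 n] e = sel e.
    by rewrite (nth_map 0) ?size_iota // nth_iota.
  rewrite /= !selE /sel1 /sel2.
  rewrite /exp_value; clear selE; case: e lte => [|e] lte; first by rewrite /= !big_nil.
  by rewrite !big_cons big_nil; case: (ev _ _); rewrite /= !big_cons big_nil.
Qed.

Section Converse.

Variables (R : realType) (I : instance).

Let N := ground_size I.

Hypothesis encI : encode I = instance_code nv cs.

Let sizes : [/\ N = n, nums_of I = instance_marginals nv cs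
  & rows_of I = instance_rows nv cs].
Proof.
apply: encode_data_inj; rewrite -?encodeE //.
- by rewrite size_map size_enum_ord.
- exact: size_instance_marginals.
- by apply/allP => _ /mapP[P _ ->]; rewrite size_set_row.
- by apply/allP => _ /mapP[t _ ->]; rewrite size_map size_iota.
Qed.

Lemma marginal_of (o : 'I_N) :
  (@marginal R I o = if val o == 0 then 0 else 2^-1)%R.
Proof.
have [En Em _] := sizes; have lto : o < n by rewrite -En.
have := congr1 (fun s => nth ([::], [::]) s o) Em.
rewrite (nth_map o) ?size_enum_ord // nth_ord_enum.
rewrite (nth_map 0) ?size_iota // nth_iota // add0n.
rewrite /marginal => E; rewrite -[rho_num o]bits_value_binary.
rewrite -[rho_den o]bits_value_binary.
by case: eqP E => _ [-> ->] /=; rewrite ?mul0r ?div1r.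
Qed.

Lemma triple_in_family t : t \in triples nv cs ->
  exists2 P, P \in Defs.family I & forall o : 'I_N, (o \in P) = in_triple t o.
Proof.
move=> tP; have [En _ Er] := sizes.
have : triple_row n t \in rows_of I by rewrite Er map_f.
case/mapP=> P PI E; exists P => // o.
by rewrite -nth_set_row -E nth_triple_row // -En.
Qed.

Lemma decomposition_solution : has_feasible_decomposition R I ->
  exists2 tau : nat -> bool, tau 0 & all (sat tau) cs.
Proof.
case=> x xF; have xH := support_hits xF; case: xF => x_ge0 x1 xe _.
have [En _ _] := sizes.
pose el e (lte : e < n) : 'I_N := Ordinal (eq_ind_r (fun k => e < k) lte En).
have lt1 : 1 < n by rewrite /n /elt_count /var_count; lia.
have lt0 : 0 < n by [].
(* Element [1] is the positive literal of variable [0]. Its marginal is 1/2, so it lies in some set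
   of positive weight. *)
have sum1 : (\sum_(S : {set 'I_N} | el 1 lt1 \in S) x S != 0)%R.
  by rewrite xe marginal_of /= invr_eq0 pnatr_eq0.
have [S /andP[S1 xS_gt0]] := psumr_neq0P (fun S _ => x_ge0 S) (elimN eqP sum1).
have xS : (x S != 0)%R by rewrite gt_eqF.
pose sel e := nth false (set_row S) e.
have selE e (lte : e < n) : sel e = (el e lte \in S).
  by rewrite -(nth_set_row S (el e lte)).
have hit t : t \in triples nv cs -> [|| sel t.1.1, sel t.1.2 | sel t.2].
  move=> tP; have [P PI PE] := triple_in_family tP.
  have /set0Pn[o] := xH S xS P PI; rewrite inE PE -nth_set_row => /andP[oS].
  by case/or3P=> /eqP <-; rewrite /sel oS ?orbT.
have sel0 : sel 0 = false.
  rewrite (selE 0 lt0); apply: contraNF xS => S0.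
  have := xe (el 0 lt0); rewrite marginal_of /= => sum0.
  by rewrite (psumr_eq0P _ sum0).
have not_both v : v < var_count nv cs -> ~~ (sel (pos v) && sel (neg v)).
  move=> ltv; have ltp : pos v < n by rewrite /n /elt_count /pos; lia.
  have ltn : neg v < n by rewrite /n /elt_count /neg; lia.
  have tP : (0, pos v, neg v) \in triples nv cs.
    by rewrite mem_cat map_f // mem_iota.
  (* The number of literals of [v] in a random set has mean 1/2 + 1/2 = 1. Every set of positive
     weight contains at least one of them, as it hits the triple of [v] and misses [0]; hence it
     contains exactly one. *)
  pose g U : R := (x U * ((el _ ltp \in U)%:R + (el _ ltn \in U)%:R - 1))%R.
  have sum_in (o : 'I_N) : (\sum_U x U * (o \in U)%:R = marginal R o)%R.
    rewrite -xe [RHS]big_mkcond; apply: eq_bigr => U _.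
    by case: (o \in U); rewrite ?mulr1 ?mulr0.
  have g0 : (\sum_U g U = 0)%R.
    under eq_bigr do rewrite /g mulrBr mulrDr mulr1.
    rewrite sumrB big_split /= !sum_in x1 !marginal_of /=.
    have {1}-> : (2^-1 + 2^-1 = 1 :> R)%R by rewrite [RHS]splitr div1r.
    exact: subrr.
  have g_ge0 U : (0 <= g U)%R.
    rewrite /g; have [->|xU] := eqVneq (x U) 0%R; first by rewrite mul0r.
    rewrite mulr_ge0 // subr_ge0; have [P PI PE] := triple_in_family tP.
    have /set0Pn[o] := xH U xU P PI; rewrite inE PE => /andP[oU].
    case/or3P=> /eqP oE.
    - have xU0 : x U = 0%R.
        have := xe o; rewrite marginal_of [val o]oE /= => sum0.
        by rewrite (psumr_eq0P _ sum0).
      by rewrite xU0 eqxx in xU.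
    - by rewrite (_ : el _ ltp = o) ?oU ?lerDl //; apply: val_inj.
    - by rewrite (_ : el _ ltn = o) ?oU ?lerDr //; apply: val_inj.
  have /eqP : g S = 0%R by apply: (psumr_eq0P _ g0).
  rewrite /g mulf_eq0 (negbTE xS) /= (selE _ ltp) (selE _ ltn).
  by case: (_ \in S) (_ \in S) => [] []; rewrite //= addrK oner_eq0.
pose tau v := sel (pos v).
have sel_ev e : e < n -> sel e = ev tau e.
  move=> lte; have [->|e_gt0] := posnP e; first by rewrite sel0.
  pose v := e.-1./2; have ltv : v < var_count nv cs.
    by move: lte; rewrite /v /n /elt_count; lia.
  have [->|->] : e = pos v \/ e = neg v.
    have := odd_double_half e.-1; rewrite /pos /neg /v -addnn.
    by case: odd; lia.
  - by rewrite ev_pos.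
  - rewrite ev_neg /tau; have := not_both v ltv.
    have := hit (0, pos v, neg v); rewrite /= sel0 /= mem_cat map_f ?mem_iota //.
    by move=> /(_ isT); case: (sel _) (sel _) => [] [].
exists tau; first exact: (etrans (selE _ lt1) S1).
apply/allP => t tcs; pose i := index t cs.
have lti : i < size cs by rewrite index_mem.
have tE : clause cs i = t by rewrite /clause nth_index.
have [_ H1 H2 H3 _] := clauseP lti; rewrite tE in H1 H2 H3.
have lt_e e : e <= nv + nv -> e < n by rewrite /n /elt_count /var_count; lia.
rewrite /sat -!sel_ev ?lt_e //.
have lt_i : i \in iota 0 (size cs) by rewrite mem_iota.
have /hit : ((clause cs i).1, pos (nv + i)) \in triples nv cs.
  by rewrite !mem_cat (map_f (fun i => ((clause cs i).1, pos (nv + i))) lt_i) orbT.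
have /hit : (neg (nv + i), (clause cs i).2, 2) \in triples nv cs.
  by rewrite !mem_cat
    (map_f (fun i => (neg (nv + i), (clause cs i).2, 2)) lt_i) !orbT.
have lt_y : nv + i < var_count nv cs by rewrite ltn_add2l.
(* As [1] is in [S], element [2] is not. If the fresh variable holds, the second triple of the
   clause then forces its third literal; otherwise the first triple forces one of the first two. *)
have := not_both _ lt_y; have := not_both 0 (leq_trans nv_gt0 (leq_addr _ _)).
rewrite tE /= -[pos 0]/1 -[neg 0]/2 (selE 1 lt1) S1 /=.
by case: (sel 2); case: (sel (pos _)); case: (sel (neg _)); case: (sel t.1.1);
  case: (sel t.1.2); case: (sel t.2).
Qed.

End Converse.

Lemma decomposition_sat (R : realType) :
  decomposition_problem R (instance_code nv cs) ->
  exists2 tau : nat -> bool, tau 0 & all (sat tau) cs.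
Proof. by case=> I encI; apply: decomposition_solution. Qed.

End Reduction.

Ltac pt_solve_if := repeat (first [pt_basic | apply: pt_if]; cbv beta).

Lemma pt_instance_code {X} `{codable X} (nv : X -> nat) (cs : X -> seq triple) :
  pt nv -> pt cs -> pt (fun x => instance_code (nv x) (cs x)).
Proof.
move=> Hnv Hcs; rewrite /instance_code.
have Hn : pt (fun x => elt_count (nv x) (cs x)).
  by rewrite /elt_count /var_count; pt_solve.
apply: pt_encode_data => //.
  by rewrite /instance_marginals; pt_solve_if.
rewrite /instance_rows /triples /triple_row /in_triple /clause /var_count /pos /neg.
pt_solve_if.
exact: (pt_comp Hn (pt_fst pt_id)).
Qed.

(** * Clause schemata with parameters for time and position *)

Section Templates.

Variable kind : finType.

(* A literal of a clause schema with parameters [t] (time) and [j] (position):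
   [TNull] is the never chosen element, [TMode] the negation of variable [0],
   and [TVar s dt jm k] is the variable of kind [k] at time [t + dt] and at
   position [0] if [jm = None], [j + d] if [jm = Some d]. *)
Inductive tlit :=
| TNull
| TMode
| TVar of bool & bool & option bool & kind.

(** An index in mixed radix. The successor reserves [0] for the variable that is true in every
    solution considered. *)
Definition var (wd t j : nat) (k : kind) : nat :=
  ((t * wd + j) * #|kind| + enum_rank k).+1.

Definition position (jm : option bool) (j : nat) : nat :=
  if jm is Some d then j + d else 0.

Definition lit_code (wd t j : nat) (l : tlit) : nat :=
  match l with
  | TNull => 0
  | TMode => 2
  | TVar s dt jm k =>
      let v := var wd (t + dt) (position jm j) k in if s then pos v else neg v
  end.

Definition template : Type := tlit * tlit * tlit.

Definition clause_code (wd t j : nat) (c : template) : triple :=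
  (lit_code wd t j c.1.1, lit_code wd t j c.1.2, lit_code wd t j c.2).

(** Variables of different kinds are distinct for all times and positions, by [var_kind], so
    well-formedness can be decided on the schema. *)
Definition wf_template (c : template) : bool :=
  match c.1.1, c.1.2 with
  | TVar _ _ _ k, TVar _ _ _ k' => k != k'
  | TVar _ _ _ _, TNull => true
  | TMode, TNull => true
  | _, _ => false
  end && (if c.2 is TMode then false else true).

Definition tval (a : nat -> nat -> kind -> bool) (t j : nat) (l : tlit) : bool :=
  if l is TVar s dt jm k then a (t + dt) (position jm j) k == s else false.

Definition tsat (a : nat -> nat -> kind -> bool) (t j : nat) (c : template) :=
  [|| tval a t j c.1.1, tval a t j c.1.2 | tval a t j c.2].

Definition var_bound (wd ht : nat) : nat := (ht * wd * #|kind|).+1.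

Lemma var_lt wd ht t j k : t < ht -> j < wd -> var wd t j k < var_bound wd ht.
Proof.
move=> lt_t lt_j; rewrite /var /var_bound ltnS.
have := ltn_ord (enum_rank k); set K := #|kind|; set r := nat_of_ord _ => lt_r.
apply: (@leq_trans ((t * wd + j).+1 * K)); first by rewrite mulSn; lia.
rewrite leq_mul2r; apply/orP; right.
apply: (@leq_trans (t.+1 * wd)); first by rewrite mulSn; lia.
by rewrite leq_mul2r lt_t orbT.
Qed.

Lemma var_kind wd t j k t' j' k' : var wd t j k = var wd t' j' k' -> k = k'.
Proof.
move=> [] /(congr1 (modn^~ #|kind|)); rewrite !modnMDl !modn_small //.
by move/val_inj/enum_rank_inj.
Qed.

Lemma wf_clause_code wd ht t j c : t.+1 < ht -> j.+1 < wd -> wf_template c ->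
  wf_clause (var_bound wd ht) (clause_code wd t j c).
Proof.
move=> lt_t lt_j.
have vlt (dt : bool) jm k :
    var wd (t + dt) (position jm j) k < var_bound wd ht.
  by apply: var_lt; [case: dt|case: jm => [[]|]] => /=; lia.
have lit_le l : lit_code wd t j l <= var_bound wd ht + var_bound wd ht.
  case: l => [||s dt jm k] //=; first by rewrite /var_bound; lia.
  by have := vlt dt jm k; rewrite /pos /neg; case: s => /=; lia.
have lit_var s dt jm k : lit_code wd t j (TVar s dt jm k) > 2.
  by rewrite /= /pos /neg /var; case: s; lia.
case: c => [[l1 l2] l3]; rewrite /wf_template /= => /andP[wf12 wf3]; apply/and5P; split; rewrite ?lit_le //=.
- case: l1 wf12 => [||s dt jm k]; case: l2 => [||s' dt' jm' k'] //=.
    by case: s.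
  move=> neq; have nvar : var wd (t + dt) (position jm j) k <>
      var wd (t + dt') (position jm' j) k'.
    by move/var_kind => E; rewrite E eqxx in neq.
  by rewrite /pos /neg; case: s; case: s'; lia.
- case: l3 wf3 => [||s dt jm k] //= _; have := lit_var s dt jm k => /=.
  by move=> H; rewrite gtn_eqF.
Qed.

Section Assignment.

Variables (tau : nat -> bool) (a : nat -> nat -> kind -> bool) (wd : nat).
Hypothesis tau0 : tau 0.
Hypothesis tauE : forall t j k, j < wd -> tau (var wd t j k) = a t j k.

Lemma ev_lit_code t j l : j.+1 < wd -> ev tau (lit_code wd t j l) = tval a t j l.
Proof.
move=> lt_j; case: l => [||s dt jm k] //=.
  by rewrite -[2]/(neg 0) ev_neg tau0.
have ltp : position jm j < wd by case: jm => [[]|] /=; lia.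
by case: s; rewrite ?ev_pos ?ev_neg tauE //; case: (a _ _ _).
Qed.

Lemma sat_clause_code t j c : j.+1 < wd ->
  sat tau (clause_code wd t j c) = tsat a t j c.
Proof. by move=> lt_j; rewrite /sat /= !ev_lit_code. Qed.

End Assignment.

Definition decode_assignment (a : nat -> nat -> kind -> bool) (wd : nat)
    (x : nat) : bool :=
  if x is y.+1 then
    if [pick k : kind | val (enum_rank k) == y %% #|kind|] is Some k
    then a ((y %/ #|kind|) %/ wd) ((y %/ #|kind|) %% wd) k else false
  else true.

Lemma decode_assignmentE a wd t j k : j < wd ->
  decode_assignment a wd (var wd t j k) = a t j k.
Proof.
move=> lt_j; rewrite /decode_assignment /var.
have K_gt0 : 0 < #|kind| by apply: leq_ltn_trans (ltn_ord (enum_rank k)).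
have E1 u : (u * #|kind| + enum_rank k) %/ #|kind| = u.
  by rewrite divnMDl // divn_small ?addn0.
have E2 : (t * wd + j) %/ wd = t by rewrite divnMDl ?divn_small ?addn0 //; lia.
have E3 : (t * wd + j) %% wd = j by rewrite modnMDl modn_small.
rewrite E1 E2 E3 modnMDl modn_small //.
case: pickP => [k' /eqP/val_inj/enum_rank_inj -> //|/(_ k)].
by rewrite eqxx.
Qed.

Lemma pt_lit_code {X} `{codable X} (wd t j : X -> nat) (l : tlit) :
  pt wd -> pt t -> pt j -> pt (fun x => lit_code (wd x) (t x) (j x) l).
Proof.
move=> Hwd Ht Hj; case: l => [||s dt jm k]; rewrite /lit_code; try exact: pt_const.
rewrite /var /pos /neg /position; case: jm => [d|]; case: s;
  by pt_solve.
Qed.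

Lemma pt_clause_codes {X} `{codable X} (wd t j : X -> nat) (cs : seq template) :
  pt wd -> pt t -> pt j ->
  pt (fun x => [seq clause_code (wd x) (t x) (j x) c | c <- cs]).
Proof.
move=> Hwd Ht Hj; elim: cs => [|c cs IH] /=; first exact: pt_const.
apply: pt_cons => //; apply: pt_pair; last exact: pt_lit_code.
by apply: pt_pair; apply: pt_lit_code.
Qed.

End Templates.

Arguments TNull {kind}.
Arguments TMode {kind}.

(** * Clauses that force a computation *)

Section CookLevin.

Variable M : machine.

Let k := last_tape M.
Let sym : finType := tape_symbol (work_symbol M).

Definition view : finType := (state M * {ffun 'I_k.+1 -> sym})%type.

Definition view_of (c : configuration M) : view :=
  (current c, [ffun i => scanned (tapes c i)]).

(** A halted configuration is given a move that changes nothing, so that the same rules apply before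
    and after halting. *)
Definition next_of (v : view) : state M * {ffun 'I_k.+1 -> sym * direction} :=
  if halting v.1 then (v.1, [ffun i => (v.2 i, Stay)]) else transition v.1 v.2.

Lemma stepE (c : configuration M) : step c =
  Configuration (next_of (view_of c)).1
    [ffun i => write_move (tapes c i) ((next_of (view_of c)).2 i)].
Proof.
rewrite /step /next_of /=; case: ifP => _; last by case: transition.
case: c => q tp /=; congr Configuration; apply/ffunP => i; rewrite !ffunE.
by case: (tp i).
Qed.

(* The kinds of variables: input bits and end-of-input marks; current state;
   agreement of the current view with [v] on its first [m] tapes; contents of
   the cells left of, at and right of each head. *)
Definition kind : finType :=
  ((bool + state M) + (view * 'I_k.+2) + ('I_3 * 'I_k.+1 * sym))%type.

Definition KB : kind := inl (inl (inl true)).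
Definition KE : kind := inl (inl (inl false)).
Definition KQ (q : state M) : kind := inl (inl (inr q)).
Definition KU (v : view) (m : 'I_k.+2) : kind := inl (inr (v, m)).
Definition KL (i : 'I_k.+1) (a : sym) : kind := inr (@Ordinal 3 0 isT, i, a).
Definition KS (i : 'I_k.+1) (a : sym) : kind := inr (@Ordinal 3 1 isT, i, a).
Definition KR (i : 'I_k.+1) (a : sym) : kind := inr (@Ordinal 3 2 isT, i, a).

Definition at_t (s : bool) (x : kind) : tlit kind := TVar s false None x.
Definition at_tj (s d : bool) (x : kind) : tlit kind := TVar s false (Some d) x.
Definition at_t1 (x : kind) : tlit kind := TVar true true None x.
Definition at_t1j (d : bool) (x : kind) : tlit kind := TVar true true (Some d) x.

Definition is_left (d : direction) := if d is MoveLeft then true else false.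
Definition is_right (d : direction) := if d is MoveRight then true else false.

Definition rule : finType := (view * 'I_k.+1 * sym * 'I_8)%type.

(** Rules 0 and 1 assemble the view one tape at a time, which keeps clauses within three literals.
    From the complete view, 2 yields the next state, 4 and 5 shift the cells on either side of the
    head, 6 yields the new scanned symbol and 7 the cell just left. Rule 3 excludes halting on the
    bit [false]. Where there is nothing to state, the clause is a tautology. *)
Definition rule_template (r : rule) : template kind :=
  let: (v, i, a, c) := r in
  let X := at_t false (KU v ord_max) in
  let: (b, d) := (next_of v).2 i in
  match val c with
  | 0 => (at_t false (KQ v.1), TNull, at_t true (KU v ord0))
  | 1 => (at_t false (KU v (widen_ord (leqnSn _) i)), at_t false (KS i (v.2 i)),
          at_t true (KU v (lift ord0 i)))
  | 2 => (X, TNull, at_t1 (KQ (next_of v).1))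
  | 3 => if halting v.1 && (v.2 ord0 == Some (inl false))
         then (X, TNull, TNull) else (X, TNull, at_t true (KU v ord_max))
  | 4 => (X, at_tj false (is_left d) (KL i a), at_t1j (is_right d) (KL i a))
  | 5 => (X, at_tj false (is_right d) (KR i a), at_t1j (is_left d) (KR i a))
  | 6 => match d with
         | Stay => (X, TNull, at_t1 (KS i b))
         | MoveLeft => (X, at_t false (KL i a), at_t1 (KS i a))
         | MoveRight => (X, at_t false (KR i a), at_t1 (KS i a))
         end
  | _ => match d with
         | Stay => (X, TNull, at_t true (KU v ord_max))
         | MoveLeft => (X, TNull, at_t1 (KR i b))
         | MoveRight => (X, TNull, at_t1 (KL i b))
         end
  end.

Definition init_rule : finType := ('I_k.+1 * 'I_9)%type.

(** Rules 2 and 3 put blanks beyond the end mark and on the other tapes. Rules 4 to 7 copy the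
    input, bit [0] under the head and bit [j.+1] to the cell [j] on its right. Rule 8 propagates the
    end mark. *)
Definition init_template (r : init_rule) : template kind :=
  let: (i, c) := r in
  match val c with
  | 0 => (TMode, TNull, at_t true (KQ (start M)))
  | 1 => (TMode, TNull, at_tj true false (KL i None))
  | 2 => if i == ord0 then (at_tj false true KE, TNull, at_tj true false (KR i None))
         else (TMode, TNull, at_tj true false (KR i None))
  | 3 => if i == ord0 then (at_t false KE, TNull, at_t true (KS i None))
         else (TMode, TNull, at_t true (KS i None))
  | 4 => (at_tj true true KE, at_tj false true KB,
          at_tj true false (KR ord0 (Some (inl true))))
  | 5 => (at_tj true true KE, at_tj true true KB,
          at_tj true false (KR ord0 (Some (inl false))))
  | 6 => (at_t true KE, at_t false KB, at_t true (KS ord0 (Some (inl true))))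
  | 7 => (at_t true KE, at_t true KB, at_t true (KS ord0 (Some (inl false))))
  | _ => (at_tj false false KE, TNull, at_tj true true KE)
  end.

Lemma wf_rule r : wf_template (rule_template r).
Proof.
case: r => [[[v i] a] c] /=; case: ((next_of v).2 i) => b d.
by case: c => [[|[|[|[|[|[|[|[|]]]]]]]] ?] //=; [case: ifP|case: d|case: d].
Qed.

Lemma wf_init r : wf_template (init_template r).
Proof.
case: r => i c /=; case: c => [[|[|[|[|[|[|[|[|[|]]]]]]]]] ?] //=;
  by case: ifP.
Qed.

Definition rules : seq (template kind) := [seq rule_template r | r <- enum rule].
Definition init_rules : seq (template kind) :=
  [seq init_template r | r <- enum init_rule].

Definition trace (s : seq bool) (t : nat) : configuration M :=
  iter t (@step M) (initial M s).

Lemma traceS s t : trace s t.+1 = Configuration (next_of (view_of (trace s t))).1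
  [ffun i => write_move (tapes (trace s t) i)
    ((next_of (view_of (trace s t))).2 i)].
Proof. exact: stepE. Qed.

Section Truth.

Variable s : seq bool.

Definition truth (t j : nat) (x : kind) : bool :=
  match x with
  | inl (inl (inl true)) => nth false s j
  | inl (inl (inl false)) => size s <= j
  | inl (inl (inr q)) => current (trace s t) == q
  | inl (inr (v, m)) => (current (trace s t) == v.1) &&
      [forall i : 'I_k.+1, (i < m) ==> (scanned (tapes (trace s t) i) == v.2 i)]
  | inr (p, i, a) =>
      let tp := tapes (trace s t) i in
      match val p with
      | 0 => nth None (left_cells tp) j
      | 1 => scanned tp
      | _ => nth None (right_cells tp) j
      end == a
  end.

Arguments truth : simpl never.

Lemma truthL t j i a :
  truth t j (KL i a) = (nth None (left_cells (tapes (trace s t) i)) j == a).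
Proof. by []. Qed.

Lemma truthS t j i a : truth t j (KS i a) = (scanned (tapes (trace s t) i) == a).
Proof. by []. Qed.

Lemma truthR t j i a :
  truth t j (KR i a) = (nth None (right_cells (tapes (trace s t) i)) j == a).
Proof. by []. Qed.

Lemma truthQ t j q : truth t j (KQ q) = (current (trace s t) == q).
Proof. by []. Qed.

Lemma truth_view t j v : truth t j (KU v ord_max) = (view_of (trace s t) == v).
Proof.
case: v => q f; rewrite /truth /= /view_of xpair_eqE; congr (_ && _).
apply/forallP/eqP => [H|<- i]; last by rewrite ffunE eqxx implybT.
apply/ffunP => i; rewrite ffunE; have := H i.
by rewrite /= ltn_ord => /eqP.
Qed.

Lemma head_nth0 T (x : T) l : head x l = nth x l 0.
Proof. by case: l. Qed.

Lemma trace_tapes t i : tapes (trace s t.+1) i =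
  write_move (tapes (trace s t) i) ((next_of (view_of (trace s t))).2 i).
Proof. by rewrite traceS ffunE. Qed.

Lemma truth_rules t j r :
  (halting (current (trace s t)) ->
    scanned (tapes (trace s t) ord0) != Some (inl false)) ->
  tsat truth t j (rule_template r).
Proof.
move=> accept; case: r => [[[v i] a] c].
have Etp := trace_tapes t i.
rewrite /rule_template; case Eact: ((next_of v).2 i) => [b d].
have nextP : view_of (trace s t) = v ->
    tapes (trace s t.+1) i = write_move (tapes (trace s t) i) (b, d).
  by move=> Ev; rewrite Etp Ev Eact.
case: c => [[|[|[|[|[|[|[|[|]]]]]]]] ?] //=; rewrite /tsat /tval /position /=
  ?addn0 ?addn1 ?eqbF_neg ?eqb_id.
- rewrite /truth /=; case: (_ == v.1) => //=.
  by apply/forallP.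
- rewrite /truth /=; case: (_ == v.1) => //=.
  case: forallP => //= H; case: eqP => //= E; apply/forallP => i0.
  apply/implyP; rewrite ltnS leq_eqVlt => /orP[/eqP/val_inj ->|lt]; first by rewrite E.
  by have := H i0; rewrite lt.
- rewrite truth_view truthQ traceS /=.
  by case: (view_of _ =P v) => [->|_] //=; rewrite eqxx.
- case: ifP => [/andP[halt_v /eqP v0]|_] /=; rewrite addn0 truth_view ?orbF eqbF_neg.
    case: (view_of _ =P v) => //= Ev; rewrite -Ev in halt_v v0.
    by have := accept halt_v; rewrite -v0 ffunE eqxx.
  by rewrite eqb_id; case: (_ == v).
- rewrite truth_view !truthL; case: (view_of _ =P v) => //= /nextP ->.
  case: (tapes _ i) => l x r; case: d {Eact nextP} => /=;
    by rewrite ?addn0 ?addn1 ?nth_behead; case: (_ == a).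
- rewrite truth_view !truthR; case: (view_of _ =P v) => //= /nextP ->.
  case: (tapes _ i) => l x r; case: d {Eact nextP} => /=;
    by rewrite ?addn0 ?addn1 ?nth_behead; case: (_ == a).
- case: d Eact nextP => _ nextP; rewrite /= ?addn0 ?addn1 ?eqbF_neg ?eqb_id
    truth_view ?truthL ?truthR truthS;
    case: (view_of _ =P v) => //= /nextP ->; case: (tapes _ i) => l x r /=;
    by rewrite ?eqxx ?head_nth0 //; case: (_ == a).
- case: d Eact nextP => _ nextP; rewrite /= ?addn0 ?addn1 ?eqbF_neg ?eqb_id
    !truth_view ?truthL ?truthR; case: (view_of _ =P v) => //= /nextP ->;
    by case: (tapes _ i) => l x r /=; rewrite eqxx.
Qed.

Lemma truth_init j r : tsat truth 0 j (init_template r).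
Proof.
have E i : tapes (trace s 0) i =
    input_tape (work_symbol M) (if i == ord0 then s else [::]) by rewrite ffunE.
have tapeR i : right_cells (tapes (trace s 0) i) =
    behead [seq Some (inl b) | b <- if i == ord0 then s else [::]] by rewrite E.
have tapeS i : scanned (tapes (trace s 0) i) =
    head None [seq Some (inl b) | b <- if i == ord0 then s else [::]] by rewrite E.
have tapeL i : left_cells (tapes (trace s 0) i) = [::] by rewrite E.
have nthS n : size s <= n -> nth None [seq Some (inl b) : sym | b <- s] n = None.
  by move=> le_n; rewrite nth_default ?size_map.
have nthB n : n < size s ->
    nth None [seq Some (inl b) : sym | b <- s] n = Some (inl (nth false s n)).
  by move=> lt_n; rewrite (nth_map false).
have truthE t n : truth t n KE = (size s <= n) by [].
have truthB t n : truth t n KB = nth false s n by [].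
case: r => i c; case: c => [[|[|[|[|[|[|[|[|[|]]]]]]]]] ?] //=;
  rewrite /tsat /= ?eqbF_neg ?eqb_id ?addn0 ?addn1.
- by rewrite truthQ /= eqxx.
- by rewrite truthL tapeL nth_nil.
- case: eqP => [->|/eqP/negbTE ne] /=; rewrite ?eqbF_neg ?eqb_id ?addn0 ?addn1 truthR tapeR.
    by rewrite eqxx truthE nth_behead; case: leqP => //= /nthS ->.
  by rewrite ne nth_nil.
- case: eqP => [->|/eqP/negbTE ne] /=; rewrite ?eqbF_neg ?eqb_id ?addn0 truthS tapeS.
    by rewrite eqxx truthE head_nth0; case: leqP => //= /nthS ->.
  by rewrite ne.
- rewrite truthE truthB truthR tapeR eqxx nth_behead.
  by case: leqP => //= /nthB ->; case: nth.
- rewrite truthE truthB truthR tapeR eqxx nth_behead.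
  by case: leqP => //= /nthB ->; case: nth.
- rewrite truthE truthB truthS tapeS eqxx head_nth0.
  by case: leqP => //= /nthB ->; case: nth.
- rewrite truthE truthB truthS tapeS eqxx head_nth0.
  by case: leqP => //= /nthB ->; case: nth.
- by rewrite !truthE; case: leqP => //= /leqW ->.
Qed.

End Truth.

Section Soundness.

Variables (a : nat -> nat -> kind -> bool) (wd T : nat) (s : seq bool).
Hypothesis ruleP : forall t j r, t < T -> j.+1 < wd -> tsat a t j (rule_template r).
Hypothesis initP : forall j r, j.+1 < wd -> tsat a 0 j (init_template r).
Hypothesis endP : forall j, j < wd -> a 0 j KE = (size s <= j).
Hypothesis bitP : forall j, j < size s -> a 0 j KB = nth false s j.
Hypothesis s_gt0 : 0 < size s.
Hypothesis T_wd : T.+1 < wd.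

(** Only variables that describe the actual run are claimed to be true. The window [j + t < wd.-1]
    shrinks by one cell per step, because after a move the content of cell [j] may come from cell
    [j.+1]. *)
Let tape_ok t := [/\ a t 0 (KQ (current (trace s t))),
  forall i, a t 0 (KS i (scanned (tapes (trace s t) i))),
  forall i j, j + t < wd.-1 ->
    a t j (KL i (nth None (left_cells (tapes (trace s t) i)) j))
  & forall i j, j + t < wd.-1 ->
    a t j (KR i (nth None (right_cells (tapes (trace s t) i)) j))].

Let view_ok t : t < T -> tape_ok t -> a t 0 (KU (view_of (trace s t)) ord_max).
Proof.
move=> lt_t [Qt St _ _]; set v := view_of _.
have lt1 : 0.+1 < wd by lia.
have step_m (i : 'I_k.+1) : a t 0 (KU v (widen_ord (leqnSn _) i)) ->
    a t 0 (KU v (lift ord0 i)).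
  move=> Um; have := ruleP (v, i, None, @Ordinal 8 1 isT) lt_t lt1.
  have := St i; rewrite /rule_template; case: ((next_of v).2 i) => b d.
  rewrite /tsat /= !eqbF_neg eqb_id addn0 Um /= [[ffun _ => _] i]ffunE.
  by move=> ->.
have U0 : a t 0 (KU v ord0).
  have := ruleP (v, ord0, None, @Ordinal 8 0 isT) lt_t lt1.
  rewrite /rule_template; case: ((next_of v).2 ord0) => b d.
  by rewrite /tsat /= !eqbF_neg eqb_id addn0 Qt.
suff H m (lt_m : m < k.+2) : a t 0 (KU v (Ordinal lt_m)) by apply: H.
elim: m lt_m => [|m IH] lt_m; first by rewrite (_ : Ordinal _ = ord0) //; apply: val_inj.
have lt_m' : m < k.+1 by [].
rewrite (_ : Ordinal _ = lift ord0 (Ordinal lt_m')); last exact: val_inj.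
by apply: step_m; rewrite (_ : widen_ord _ _ = Ordinal (leqW lt_m')) //; apply: val_inj.
Qed.

Let tape_ok0 : tape_ok 0.
Proof.
have E i : tapes (trace s 0) i =
    input_tape (work_symbol M) (if i == ord0 then s else [::]) by rewrite ffunE.
have lt1 : 0.+1 < wd by lia.
have nthS n : size s <= n -> nth None [seq Some (inl b) : sym | b <- s] n = None.
  by move=> le_n; rewrite nth_default ?size_map.
have nthB n : n < size s ->
    nth None [seq Some (inl b) : sym | b <- s] n = Some (inl (nth false s n)).
  by move=> lt_n; rewrite (nth_map false).
split.
- have := initP (ord0, @Ordinal 9 0 isT) lt1.
  by rewrite /tsat /= eqb_id.
- move=> i; rewrite E; have := initP (i, @Ordinal 9 3 isT) lt1.
  rewrite /tsat /=; case: eqP => [->|_] /=; last by rewrite eqb_id.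
  move=> _; rewrite head_nth0 nthB //.
  have := initP (i, @Ordinal 9 6 isT) lt1; have := initP (i, @Ordinal 9 7 isT) lt1.
  rewrite /tsat /= !eqb_id !eqbF_neg endP; last by lia.
  by rewrite leqNgt s_gt0 bitP //; case: (nth _ _ _).
- move=> i j lt_j; rewrite E nth_nil.
  have := initP (i, @Ordinal 9 1 isT) (j := j).
  by rewrite /tsat /= eqb_id !addn0; apply; lia.
- move=> i j lt_j; have lt_j1 : j.+1 < wd by lia.
  rewrite E; have := initP (i, @Ordinal 9 2 isT) lt_j1.
  rewrite /tsat /=; case: eqP => [->|_] /=; last first.
    by rewrite eqb_id !addn0 nth_nil.
  rewrite !eqb_id eqbF_neg !addn0 addn1 endP // nth_behead.
  case: leqP => [/nthS -> //|lt_js _]; rewrite nthB //.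
  have := initP (i, @Ordinal 9 4 isT) lt_j1; have := initP (i, @Ordinal 9 5 isT) lt_j1.
  rewrite /tsat /= !eqb_id !eqbF_neg !addn0 addn1 endP // leqNgt lt_js bitP //.
  by case: (nth _ _ _).
Qed.

Let tape_okS t : t < T -> tape_ok t -> tape_ok t.+1.
Proof.
move=> lt_t ok_t; have X := view_ok lt_t ok_t; case: ok_t => [_ _ Lt Rt].
set v := view_of _ in X; have lt1 : 0.+1 < wd by lia.
have ruleX i b c j := @ruleP t j (v, i, b, c) lt_t.
split; last 2 first.
- move=> i j lt_j; rewrite trace_tapes -/v.
  case Eact: ((next_of v).2 i) => [b d]; have := Lt i.
  case: (tapes (trace s t) i) => l x r /= Lti.
  case: d Eact => Eact.
  + have := ruleX i (nth None l j.+1) (@Ordinal 8 4 isT) j.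
    rewrite /tsat /= Eact /= !eqbF_neg eqb_id !addn0 !addn1 X Lti /=; last by lia.
    by rewrite nth_behead; apply; lia.
  + have := ruleX i (nth None l j) (@Ordinal 8 4 isT) j.
    rewrite /tsat /= Eact /= !eqbF_neg eqb_id !addn0 !addn1 X Lti /=; last by lia.
    by apply; lia.
  + case: j lt_j => [|j] lt_j /=.
      have := ruleX i None (@Ordinal 8 7 isT) 0 lt1.
      by rewrite /tsat /= Eact /= !eqbF_neg eqb_id !addn0 !addn1 X.
    have := ruleX i (nth None l j) (@Ordinal 8 4 isT) j.
    rewrite /tsat /= Eact /= !eqbF_neg eqb_id !addn0 !addn1 X Lti /=; last by lia.
    by apply; lia.
- move=> i j lt_j; rewrite trace_tapes -/v.
  case Eact: ((next_of v).2 i) => [b d]; have := Rt i.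
  case: (tapes (trace s t) i) => l x r /= Rti.
  case: d Eact => Eact.
  + case: j lt_j => [|j] lt_j /=.
      have := ruleX i None (@Ordinal 8 7 isT) 0 lt1.
      by rewrite /tsat /= Eact /= !eqbF_neg eqb_id !addn0 !addn1 X.
    have := ruleX i (nth None r j) (@Ordinal 8 5 isT) j.
    rewrite /tsat /= Eact /= !eqbF_neg eqb_id !addn0 !addn1 X Rti /=; last by lia.
    by apply; lia.
  + have := ruleX i (nth None r j) (@Ordinal 8 5 isT) j.
    rewrite /tsat /= Eact /= !eqbF_neg eqb_id !addn0 !addn1 X Rti /=; last by lia.
    by apply; lia.
  + have := ruleX i (nth None r j.+1) (@Ordinal 8 5 isT) j.
    rewrite /tsat /= Eact /= !eqbF_neg eqb_id !addn0 !addn1 X Rti /=; last by lia.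
    by rewrite nth_behead; apply; lia.
- rewrite traceS /=; have := ruleX ord0 None (@Ordinal 8 2 isT) 0 lt1.
  rewrite /tsat /=; case: ((next_of v).2 ord0) => b d /=.
  by rewrite !eqbF_neg eqb_id !addn0 !addn1 X.
- move=> i; rewrite trace_tapes -/v.
  case Eact: ((next_of v).2 i) => [b d]; have := Rt i; have := Lt i.
  case: (tapes (trace s t) i) => l x r /= Lti Rti.
  case: d Eact => Eact /=.
  + have := ruleX i (head None l) (@Ordinal 8 6 isT) 0 lt1.
    rewrite /tsat /= Eact /= !eqbF_neg eqb_id !addn0 !addn1 X head_nth0 Lti //=.
    by lia.
  + have := ruleX i None (@Ordinal 8 6 isT) 0 lt1.
    by rewrite /tsat /= Eact /= !eqbF_neg eqb_id !addn0 !addn1 X.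
  + have := ruleX i (head None r) (@Ordinal 8 6 isT) 0 lt1.
    rewrite /tsat /= Eact /= !eqbF_neg eqb_id !addn0 !addn1 X head_nth0 Rti //=.
    by lia.
Qed.

Lemma rules_accept t : t < T -> halting (current (trace s t)) ->
  scanned (tapes (trace s t) ord0) != Some (inl false).
Proof.
move=> lt_t halt_t; have lt1 : 0.+1 < wd by lia.
have ok_t : tape_ok t.
  by elim: t lt_t {halt_t} => // t IH lt_t; apply: tape_okS (IH _); lia.
have := ruleP (view_of (trace s t), ord0, None, @Ordinal 8 3 isT) lt_t lt1.
rewrite /rule_template; case: ((next_of _).2 _) => b d.
rewrite /= ffunE halt_t /=; case: eqP => //= _.
by rewrite /tsat /= eqbF_neg addn0 (view_ok lt_t ok_t).
Qed.

End Soundness.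
End CookLevin.

(** * The tableau of a machine on an input with a free end *)

Section Tableau.

Variable M : machine.

(** A clause [(2, 0, l)] is the unit clause [l], as [2] and [0] are false. Such clauses fix the
    prefix [dw] and require the input to end no earlier than [size dw] and no later than
    [size dw + P]; the bits in between are free. *)
Definition tableau (dw : seq bool) (P T wd : nat) : seq triple :=
  flatten [seq flatten [seq [seq clause_code wd t j c | c <- rules M]
                       | j <- iota 0 wd.-1] | t <- iota 0 T] ++
  flatten [seq [seq clause_code wd 0 j c | c <- init_rules M]
          | j <- iota 0 wd.-1] ++
  [seq (2, 0, if nth false dw j then pos (var wd 0 j (KB M))
              else neg (var wd 0 j (KB M))) | j <- iota 0 (size dw)] ++
  [:: (2, 0, neg (var wd 0 (size dw).-1 (KE M)));
      (2, 0, pos (var wd 0 (size dw + P) (KE M)))].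

Lemma pt_tableau {X} `{codable X} (dw : X -> seq bool) (P T wd : X -> nat) :
  pt dw -> pt P -> pt T -> pt wd ->
  pt (fun x => tableau (dw x) (P x) (T x) (wd x)).
Proof.
move=> Hdw HP HT Hwd; have Hwd1 : pt (fun x => iota 0 (wd x).-1).
  by apply: pt_iota; [apply: pt_const|apply: pt_pred].
apply: pt_cat; [|apply: pt_cat; [|apply: pt_cat]].
- apply: pt_flatten; apply: pt_map; last by pt_solve.
  apply: pt_flatten; apply: pt_map; last exact: (pt_comp Hwd1 (pt_fst pt_id)).
  by apply: pt_clause_codes; pt_solve; exact: (pt_comp Hwd (pt_fst (pt_fst pt_id))).
- apply: pt_flatten; apply: pt_map => //.
  by apply: pt_clause_codes; pt_solve.
- by rewrite /var /pos /neg; pt_solve_if.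
- have Hp : pt (fun x => (size (dw x)).-1) by apply: pt_pred; pt_solve.
  by rewrite /var /pos /neg; pt_solve.
Qed.

Variables (dw : seq bool) (P T wd : nat).
Hypotheses (dw_gt0 : 0 < size dw) (T_gt0 : 0 < T) (T_wd : T.+1 < wd) (dwP_wd : size dw + P < wd).

Lemma all_tableau (Pr : pred triple) : all Pr (tableau dw P T wd) <->
  [/\ forall t j r, t < T -> j.+1 < wd -> Pr (clause_code wd t j (@rule_template M r)),
    forall j r, j.+1 < wd -> Pr (clause_code wd 0 j (@init_template M r)),
    forall j, j < size dw -> Pr (2, 0, if nth false dw j
      then pos (var wd 0 j (KB M)) else neg (var wd 0 j (KB M))),
    Pr (2, 0, neg (var wd 0 (size dw).-1 (KE M)))
  & Pr (2, 0, pos (var wd 0 (size dw + P) (KE M)))].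
Proof.
have wdE j : (j \in iota 0 wd.-1) = (j.+1 < wd).
  by rewrite mem_iota add0n /=; lia.
split=> [|[H1 H2 H3 H4 H5]].
  rewrite !all_cat => /and4P[/allP H1 /allP H2 /allP H3 /and3P[H4 H5 _]].
  split=> // [t j r lt_t lt_j|j r lt_j|j lt_j].
  - apply: H1; apply/flatten_mapP; exists t; first by rewrite mem_iota.
    apply/flatten_mapP; exists j; first by rewrite wdE.
    rewrite /rules -map_comp.
    by apply: (map_f (clause_code wd t j \o @rule_template M)); rewrite mem_enum.
  - apply: H2; apply/flatten_mapP; exists j; first by rewrite wdE.
    rewrite /init_rules -map_comp.
    by apply: (map_f (clause_code wd 0 j \o @init_template M)); rewrite mem_enum.
  - by apply: H3; apply/mapP; exists j; rewrite ?mem_iota.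
rewrite !all_cat /= H4 H5 !andbT; apply/and3P; split; apply/allP => c.
- case/flatten_mapP=> t; rewrite mem_iota add0n => /= lt_t.
  case/flatten_mapP=> j; rewrite wdE /rules -map_comp => lt_j /mapP[r _ ->].
  exact: H1.
- case/flatten_mapP=> j; rewrite wdE /init_rules -map_comp => lt_j /mapP[r _ ->].
  exact: H2.
- by case/mapP=> j; rewrite mem_iota add0n => /= lt_j ->; apply: H3.
Qed.

Lemma wf_tableau :
  all (wf_clause (var_bound (kind M) wd T.+1)) (tableau dw P T wd).
Proof.
have vlt j (x : kind M) : j < wd -> var wd 0 j x < var_bound (kind M) wd T.+1.
  by move=> lt_j; apply: var_lt.
have wf_fact (b : bool) j (x : kind M) : j < wd ->
    wf_clause (var_bound (kind M) wd T.+1)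
      (2, 0, if b then pos (var wd 0 j x) else neg (var wd 0 j x)).
  move/(vlt _ x); rewrite /wf_clause /= /pos /neg.
  have : 0 < var wd 0 j x by [].
  by move: (var _ _ _ _) (var_bound _ _ _) => v nv; case: b => /=; lia.
apply/all_tableau; split=> [t j r lt_t lt_j|j r lt_j|j lt_j||].
- by apply: wf_clause_code => //; apply: wf_rule.
- by apply: wf_clause_code => //; apply: wf_init.
- by apply: wf_fact; lia.
- by apply: (wf_fact false); lia.
- exact: (wf_fact true).
Qed.

(** Absence of rejection is what rule 3 can express. By [accepts_run] it amounts to acceptance once
    the machine halts before time [T]. *)
Definition accepts (s : seq bool) : Prop := forall t, t < T ->
  halting (current (trace M s t)) ->
  scanned (tapes (trace M s t) ord0) != Some (inl false).

Lemma sat_neg0 (tau : nat -> bool) e : tau 0 -> sat tau (2, 0, e) = ev tau e.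
Proof. by move=> tau0; rewrite /sat /= -[2]/(neg 0) ev_neg tau0. Qed.

Lemma accepts_tableau u : size u <= P -> accepts (dw ++ u) ->
  exists2 tau : nat -> bool, tau 0 & all (sat tau) (tableau dw P T wd).
Proof.
move=> size_u acc; pose a := @truth M (dw ++ u).
have tauE t j (x : kind M) : j < wd -> decode_assignment a wd (var wd t j x) = a t j x.
  exact: decode_assignmentE.
exists (decode_assignment a wd) => //; apply/all_tableau.
split=> [t j r lt_t lt_j|j r lt_j|j lt_j||].
- by rewrite (sat_clause_code (a := a)) //; apply: truth_rules; apply: acc.
- by rewrite (sat_clause_code (a := a)) //; apply: truth_init.
- have bE : a 0 j (KB M) = nth false dw j by rewrite /a /truth /= nth_cat lt_j.
  rewrite sat_neg0 //; case: ifP => E; rewrite ?ev_pos ?ev_neg tauE ?bE ?E //; lia.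
- rewrite sat_neg0 // ev_neg tauE; last by lia.
  by rewrite /a /truth /= size_cat; lia.
- rewrite sat_neg0 // ev_pos tauE; last by lia.
  by rewrite /a /truth /= size_cat; lia.
Qed.

Lemma tableau_accepts (tau : nat -> bool) :
  tau 0 -> all (sat tau) (tableau dw P T wd) ->
  exists2 u, size u <= P & accepts (dw ++ u).
Proof.
move=> tau0 /all_tableau[H1 H2 H3 H4 H5].
pose a t j (x : kind M) := tau (var wd t j x).
have tauE t j (x : kind M) : j < wd -> tau (var wd t j x) = a t j x by [].
have ruleP t j r : t < T -> j.+1 < wd -> tsat a t j (rule_template r).
  by move=> lt_t lt_j; rewrite -(sat_clause_code tau0 tauE) //; apply: H1.
have initP j r : j.+1 < wd -> tsat a 0 j (init_template r).
  by move=> lt_j; rewrite -(sat_clause_code tau0 tauE) //; apply: H2.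
rewrite sat_neg0 // ev_neg -/(a _ _ _) in H4.
rewrite sat_neg0 // ev_pos -/(a _ _ _) in H5.
have {}H3 j : j < size dw -> a 0 j (KB M) = nth false dw j.
  move=> /H3; rewrite sat_neg0 //.
  case: (nth false dw j); rewrite ?ev_pos ?ev_neg -/(a _ _ _); first by [].
  by move/negbTE.
have mono j j' : j <= j' -> j' < wd -> a 0 j (KE M) -> a 0 j' (KE M).
  elim: j' => [|j' IH]; first by rewrite leqn0 => /eqP ->.
  rewrite leq_eqVlt => /orP[/eqP -> //|le_j] lt_j' Ej.
  have := initP j' (ord0, @Ordinal 9 8 isT) lt_j'.
  by rewrite /tsat /= eqbF_neg eqb_id !addn0 !addn1 IH //; lia.
(* The first end mark is the length of the input. By monotonicity the marks are then exactly those
   of a word of length [L]. *)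
have [L EL minL] := ex_minnP (ex_intro (fun j => a 0 j (KE M)) _ H5).
have le_L := minL _ H5.
have lt_L : size dw <= L.
  (* An end mark inside [dw] would propagate to its last position, where it is excluded. *)
  rewrite leqNgt; apply: contra H4 => lt_L; apply: mono EL; lia.
pose s := [seq a 0 j (KB M) | j <- iota 0 L].
have size_s : size s = L by rewrite size_map size_iota.
have nth_s j : j < L -> nth false s j = a 0 j (KB M).
  by move=> lt_j; rewrite (nth_map 0) ?size_iota // nth_iota.
have sE : s = dw ++ drop (size dw) s.
  rewrite -{1}(cat_take_drop (size dw) s); congr (_ ++ _).
  apply: (@eq_from_nth _ false); rewrite size_takel ?size_s // => j lt_j.
  by rewrite nth_take // nth_s ?H3 //; lia.
exists (drop (size dw) s); first by rewrite size_drop size_s; lia.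
rewrite -sE => t lt_t; apply: (@rules_accept M a wd T) => //.
- move=> j lt_j; rewrite size_s; apply/idP/idP => [/minL //|le_Lj].
  exact: mono EL.
- by move=> j; rewrite size_s => lt_j; rewrite nth_s.
- by rewrite size_s; lia.
Qed.

End Tableau.

(** * The reduction from an arbitrary language in NP *)

Lemma halted_trace (M : machine) s t t' : halting (current (trace M s t)) ->
  halting (current (trace M s t')) -> trace M s t = trace M s t'.
Proof.
have stay m n : halting (current (trace M s m)) -> trace M s (n + m) = trace M s m.
  move=> halt_m; elim: n => // n IH.
  by rewrite addSn -[LHS]/(step (trace M s (n + m))) IH /step halt_m.
move=> halt_t halt_t'; have [le|lt] := leqP t t'.
  by rewrite -(subnK le) stay.
by rewrite -(subnK (ltnW lt)) stay.
Qed.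

Lemma accepts_run (M : machine) (T : nat) (s : seq bool) (b : bool) (n : nat) :
  n < T -> run_result M n s [:: b] -> accepts M T s <-> b.
Proof.
move=> lt_n [halt_n out_n]; rewrite -/(trace M s n) in halt_n out_n.
split=> [/(_ n lt_n halt_n)|b_true t lt_t halt_t].
  by move: out_n; rewrite /output; case: (tapes _ _) => l [[[]|x]|] r //= [<- _].
rewrite (halted_trace halt_t halt_n); move: out_n; rewrite /output b_true.
by case: (tapes _ _) => l [[[]|x]|] r.
Qed.

Theorem decomposition_NP_hard (R : realType) (L : language) : in_NP L ->
  polytime_reduces L (decomposition_problem R).
Proof.
case=> V [p [[chi [M [pM chiM]] VE] LE]].
(* [pair_code w u] is [dw w ++ u], so the witness is the free end of the input. *)
pose dw w := delimited w.
pose P (w : seq bool) := peval p (size w).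
(* A time bound for all inputs of length at most [size (dw w) + P w]; the successor makes the
   halting time strictly smaller. *)
pose T w := (peval pM (size (dw w) + P w)).+1.
pose wd w := T w + size (dw w) + P w + 3.
(* Rules at a time below [T w] also speak of the next time, hence one more row. *)
pose nv w := var_bound (kind M) (wd w) (T w).+1.
pose cs w := tableau M (dw w) (P w) (T w) (wd w).
exists (fun w => instance_code (nv w) (cs w)).
  have Hdw : pt dw by rewrite /dw; apply: pt_delimited; apply: pt_id.
  have HP : pt P by rewrite /P; apply: pt_poly; apply: pt_size_seq; apply: pt_id.
  have HT : pt T.
    by rewrite /T; apply: pt_succ; apply: pt_poly; apply: pt_add => //;
      apply: (pt_size_seq Hdw).
  have Hwd : pt wd by rewrite /wd; pt_solve.
  apply: pt_polytime; apply: pt_instance_code.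
    by rewrite /nv /var_bound; pt_solve.
  exact: pt_tableau.
move=> w.
have dw_gt0 : 0 < size (dw w) by rewrite size_delimited.
have T_wd : (T w).+1 < wd w by rewrite /wd; lia.
have P_wd : size (dw w) + P w < wd w by rewrite /wd; lia.
have runP u : size u <= P w -> accepts M (T w) (dw w ++ u) <-> V (pair_code w u).
  move=> size_u; rewrite VE; have [n le_n run_n] := chiM (pair_code w u).
  apply: accepts_run run_n; apply: leq_ltn_trans le_n _; rewrite /T ltnS.
  by apply: (peval_le pM); rewrite size_cat leq_add2l.
have nv_gt0 : 0 < nv w by [].
have cs_wf := wf_tableau M dw_gt0 (ltn0Sn _) T_wd P_wd.
rewrite LE; split=> [[u size_u /(runP _ size_u) acc]|D].
  have [tau tau0 tauP] := accepts_tableau dw_gt0 (ltn0Sn _) T_wd P_wd size_u acc.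
  exact: (sat_decomposition nv_gt0 cs_wf R tau0 tauP).
have [tau tau0 tauP] := decomposition_sat nv_gt0 cs_wf D.
have [u size_u acc] := tableau_accepts dw_gt0 (ltn0Sn _) T_wd P_wd tau0 tauP.
by exists u => //; apply/(runP _ size_u).
Qed.

Theorem theorem10 (R : realType) : NP_complete (decomposition_problem R).
Proof.
split; first exact: decomposition_in_NP.
by move=> L; apply: decomposition_NP_hard.
Qed.
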